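(* Let $d\ge2$ and let $p$ be a probability density on $[0,\infty)$ with $0<\int_0^\infty p(r)r^2\,dr<\infty$. Let $\bar p(\mathbf{x})=p(\|\mathbf{x}\|)/A(\|\mathbf{x}\|)$ on $\mathbb{R}^d$, where $A(r)$ is the surface area of the sphere of radius $r$ in $\mathbb{R}^d$, and for a kernel $k$ let $(T_kf)(\mathbf{x})=\int_{\mathbb{R}^d}k(\mathbf{x},\mathbf{z})f(\mathbf{z})\bar p(\mathbf{z})\,d\mathbf{z}$. Let $\kappa_0,\kappa_1:[-1,1]\to\mathbb{R}$ be continuous and such that $(\mathbf{u},\mathbf{v})\mapsto\kappa_i(\mathbf{u}^T\mathbf{v})$ is a positive definite kernel on $\mathbb{S}^{d-1}$, $i=0,1$. Write $r_x=\|\mathbf{x}\|$, $\hat{\mathbf{x}}=\mathbf{x}/r_x$. (1) Let $k_0(\mathbf{x},\mathbf{z})=r_xr_z\kappa_0(\hat{\mathbf{x}}^T\hat{\mathbf{z}})$ (homogeneous of order 1). Then for every spherical harmonic $Y_{k,j}$ of $\mathbb{S}^{d-1}$, the function $\Psi_{k,j}(\mathbf{x})=a\,r_xY_{k,j}(\hat{\mathbf{x}})$ is an eigenfunction of $T_{k_0}$, and for a suitable constant $a>0$ (independent of $k,j$) the family $\{\Psi_{k,j}\}$ is orthonormal in $L^2(\bar p)$, giving $k_0(\mathbf{x},\mathbf{z})=\sum_k\lambda'_k\sum_j\Psi_{k,j}(\mathbf{x})\Psi_{k,j}(\mathbf{z})$. (2) Let $k=k_0+k_1$ with $k_1(\mathbf{x},\mathbf{z})=\kappa_1(\hat{\mathbf{x}}^T\hat{\mathbf{z}})$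 (homogeneous of order 0). Then for every spherical harmonic $Y_{k,j}$, the two-dimensional space $\{(ar_x+b)Y_{k,j}(\hat{\mathbf{x}}):a,b\in\mathbb{R}\}$ is invariant under $T_k$; consequently $T_k$ has eigenfunctions of the form $\Psi(\mathbf{x})=(ar_x+b)Y_{k,j}(\hat{\mathbf{x}})$, and the eigenfunctions of $k$ are of this form.
   Context: Spherical harmonics $Y_{k,j}$, $j=1,\dots,N(d,k)$, form an orthonormal basis (uniform measure on $\mathbb{S}^{d-1}$) of the degree-$k$ spherical harmonics; they are eigenfunctions of every continuous zonal kernel on $\mathbb{S}^{d-1}$. *)

(* Defs.v *)
From HB Require Import structures.
From mathcomp Require Import all_boot all_order all_algebra.
From mathcomp Require Import all_classical all_reals all_analysis.
Set Implicit Arguments. Unset Strict Implicit. Unset Printing Implicit Defensive.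
Import Order.TTheory GRing.Theory Num.Theory.
Import numFieldNormedType.Exports.
Local Open Scope classical_set_scope.
Local Open Scope ring_scope.

Section Defs.
Variable R : realType.

(* Euclidean inner product and Euclidean norm on R^d = 'rV[R]_d
   (the library norm on matrices is the sup norm, hence not used). *)
Definition dotv d (u v : 'rV[R]_d) : R := \sum_(i < d) u 0 i * v 0 i.
Definition enorm d (x : 'rV[R]_d) : R := Num.sqrt (dotv x x).
(* x-hat = x / ||x|| (with the convention 0^-1 = 0, so hat 0 = 0). *)
Definition hatv d (x : 'rV[R]_d) : 'rV[R]_d := (enorm x)^-1 *: x.

(* Lebesgue integral over R^d, as the iterated one-dimensional Lebesgue
   integral (equal to the d-dimensional Lebesgue integral for integrable or
   nonnegative measurable integrands, by Fubini--Tonelli). *)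
Fixpoint iint (d : nat) : ('rV[R]_d -> R) -> \bar R :=
  match d with
  | 0 => fun f => (f 0)%:E
  | d'.+1 => fun f =>
      (\int[@lebesgue_measure R]_(t in [set: R])
         iint (fun v : 'rV[R]_d' => f (row_mx (\row_(_ < 1) t) v)))%E
  end.

Definition ball_vol d : R :=
  fine (iint (fun x : 'rV[R]_d => if enorm x <= 1 then 1 else 0)).
Definition sphere_area d (r : R) : R := d%:R * ball_vol d * r ^+ d.-1.

(* Integral against the normalized uniform (surface) measure on S^{d-1},
   realized as the normalized cone measure: avg_S g = (1/|B|) int_B g(x/|x|) dx. *)
Definition sphere_int d (g : 'rV[R]_d -> R) : \bar R :=
  (iint (fun x : 'rV[R]_d => ((if enorm x <= 1 then 1 else 0) * g (hatv x))%R)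
   * ((ball_vol d)^-1)%:E)%E.

Definition pbar d (p : R -> R) (x : 'rV[R]_d) : R :=
  p (enorm x) / sphere_area d (enorm x).

Definition Top d (p : R -> R) (k : 'rV[R]_d -> 'rV[R]_d -> R)
  (f : 'rV[R]_d -> R) (x : 'rV[R]_d) : \bar R :=
  iint (fun z => k x z * f z * pbar p z).

Definition L2ip d (p : R -> R) (f g : 'rV[R]_d -> R) : \bar R :=
  iint (fun z => f z * g z * pbar p z).

Definition sph_pd d (kappa : R -> R) : Prop :=
  forall (n : nat) (u : 'I_n -> 'rV[R]_d) (c : 'I_n -> R),
    (forall i, enorm (u i) = 1) ->
    0 <= \sum_(i < n) \sum_(j < n) c i * c j * kappa (dotv (u i) (u j)).

Definition homog_poly d (k : nat) (P : 'rV[R]_d -> R) : Prop :=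
  exists c : {ffun 'I_d -> 'I_k.+1} -> R,
    forall x, P x = \sum_(m : {ffun 'I_d -> 'I_k.+1} | (\sum_(i < d) (m i : nat))%N == k)
                      c m * \prod_(i < d) x 0 i ^+ m i.

Definition laplacian d (P : 'rV[R]_d -> R) (x : 'rV[R]_d) : R :=
  \sum_(i < d) derive (fun y => derive P y (delta_mx 0 i)) x (delta_mx 0 i).

Definition sph_harm d (k : nat) (Y : 'rV[R]_d -> R) : Prop :=
  exists P, homog_poly k P /\ (forall x, laplacian P x = 0) /\
            (forall u, enorm u = 1 -> Y u = P u).

Definition sph_harm_basis d (N : nat -> nat) (Y : nat -> nat -> 'rV[R]_d -> R) : Prop :=
  [/\ (forall k j, (j < N k)%N -> sph_harm k (Y k j)),
      (forall k j k' j', (j < N k)%N -> (j' < N k')%N ->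
         sphere_int (fun u => Y k j u * Y k' j' u)
         = (if (k == k') && (j == j') then 1 else 0)%:E) &
      (forall k Z, sph_harm k Z -> exists c : nat -> R,
         forall u, enorm u = 1 -> Z u = \sum_(j < N k) c j * Y k j u)].

End Defs.

Definition radial_sh (R : realType) d (a b : R) (Y : 'rV[R]_d -> R) (x : 'rV[R]_d) : R :=
  ((a * enorm x + b) * Y (hatv x))%R.

(* Main.v *)
(* With [e] a unit vector, the Funk-Hecke formula holds because a harmonic of degree [k]
   that depends only on [dotv e u] is a polynomial of degree [k] in [dotv e u] orthogonal to
   all lower ones, hence is unique up to a factor; the projection of [kappa (dotv e u)] on the
   harmonics of degree [k] is such a function. The eigenvalue is nonnegative: average the
   positive definite form over many independent random points weighted by an eigenfunction.
   Smoothing [kappa] with the kernels [((1 + t) / 2) ^ m] gives finite expansions whose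
   coefficients are those of [kappa] times factors in [0, 1] tending to 1, and Tannery's
   theorem yields the pointwise expansion of [kappa]. In polar coordinates the operators
   then reduce, for each harmonic, to the span of the radial functions [r] and [1], where
   they become a 2 x 2 matrix, symmetric for the Gram form of the moments of [p]. *)
Require Import Defs.
From HB Require Import structures.
From mathcomp Require Import all_boot all_order all_algebra.
From mathcomp Require Import all_classical all_reals all_analysis.
From mathcomp Require Import measurable_realfun.
From mathcomp Require Import ring lra.
Set Implicit Arguments. Unset Strict Implicit. Unset Printing Implicit Defensive.
Import Order.TTheory GRing.Theory Num.Theory.
Import numFieldNormedType.Exports.
Local Open Scope classical_set_scope.
Local Open Scope ring_scope.

Lemma cvg_sum {T I : Type} {F : set_system T} {FF : Filter F} {K : numFieldType}
    {V : pseudoMetricNormedZmodType K} (r : seq I) (f : I -> T -> V) (l : I -> V) :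
  (forall i, f i x @[x --> F] --> l i) ->
  \sum_(i <- r) f i x @[x --> F] --> \sum_(i <- r) l i.
Proof.
move=> fl; elim: r => [|i r IH].
  by rewrite big_nil; under eq_fun do rewrite big_nil; exact: cvg_cst.
by rewrite big_cons; under eq_fun do rewrite big_cons; exact: cvgD.
Qed.

(** * Euclidean geometry of row vectors *)

Section euclidean.
Variables (R : realType) (d : nat).
Implicit Types (x y z u v e n : 'rV[R]_d) (O : 'M[R]_d) (a : R).

Lemma dotvE x y : dotv x y = (x *m y^T) 0 0.
Proof. by rewrite mxE; apply: eq_bigr => i _; rewrite mxE. Qed.

Lemma dotvC x y : dotv x y = dotv y x.
Proof. by apply: eq_bigr => i _; rewrite mulrC. Qed.

Lemma dotvDl x y z : dotv (x + y) z = dotv x z + dotv y z.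
Proof. by rewrite !dotvE mulmxDl mxE. Qed.

Lemma dotvZl a x y : dotv (a *: x) y = a * dotv x y.
Proof. by rewrite !dotvE -scalemxAl mxE. Qed.

Lemma dotvNl x y : dotv (- x) y = - dotv x y.
Proof. by rewrite !dotvE mulNmx mxE. Qed.

Lemma dotvDr x y z : dotv x (y + z) = dotv x y + dotv x z.
Proof. by rewrite dotvC dotvDl !(dotvC x). Qed.

Lemma dotvZr a x y : dotv x (a *: y) = a * dotv x y.
Proof. by rewrite dotvC dotvZl dotvC. Qed.

Lemma dotvNr x y : dotv x (- y) = - dotv x y.
Proof. by rewrite dotvC dotvNl dotvC. Qed.

Definition dotv_bilinear :=
  (dotvDl, dotvDr, dotvZl, dotvZr, dotvNl, dotvNr).

Lemma dot0v x : dotv 0 x = 0.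
Proof. by rewrite dotvE mul0mx mxE. Qed.

Lemma dotv_delta x i : dotv x (delta_mx 0 i) = x 0 i.
Proof.
rewrite /dotv (bigD1 i)//= mxE !eqxx mulr1 big1 ?addr0// => j /negbTE ji.
by rewrite mxE ji andbF mulr0.
Qed.

Lemma dotv_ge0 x : 0 <= dotv x x.
Proof. by apply: sumr_ge0 => i _; rewrite -expr2 sqr_ge0. Qed.

Lemma dotv_eq0 x : (dotv x x == 0) = (x == 0).
Proof.
apply/eqP/eqP => [/eqP|->]; last exact: dot0v.
rewrite psumr_eq0 => [/allP x0|i _]; last by rewrite -expr2 sqr_ge0.
apply/rowP => i; rewrite mxE; have := x0 i (mem_index_enum _).
by rewrite -expr2 sqrf_eq0 => /eqP.
Qed.

Lemma enorm_ge0 x : 0 <= enorm x.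
Proof. exact: sqrtr_ge0. Qed.

Lemma sqr_enorm x : enorm x ^+ 2 = dotv x x.
Proof. by rewrite sqr_sqrtr ?dotv_ge0. Qed.

Lemma enorm_eq0 x : (enorm x == 0) = (x == 0).
Proof. by rewrite -sqrf_eq0 sqr_enorm dotv_eq0. Qed.

Lemma enorm0 : enorm (0 : 'rV[R]_d) = 0.
Proof. by apply/eqP; rewrite enorm_eq0. Qed.

Lemma enorm_gt0 x : (0 < enorm x) = (x != 0).
Proof. by rewrite lt_neqAle enorm_ge0 andbT eq_sym enorm_eq0. Qed.

Lemma enormZ a x : enorm (a *: x) = `|a| * enorm x.
Proof.
by rewrite /enorm !dotv_bilinear mulrA -expr2 sqrtrM ?sqr_ge0// sqrtr_sqr.
Qed.

Lemma enorm_le x a : 0 <= a -> (enorm x <= a) = (dotv x x <= a ^+ 2).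
Proof. by move=> a0; rewrite -sqr_enorm ler_sqr ?nnegrE ?enorm_ge0. Qed.

Lemma coord_le_enorm x i : `|x 0 i| <= enorm x.
Proof.
rewrite -sqrtr_sqr ler_wsqrtr// /dotv (bigD1 i)//= expr2 lerDl.
by apply: sumr_ge0 => j _; rewrite -expr2 sqr_ge0.
Qed.

Definition usphere : set 'rV[R]_d := [set u | enorm u = 1].

Lemma usphereE u : usphere u <-> dotv u u = 1.
Proof.
by split=> u1; [rewrite -sqr_enorm u1 expr1n|rewrite /usphere/= /enorm u1 sqrtr1].
Qed.

Lemma usphere_delta i : usphere (delta_mx 0 i).
Proof. by apply/usphereE; rewrite dotv_delta mxE !eqxx. Qed.

Lemma enorm_hatv x : x != 0 -> enorm (hatv x) = 1.
Proof.
by move=> x0; rewrite enormZ ger0_norm ?invr_ge0 ?enorm_ge0// mulVf// enorm_eq0.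
Qed.

Lemma hatv0 : hatv (0 : 'rV[R]_d) = 0.
Proof. exact: scaler0. Qed.

Lemma hatv_usphere u : usphere u -> hatv u = u.
Proof. by rewrite /hatv => ->; rewrite invr1 scale1r. Qed.

Lemma usphere_hatv x : usphere (hatv x) <-> x != 0.
Proof.
split=> [|/enorm_hatv//]; apply: contraPneq => ->.
by rewrite /usphere/= hatv0 enorm0 => /esym/eqP; rewrite oner_eq0.
Qed.

Lemma hatvZ a x : 0 < a -> hatv (a *: x) = hatv x.
Proof.
move=> a0; rewrite /hatv enormZ gtr0_norm// invfM scalerA mulrAC mulVf ?mul1r//.
by rewrite gt_eqF.
Qed.

Lemma enorm_scale_hatv x : enorm x *: hatv x = x.
Proof.
have [->|x0] := eqVneq x 0; first by rewrite hatv0 scaler0.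
by rewrite scalerA divff ?scale1r// enorm_eq0.
Qed.

Lemma normr_dotv_le1 u v : usphere u -> usphere v -> `|dotv u v| <= 1.
Proof.
move=> /usphereE uu /usphereE vv; rewrite ler_norml.
have := dotv_ge0 (u - v); have := dotv_ge0 (u + v).
by rewrite !dotv_bilinear (dotvC v u) uu vv; lra.
Qed.

Lemma dotv_itv u v : usphere u -> usphere v -> `[-1, 1]%classic (dotv u v).
Proof. by move=> u1 v1; rewrite /= in_itv/= -ler_norml normr_dotv_le1. Qed.

Lemma usphere_exists_orth e : (1 < d)%N -> usphere e ->
  exists2 e', usphere e' & dotv e e' = 0.
Proof.
move=> d1 e1.
have [i ei] : exists i, e 0 i ^+ 2 < 1.
  pose i0 : 'I_d := Ordinal (ltnW d1); pose i1 : 'I_d := Ordinal d1.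
  have [h|h] := ltP (e 0 i0 ^+ 2) 1; first by exists i0.
  exists i1; move/usphereE : e1.
  rewrite /dotv (bigD1 i0)//= (bigD1 i1)//= -!expr2 => e1.
  have : 0 <= \sum_(i < d | (i != i0) && (i != i1)) e 0 i * e 0 i.
    by apply: sumr_ge0 => i _; rewrite -expr2 sqr_ge0.
  lra.
pose w := delta_mx 0 i - e 0 i *: e.
have ww : dotv w w = 1 - e 0 i ^+ 2.
  rewrite !dotv_bilinear (dotvC _ e) !dotv_delta (usphereE e).1//.
  by rewrite mxE !eqxx/=; ring.
exists (hatv w); first by apply/usphere_hatv; rewrite -dotv_eq0 ww; lra.
by rewrite !dotv_bilinear dotv_delta (usphereE e).1// mulr1 subrr mulr0.
Qed.

Definition orthogonal_mx O := O *m O^T = 1%:M.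

Lemma orthogonal_mx1 : orthogonal_mx 1%:M.
Proof. by rewrite /orthogonal_mx trmx1 mulmx1. Qed.

Lemma orthogonal_mx_tr O : orthogonal_mx O -> orthogonal_mx O^T.
Proof. by move=> /mulmx1C; rewrite /orthogonal_mx trmxK. Qed.

Lemma mulmx_orthogonalK O x : orthogonal_mx O -> x *m O *m O^T = x.
Proof. by move=> oO; rewrite -mulmxA oO mulmx1. Qed.

Lemma mulmx_orthogonalVK O x : orthogonal_mx O -> x *m O^T *m O = x.
Proof. by move=> /mulmx1C oO; rewrite -mulmxA oO mulmx1. Qed.

Lemma dotv_mulmx O x y : orthogonal_mx O -> dotv (x *m O) (y *m O) = dotv x y.
Proof. by move=> oO; rewrite !dotvE trmx_mul mulmxA mulmx_orthogonalK. Qed.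

Lemma enorm_mulmx O x : orthogonal_mx O -> enorm (x *m O) = enorm x.
Proof. by move=> oO; rewrite /enorm dotv_mulmx. Qed.

Lemma hatv_mulmx O x : orthogonal_mx O -> hatv (x *m O) = hatv x *m O.
Proof. by move=> oO; rewrite /hatv enorm_mulmx// scalemxAl. Qed.

Lemma usphere_mulmx O u : orthogonal_mx O -> usphere (u *m O) <-> usphere u.
Proof. by move=> oO; rewrite /usphere/= enorm_mulmx. Qed.

Definition householder n : 'M[R]_d := 1%:M - 2 *: (n^T *m n).

Lemma mulmx_householder n x :
  x *m householder n = x - (2 * dotv x n) *: n.
Proof.
rewrite mulmxBr mulmx1 -scalemxAr mulmxA -scalerA.
by rewrite [x *m n^T]mx11_scalar mul_scalar_mx dotvE.
Qed.

Lemma householder_orthogonal n : usphere n -> orthogonal_mx (householder n).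
Proof.
move=> /usphereE n1; rewrite /orthogonal_mx.
have -> : (householder n)^T = householder n.
  by rewrite /householder linearB linearZ/= trmx1 trmx_mul trmxK.
apply/row_matrixP => i; rewrite -[X in X *m _]mul1mx -mulmxA !row_mul row1.
rewrite mulmxA !mulmx_householder !dotv_bilinear n1 mulr1 -addrA -opprD -scalerDl.
by rewrite [X in X *: _](_ : _ = 0) ?scale0r ?subr0//; ring.
Qed.

(* The witness is the reflection exchanging [u] and [v]. *)
Lemma orthogonal_mx_transitive e u v :
  enorm u = enorm v -> dotv e u = dotv e v ->
  exists O, [/\ orthogonal_mx O, u *m O = v & e *m O = e].
Proof.
move=> uv euv; have [<-|vu] := eqVneq u v.
  by exists 1%:M; rewrite !mulmx1; split => //; exact: orthogonal_mx1.
have w0 : u - v != 0 by rewrite subr_eq0.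
have uvv : 2 * dotv u (hatv (u - v)) * (enorm (u - v))^-1 = 1.
  have e0 : enorm (u - v) != 0 by rewrite enorm_eq0.
  rewrite dotvZr; transitivity (2 * dotv u (u - v) / enorm (u - v) ^+ 2).
    by field.
  rewrite [X in X / _](_ : _ = enorm (u - v) ^+ 2) ?divff ?expf_neq0//.
  by rewrite sqr_enorm !dotv_bilinear (dotvC v u) -!sqr_enorm uv; ring.
exists (householder (hatv (u - v))); split; rewrite ?mulmx_householder.
- exact/householder_orthogonal/enorm_hatv.
- by rewrite scalerA uvv scale1r subKr.
- by rewrite dotvZr dotvDr dotvNr euv subrr !mulr0 scale0r subr0.
Qed.

End euclidean.
Arguments usphere {R d}.

(** * Lebesgue measure on row vectors *)

Section measure_complements.
Context d1 d2 (T1 : measurableType d1) (T2 : measurableType d2) (R : realType).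

Definition image_measure (m : {measure set T1 -> \bar R}) (f : T1 -> T2)
  (mf : measurable_fun [set: T1] f) : {measure set T2 -> \bar R}.
Proof. by refine (pushforward m f). Defined.

Lemma measurable_set_of_bool (b : T1 -> bool) :
  measurable_fun [set: T1] b -> measurable [set x | b x].
Proof.
by move=> /(_ measurableT [set true] I); rewrite setTI; congr measurable.
Qed.

Lemma integral_prod_mul (m1 : {sigma_finite_measure set T1 -> \bar R})
    (m2 : {sigma_finite_measure set T2 -> \bar R}) (f : T1 -> R) (g : T2 -> R) :
  m1.-integrable setT (EFin \o f) -> m2.-integrable setT (EFin \o g) ->
  (m1 \x m2)%E.-integrable setT (fun z => (f z.1 * g z.2)%:E) /\
  (\int[m1 \x m2]_z (f z.1 * g z.2)%:E =
   \int[m1]_x (f x)%:E * \int[m2]_y (g y)%:E)%E.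
Proof.
move=> fi gi; have /integrableP[/measurable_EFinP mf foo] := fi.
have /integrableP[/measurable_EFinP mg goo] := gi.
have fgi : (m1 \x m2)%E.-integrable setT (fun z => (f z.1 * g z.2)%:E).
  apply/integrable12ltyP => /=.
    by apply/measurable_EFinP; apply: measurable_funM; exact: measurableT_comp.
  have mng : measurable_fun setT (fun y => `|g y|%:E).
    exact/measurable_EFinP/measurableT_comp.
  have mnf : measurable_fun setT (fun x => `|f x|%:E).
    exact/measurable_EFinP/measurableT_comp.
  under eq_integral => x _.
    under eq_integral do rewrite normrM EFinM.
    rewrite ge0_integralZl//=.
    over.
  rewrite /= ge0_integralZr ?integral_ge0//= lte_mul_pinfty ?integral_ge0//.
  by rewrite ge0_fin_numE// integral_ge0.
split=> //; rewrite -integral12_prod_meas1//= -(fineK (integrable_fin_num _ gi))//.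
rewrite -integralZr//; apply: eq_integral => x _ /=; rewrite /fubini_F fineK.
  by rewrite -integralZl.
exact: integrable_fin_num.
Qed.

End measure_complements.

Definition row_display : measure_display.
Proof. exact: default_measure_display. Qed.

Section measurable_row.
Variables (R : realType) (d : nat).

Let coord (i : 'I_d) (x : 'rV[R]_d) : measurableTypeR R := x 0 i.

Let row_set0 : g_sigma_preimage coord set0.
Proof. exact: sigma_algebra0. Qed.

Let row_setC A : g_sigma_preimage coord A -> g_sigma_preimage coord (~` A).
Proof. exact: sigma_algebraC. Qed.

Let row_bigcup (F : _^nat) : (forall i, g_sigma_preimage coord (F i)) ->
  g_sigma_preimage coord (\bigcup_i (F i)).
Proof. exact: sigma_algebra_bigcup. Qed.

HB.instance Definition _ := @isMeasurable.Build row_display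
  ('rV[R]_d) (g_sigma_preimage coord) row_set0 row_setC row_bigcup.

Lemma measurable_row_coord (i : 'I_d) :
  measurable_fun [set: 'rV[R]_d] (fun x => x 0 i : measurableTypeR R).
Proof.
move=> _ B mB; rewrite setTI; apply: sub_sigma_algebra => /=.
rewrite -bigcup_seq/=; exists i => /=; first by rewrite mem_index_enum.
by exists B => //; rewrite setTI.
Qed.

Lemma measurable_fun_row dd (T : measurableType dd) (f : T -> 'rV[R]_d) :
  (forall i, measurable_fun [set: T] (fun t => f t 0 i)) ->
  measurable_fun [set: T] f.
Proof.
move=> mf _ A mA; rewrite setTI.
have : preimage_set_system [set: T] f (g_sigma_preimage coord) `<=` measurable.
  rewrite -g_sigma_preimageE; apply: smallest_sub.
    exact: sigma_algebra_measurable.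
  move=> _ [B + <-]; rewrite -bigcup_seq/= => -[i _ [C mC <-]].
  by rewrite !setTI; have := mf i measurableT C mC; rewrite setTI.
by apply; exists A => //; rewrite setTI.
Qed.

Lemma measurable_fun_rowD dd (T : measurableType dd) (f g : T -> 'rV[R]_d) :
  measurable_fun [set: T] f -> measurable_fun [set: T] g ->
  measurable_fun [set: T] (fun t => f t + g t).
Proof.
move=> mf mg; apply: measurable_fun_row => i; under eq_fun do rewrite mxE.
by apply: measurable_funD; exact: (measurableT_comp (measurable_row_coord i)).
Qed.

Lemma measurable_fun_rowZ dd (T : measurableType dd) (a : T -> R) (f : T -> 'rV[R]_d) :
  measurable_fun [set: T] a -> measurable_fun [set: T] f ->
  measurable_fun [set: T] (fun t => a t *: f t).
Proof.
move=> ma mf; apply: measurable_fun_row => i; under eq_fun do rewrite mxE.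
by apply: measurable_funM => //; exact: (measurableT_comp (measurable_row_coord i)).
Qed.

Lemma measurable_fun_mulmx (O : 'M[R]_d) :
  measurable_fun [set: 'rV[R]_d] (fun x => x *m O).
Proof.
apply: measurable_fun_row => i; under eq_fun do rewrite mxE.
by apply: measurable_sum => j; apply: measurable_funM => //; exact: measurable_row_coord.
Qed.

End measurable_row.

Section row_cons.
Variable R : realType.

Definition row_cons d (t : R) (v : 'rV[R]_d) : 'rV[R]_d.+1 :=
  row_mx (\row_(_ < 1) t) v.

Definition row_tail d (x : 'rV[R]_d.+1) : 'rV[R]_d :=
  @rsubmx R 1 1 d (x : 'rV[R]_(1 + d)).

Lemma row_cons0E d t (v : 'rV[R]_d) : row_cons t v 0 0 = t.
Proof.
rewrite /row_cons (_ : (0 : 'I_d.+1) = lshift d (0 : 'I_1)); last exact: val_inj.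
by rewrite (@row_mxEl _ 1 1 d) mxE.
Qed.

Lemma row_consSE d t (v : 'rV[R]_d) i : row_cons t v 0 (lift 0 i) = v 0 i.
Proof.
rewrite /row_cons (_ : lift 0 i = rshift 1 i); last exact: val_inj.
by rewrite (@row_mxEr _ 1 1 d).
Qed.

Lemma row_tailE d (x : 'rV[R]_d.+1) i : row_tail x 0 i = x 0 (lift 0 i).
Proof. by rewrite mxE; congr (x _ _); exact: val_inj. Qed.

Lemma row_tail_cons d t (v : 'rV[R]_d) : row_tail (row_cons t v) = v.
Proof. by apply/rowP => i; rewrite row_tailE row_consSE. Qed.

Lemma row_cons_affine d (a t s : R) (v w : 'rV[R]_d) :
  a *: row_cons t v + row_cons s w = row_cons (a * t + s) (a *: v + w).
Proof.
apply/rowP => i; rewrite [LHS]mxE [X in X + _]mxE.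
have [j ->|->] := unliftP 0 i; last by rewrite !row_cons0E.
by rewrite !row_consSE [RHS]mxE [X in _ = X + _]mxE.
Qed.

Lemma row_cons_tail d (x : 'rV[R]_d.+1) : row_cons (x 0 0) (row_tail x) = x.
Proof.
apply/rowP => i; have [j ->|->] := unliftP 0 i; last exact: row_cons0E.
by rewrite row_consSE row_tailE.
Qed.

Lemma measurable_fun_row_cons dd (T : measurableType dd) d (f : T -> R)
    (g : T -> 'rV[R]_d) :
  measurable_fun [set: T] f -> measurable_fun [set: T] g ->
  measurable_fun [set: T] (fun t => row_cons (f t) (g t)).
Proof.
move=> mf mg; apply: measurable_fun_row => i.
have [j ->|->] := unliftP 0 i; last by under eq_fun do rewrite row_cons0E.
under eq_fun do rewrite row_consSE.
exact: (measurableT_comp (measurable_row_coord j) mg).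
Qed.

Lemma measurable_row_tail d : measurable_fun [set: 'rV[R]_d.+1] (@row_tail d).
Proof.
apply: measurable_fun_row => i; under eq_fun do rewrite row_tailE.
exact: measurable_row_coord.
Qed.

Definition row_cons_pair d (z : measurableTypeR R * 'rV[R]_d) := row_cons z.1 z.2.

Lemma measurable_row_cons_pair d :
  measurable_fun [set: (measurableTypeR R * 'rV[R]_d)%type] (@row_cons_pair d).
Proof. exact: measurable_fun_row_cons. Qed.

End row_cons.

Section lebesgue_row.
Variable R : realType.
Local Open Scope ereal_scope.

Section successor.
Variables (d : nat) (m : {sigma_finite_measure set 'rV[R]_d -> \bar R}).

Definition lebesgue_row_succ : set 'rV[R]_d.+1 -> \bar R :=
  image_measure (@lebesgue_measure R \x m) (@measurable_row_cons_pair R d).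

HB.instance Definition _ := Measure.on lebesgue_row_succ.

Lemma lebesgue_row_succX (A : set (measurableTypeR R)) (B : set 'rV[R]_d) :
  measurable A -> measurable B ->
  lebesgue_row_succ [set x : 'rV[R]_d.+1 | A (x 0%R 0%R) /\ B (row_tail x)] =
  lebesgue_measure A * m B.
Proof.
move=> mA mB; rewrite /lebesgue_row_succ /= /pushforward -product_measure1E//.
congr ((_ \x _) _); apply/seteqP.
by split=> -[t v] /=; rewrite /row_cons_pair row_cons0E row_tail_cons.
Qed.

Lemma lebesgue_row_succ_sigma_finite : sigma_finite setT lebesgue_row_succ.
Proof.
have /sigma_finiteP[F [TF ndF Foo]] := sigma_finiteT (@lebesgue_measure R).
have /sigma_finiteP[G [TG ndG Goo]] := sigma_finiteT m.
exists (fun n => [set x : 'rV[R]_d.+1 | F n (x 0%R 0%R) /\ G n (row_tail x)]).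
  apply/seteqP; split => // x _.
  have [n _ Fn] : (\bigcup_n F n) (x 0%R 0%R) by rewrite -TF.
  have [k _ Gk] : (\bigcup_n G n) (row_tail x) by rewrite -TG.
  exists (maxn n k) => //; split.
  - by move: Fn; exact/subsetPset/ndF/leq_maxl.
  - by move: Gk; exact/subsetPset/ndG/leq_maxr.
move=> k; have [mF Fk] := Foo k; have [mG Gk] := Goo k; split.
  apply: measurableI.
  - by rewrite -[X in measurable X]setTI; exact: measurable_row_coord.
  - by rewrite -[X in measurable X]setTI; exact: measurable_row_tail.
by rewrite lebesgue_row_succX// lte_mul_pinfty// ge0_fin_numE.
Qed.

HB.instance Definition _ := Measure_isSigmaFinite.Build _ _ _ lebesgue_row_succ
  lebesgue_row_succ_sigma_finite.

End successor.

Definition lebesgue_row0 : set 'rV[R]_0 -> \bar R := \d_(0 : 'rV[R]_0)%R.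

HB.instance Definition _ := Measure.on lebesgue_row0.

Let lebesgue_row0_sigma_finite : sigma_finite setT lebesgue_row0.
Proof.
exists (fun=> setT); first by rewrite bigcup_const.
by move=> _; split => //; rewrite /lebesgue_row0 diracT ltry.
Qed.

HB.instance Definition _ := Measure_isSigmaFinite.Build _ _ _ lebesgue_row0
  lebesgue_row0_sigma_finite.

Fixpoint lebesgue_row (d : nat) : {sigma_finite_measure set 'rV[R]_d -> \bar R} :=
  match d return {sigma_finite_measure set 'rV[R]_d -> \bar R} with
  | 0%N => lebesgue_row0
  | d'.+1 => lebesgue_row_succ (lebesgue_row d')
  end.

End lebesgue_row.

Section lebesgue_row_integral.
Variable R : realType.
Local Notation mu := (@lebesgue_measure R).
Local Open Scope ereal_scope.

Lemma lebesgue_row_consX d (A : set (measurableTypeR R)) (B : set 'rV[R]_d) :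
  measurable A -> measurable B ->
  lebesgue_row R d.+1 [set x : 'rV[R]_d.+1 | A (x 0%R 0%R) /\ B (row_tail x)] =
  mu A * lebesgue_row R d B.
Proof. exact: lebesgue_row_succX. Qed.

Lemma ge0_integral_row_cons d (f : 'rV[R]_d.+1 -> \bar R) :
  measurable_fun setT f -> (forall x, 0 <= f x) ->
  \int[lebesgue_row R d.+1]_x f x = \int[mu]_t \int[lebesgue_row R d]_v f (row_cons t v).
Proof.
move=> mf f0.
rewrite [LHS](ge0_integral_pushforward (@measurable_row_cons_pair R d))// preimage_setT.
apply: (@fubini_tonelli1 _ _ (measurableTypeR R) 'rV[R]_d R mu (lebesgue_row R d)
  (f \o @row_cons_pair R d)) => [|x] /=; last exact: f0.
by apply: (measurableT_comp mf); exact: measurable_row_cons_pair.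
Qed.

Lemma measurable_integral_row_cons d (f : 'rV[R]_d.+1 -> \bar R) :
  measurable_fun setT f -> (forall x, 0 <= f x) ->
  measurable_fun [set: R] (fun t => \int[lebesgue_row R d]_v f (row_cons t v)).
Proof.
move=> mf f0; apply: (@measurable_fun_fubini_tonelli_F _ _ (measurableTypeR R)
  'rV[R]_d R (lebesgue_row R d) (f \o @row_cons_pair R d)) => [|x] /=.
  by apply: (measurableT_comp mf); exact: measurable_row_cons_pair.
exact: f0.
Qed.

Lemma integrable_row_cons d (f : 'rV[R]_d.+1 -> \bar R) :
  (lebesgue_row R d.+1).-integrable setT f ->
  (mu \x lebesgue_row R d).-integrable setT (f \o @row_cons_pair R d).
Proof.
move=> /integrableP[mf foo]; apply/integrableP; split.
  by apply: (measurableT_comp mf); exact: measurable_row_cons_pair.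
apply: le_lt_trans foo.
rewrite [leRHS](ge0_integral_pushforward (@measurable_row_cons_pair R d))//=.
exact: measurableT_comp.
Qed.

Lemma integral_row_cons d (f : 'rV[R]_d.+1 -> \bar R) :
  (lebesgue_row R d.+1).-integrable setT f ->
  \int[lebesgue_row R d.+1]_x f x = \int[mu]_t \int[lebesgue_row R d]_v f (row_cons t v).
Proof.
move=> fi; have fi' := integrable_row_cons fi.
rewrite [RHS](integral12_prod_meas1 fi').
apply: (integral_pushforward (measurable_row_cons_pair (d := d))) => //.
by case/integrableP: fi.
Qed.

Lemma measurable_iint dd (T : measurableType dd) d (f : T -> 'rV[R]_d -> R) :
  measurable_fun [set: (T * 'rV[R]_d)%type] (fun z => f z.1 z.2) ->
  measurable_fun setT (fun p => iint (f p)).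
Proof.
elim: d dd T f => [|d IH] dd T f mf /=.
  apply/measurable_EFinP.
  apply: (measurableT_comp mf (f := fun z => f z.1 z.2) (g := fun p => (p, 0%R))).
  exact: measurable_fun_pair.
pose g (z : T * measurableTypeR R) := iint (fun v => f z.1 (row_cons z.2 v)).
have mg : measurable_fun setT g.
  apply: (IH _ _ (fun (z : T * measurableTypeR R) v => f z.1 (row_cons z.2 v))).
  apply: (measurableT_comp mf (f := fun z => f z.1 z.2)
    (g := fun q => (q.1.1, row_cons q.1.2 q.2))).
  apply: measurable_fun_pair; first exact: measurableT_comp.
  by apply: measurable_fun_row_cons => //; exact: measurableT_comp.
rewrite (_ : (fun p => _) = (fun p => \int[mu]_t g^\+ (p, t)) \-
  (fun p => \int[mu]_t g^\- (p, t))).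
  apply: emeasurable_funB.
  - apply: (measurable_fun_fubini_tonelli_F (m2 := lebesgue_measure) g^\+) => //.
    exact: measurable_funepos.
  - apply: (measurable_fun_fubini_tonelli_F (m2 := lebesgue_measure) g^\-) => //.
    exact: measurable_funeneg.
apply/funext => p; rewrite integralE; congr (_ - _).
- by apply: eq_integral => t _; rewrite !funeposE.
- by apply: eq_integral => t _; rewrite !funenegE.
Qed.

Lemma iint_integral d (f : 'rV[R]_d -> R) :
  (lebesgue_row R d).-integrable setT (EFin \o f) ->
  iint f = \int[lebesgue_row R d]_x (f x)%:E.
Proof.
elim: d f => [|d IH] f fi.
  rewrite /= /lebesgue_row0 integral_dirac//; last by case/integrableP: fi.
  by rewrite diracT mul1e.
have /integrableP[/measurable_EFinP mf _] := fi.
rewrite [RHS]integral_row_cons//=; apply: ae_eq_integral => //.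
- apply: (@measurable_iint _ (measurableTypeR R) d (fun t v => f (row_cons t v))).
  by apply: (measurableT_comp mf); exact: measurable_row_cons_pair.
- by have /measurable_fubini_F := integrable_row_cons fi; exact.
- have := ae_integrable1 (integrable_row_cons fi).
  by apply: filterS => t /= fti _; rewrite IH.
Qed.

Lemma lebesgue_measure_affine (r a : R) (A : set R) : (0 < r)%R -> measurable A ->
  mu A = r%:E * mu ((fun t => r * t + a)%R @^-1` A).
Proof.
move=> r0 mA; pose phi (t : measurableTypeR R) : measurableTypeR R := (r * t + a)%R.
have mphi : measurable_fun setT phi.
  by apply: measurable_funD => //; exact: measurable_funM.
have := @lebesgue_measure_unique R
  (mscale (NngNum (ltW r0)) (image_measure mu mphi)).
apply => // _ [[x y]] _ <- /=; rewrite /mscale /= /pushforward.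
rewrite (_ : phi @^-1` _ = `]((x - a) / r)%R, ((y - a) / r)%R]%classic); last first.
  apply/seteqP; split => t /=; rewrite !in_itv/= /phi ltr_pdivrMr//
    ler_pdivlMr// ltrBlDr lerBrDr mulrC//.
rewrite !lebesgue_measure_itv/= !lte_fin ltr_pM2r ?invr_gt0// ltrD2r.
case: ifPn => _; last by rewrite mule0.
by rewrite -!EFinB -EFinM; congr EFin; field; rewrite gt_eqF.
Qed.

Lemma ge0_integral_affine (r a : R) (f : R -> \bar R) : (0 < r)%R ->
  measurable_fun setT f -> (forall x, 0 <= f x) ->
  \int[mu]_t f t = r%:E * \int[mu]_t f (r * t + a)%R.
Proof.
move=> r0 mf f0.
have mphi : measurable_fun [set: measurableTypeR R]
    (fun t : measurableTypeR R => r * t + a : measurableTypeR R)%R.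
  by apply: measurable_funD => //; exact: measurable_funM.
rewrite (eq_measure_integral (mscale (NngNum (ltW r0)) (image_measure mu mphi))).
  rewrite ge0_integral_mscale//; congr (_ * _).
  by rewrite [LHS](ge0_integral_pushforward mphi)// preimage_setT.
by move=> A mA _; exact: (lebesgue_measure_affine a r0 mA).
Qed.

Lemma ge0_integral_row_affine d (r : R) (a : 'rV[R]_d) (f : 'rV[R]_d -> \bar R) :
  (0 < r)%R -> measurable_fun setT f -> (forall x, 0 <= f x) ->
  \int[lebesgue_row R d]_x f x =
  (r ^+ d)%:E * \int[lebesgue_row R d]_x f (r *: x + a)%R.
Proof.
move=> r0; elim: d a f => [|d IH] a f mf f0.
  rewrite expr0 mul1e; apply: eq_integral => x _; congr f.
  by apply/rowP => -[].
have mfa : measurable_fun setT (fun x : 'rV[R]_d.+1 => f (r *: x + a)%R).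
  apply: (measurableT_comp mf).
  by apply: measurable_fun_rowD => //; exact: measurable_fun_rowZ.
have fa0 x : 0 <= f (r *: x + a)%R by [].
rewrite (ge0_integral_row_cons mf f0) (ge0_integral_row_cons mfa fa0).
rewrite (ge0_integral_affine (a 0%R 0%R) r0 (measurable_integral_row_cons mf f0)); last first.
  by move=> t; exact: integral_ge0.
have mifa := measurable_integral_row_cons mfa fa0.
rewrite exprS EFinM -muleA; congr (_ * _); rewrite -ge0_integralZl//=; last 2 first.
- by move=> t _; exact: integral_ge0.
- by rewrite lee_fin exprn_ge0// ltW.
apply: eq_integral => t _; rewrite (IH (row_tail a))//; last first.
  by apply: (measurableT_comp mf); exact: measurable_fun_row_cons.
congr (_ * _); apply: eq_integral => v _.
by rewrite -[in RHS](row_cons_tail a) row_cons_affine.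
Qed.

Lemma ge0_integral_row_translate d (a : 'rV[R]_d) (f : 'rV[R]_d -> \bar R) :
  measurable_fun setT f -> (forall x, 0 <= f x) ->
  \int[lebesgue_row R d]_x f (x + a)%R = \int[lebesgue_row R d]_x f x.
Proof.
move=> mf f0; rewrite [RHS](ge0_integral_row_affine a ltr01 mf f0) expr1n mul1e.
by under [in RHS]eq_integral do rewrite scale1r.
Qed.

Lemma ge0_integral_row_scale d (r : R) (f : 'rV[R]_d -> \bar R) :
  (0 < r)%R -> measurable_fun setT f -> (forall x, 0 <= f x) ->
  \int[lebesgue_row R d]_x f x = (r ^+ d)%:E * \int[lebesgue_row R d]_x f (r *: x)%R.
Proof.
move=> r0 mf f0; rewrite (ge0_integral_row_affine 0%R r0 mf f0).
by under eq_integral do rewrite addr0.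
Qed.

End lebesgue_row_integral.

Section euclidean_measurability.
Variables (R : realType) (d : nat).

Lemma measurable_invr : measurable_fun [set: R] (fun x : R => x^-1).
Proof.
have -> : (fun x : R => x^-1) = fun x => if x == 0 then 0 else x^-1.
  by apply/funext => x; case: eqP => // ->; rewrite invr0.
apply: measurable_fun_if => //; first exact: measurable_fun_eqr.
rewrite setTI (_ : _ @^-1` _ = [set x : R | x != 0]); last first.
  by apply/seteqP; split => x /=; case: eqP.
apply: open_continuous_measurable_fun; first exact: open_neq.
by move=> x; rewrite inE/= => x0; apply: inv_continuous.
Qed.

Lemma measurable_dotv (u : 'rV[R]_d) : measurable_fun setT (dotv u).
Proof.
by apply: measurable_sum => i; apply: measurable_funM => //; exact: measurable_row_coord.
Qed.

Lemma measurable_enorm : measurable_fun setT (@enorm R d).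
Proof.
have msqrt : measurable_fun setT (@Num.sqrt R).
  by apply: continuous_measurable_fun; exact: sqrt_continuous.
apply: (measurableT_comp msqrt).
by apply: measurable_sum => i; apply: measurable_funM; exact: measurable_row_coord.
Qed.

Lemma measurable_hatv : measurable_fun setT (@hatv R d).
Proof.
apply: measurable_fun_rowZ => //.
exact: (measurableT_comp measurable_invr measurable_enorm).
Qed.

Lemma measurable_usphere : measurable (usphere : set 'rV[R]_d).
Proof.
rewrite (_ : usphere = [set x : 'rV[R]_d | enorm x == 1]).
  apply: measurable_set_of_bool; apply: measurable_fun_eqr => //.
  exact: measurable_enorm.
by apply/seteqP; split => x /eqP.
Qed.

Lemma continuous_dotv (u : 'rV[R]_d) : continuous (dotv u).
Proof.
move=> x; apply: (cvg_sum (F := nbhs x)) => i.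
by apply: cvgM; [exact: cvg_cst|exact: coord_continuous].
Qed.

Lemma continuous_enorm : continuous (@enorm R d).
Proof.
move=> x; apply: (@continuous_comp _ _ _ (fun x : 'rV[R]_d => dotv x x) Num.sqrt).
  by apply: (cvg_sum (F := nbhs x)) => i; apply: cvgM; exact: coord_continuous.
exact: sqrt_continuous.
Qed.

Definition unit_ball : set 'rV[R]_d := [set x | enorm x <= 1].

Lemma measurable_unit_ball : measurable unit_ball.
Proof.
apply: measurable_set_of_bool; apply: measurable_fun_ler => //.
exact: measurable_enorm.
Qed.

Lemma mem_unit_ball x : (x \in unit_ball) = (enorm x <= 1).
Proof. by apply/idP/idP; rewrite inE. Qed.

End euclidean_measurability.
Arguments unit_ball {R d}.

Section row_volume.
Variable R : realType.
Local Notation leb := (lebesgue_row R).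
Local Open Scope ereal_scope.

Definition cube d (c : 'rV[R]_d) (e : R) : set 'rV[R]_d :=
  [set x | forall i, (`|x 0 i - c 0 i| <= e)%R].

Lemma measurable_cube d (c : 'rV[R]_d) e : measurable (cube c e).
Proof.
have -> : cube c e = \bigcap_(i in [set: 'I_d]) [set x | (`|x 0 i - c 0 i| <= e)%R].
  by apply/seteqP; split => x xb i //=; exact: xb.
apply: fin_bigcap_measurable => [|i _]; first exact: finite_finset.
apply: measurable_set_of_bool; apply: measurable_fun_ler => //.
apply: measurableT_comp => //.
by apply: measurable_funB => //; exact: measurable_row_coord.
Qed.

Lemma lebesgue_row_cube d (c : 'rV[R]_d) e : (0 <= e)%R ->
  leb d (cube c e) = ((e *+ 2) ^+ d)%:E.
Proof.
move=> e0; elim: d c => [|d IH] c.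
  have -> : cube c e = setT by apply/seteqP; split => // x _ [].
  by rewrite /= /lebesgue_row0 diracT expr0.
have -> : cube c e = [set x : 'rV[R]_d.+1 |
    `[(c 0 0 - e)%R, (c 0 0 + e)%R]%classic (x 0%R 0%R) /\
    cube (row_tail c) e (row_tail x)].
  apply/seteqP; split => x.
    move=> xc; split; first by rewrite /= in_itv/= -ler_distl; exact: xc.
    by move=> i; rewrite !row_tailE; exact: xc.
  move=> [x0 xc] i; have [j ->|->] := unliftP 0%R i.
    by rewrite -!row_tailE; exact: xc.
  by move: x0; rewrite /= in_itv/= -ler_distl.
rewrite lebesgue_row_consX//; last exact: measurable_cube.
rewrite IH lebesgue_measure_itv/= lte_fin; case: ifPn => [_|].
  by rewrite -EFinB -EFinM exprS; congr (_ * _)%:E; ring.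
rewrite -leNgt => h; have -> : e = 0%R by apply/eqP; rewrite eq_le e0 andbT; lra.
by rewrite mul0e mul0rn expr0n.
Qed.

Lemma open_lebesgue_row_gt0 d (A : set 'rV[R]_d) :
  open A -> measurable A -> A !=set0 -> 0 < leb d A.
Proof.
move=> oA mA [c Ac]; have /nbhs_ballP[e /= e0 ballA] := open_nbhs_nbhs (conj oA Ac).
apply: (@lt_le_trans _ _ (leb d (cube c (e / 2)))).
  by rewrite lebesgue_row_cube ?divr_ge0 ?ltW// lte_fin exprn_gt0// pmulrn_lgt0// divr_gt0.
apply: le_measure; rewrite ?inE//; first exact: measurable_cube.
move=> x xc; apply: ballA; split=> // i j; rewrite ord1 /ball/= distrC.
by rewrite (le_lt_trans (xc j))// ltr_pdivrMr// ltr_pMr// ltr1n.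
Qed.

Lemma lebesgue_row_set0 d : (0 < d)%N -> leb d [set 0%R] = 0.
Proof.
move=> d0; have -> : [set 0%R] = cube (0%R : 'rV[R]_d) 0.
  apply/seteqP; split => [x -> i|x x0]; first by rewrite !mxE subr0 normr0.
  by apply/rowP => i; have := x0 i; rewrite !mxE subr0 normr_le0 => /eqP.
by rewrite lebesgue_row_cube// mul0rn expr0n gtn_eqF.
Qed.

Lemma measurable_row_set0 d : measurable [set 0%R : 'rV[R]_d].
Proof.
rewrite (_ : [set 0%R] = [set x : 'rV[R]_d | enorm x == 0%R]).
  apply: measurable_set_of_bool; apply: measurable_fun_eqr => //.
  exact: measurable_enorm.
by apply/seteqP; split=> x /=; rewrite enorm_eq0 => /eqP.
Qed.

Lemma ae_row_neq0 d : (0 < d)%N -> {ae leb d, forall x, x != 0%R}.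
Proof.
move=> d0; exists [set 0%R]; split; last by move=> x /= /negP/negPn/eqP.
  exact: measurable_row_set0.
exact: lebesgue_row_set0.
Qed.

Lemma lebesgue_row_unit_ball_ltoo d : leb d (unit_ball : set 'rV[R]_d) < +oo.
Proof.
apply: (@le_lt_trans _ _ (leb d (cube 0%R 1%R))); last first.
  by rewrite lebesgue_row_cube// ltry.
apply: le_measure; rewrite ?inE; [exact: measurable_unit_ball|exact: measurable_cube|].
by move=> x /= x1 i; rewrite mxE subr0 (le_trans (coord_le_enorm _ _)).
Qed.

Lemma lebesgue_row_unit_ball_gt0 d : 0 < leb d (unit_ball : set 'rV[R]_d).
Proof.
have mB : measurable [set x : 'rV[R]_d | (enorm x < 1)%R].
  by apply: measurable_set_of_bool; apply: measurable_fun_ltr => //; exact: measurable_enorm.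
apply: (@lt_le_trans _ _ (leb d [set x | (enorm x < 1)%R])).
  apply: open_lebesgue_row_gt0 => //; last by exists 0%R; rewrite /= enorm0.
  apply: (@open_comp _ _ (@enorm R d) [set t : R | (t < 1)%R]); last exact: open_lt.
  by move=> x _; exact: continuous_enorm.
by apply: le_measure; rewrite ?inE//; [exact: measurable_unit_ball|move=> x /ltW].
Qed.

End row_volume.

(* The integrals of [f (x O)] and of [f] are compared after multiplication by the
   volume of the unit ball [B], written as [int 1_B (y - x O) dy]: translating [x] by
   [y O^T] exchanges the roles of [f] and [1_B]. *)
Section orthogonal_invariance.
Variables (R : realType) (d : nat) (O : 'M[R]_d) (f : 'rV[R]_d -> \bar R).
Hypothesis oO : orthogonal_mx O.
Local Open Scope ereal_scope.
Hypotheses (mf : measurable_fun setT f) (f0 : forall x, 0 <= f x).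
Local Notation leb := (lebesgue_row R d).
Local Notation vol := (leb unit_ball).

Let indic_ball (x : 'rV[R]_d) : \bar R := (\1_unit_ball x)%:E.

Let measurable_indic_ball : measurable_fun setT indic_ball.
Proof. by apply/measurable_EFinP; apply: measurable_indic; exact: measurable_unit_ball. Qed.

Let indic_ball_ge0 x : 0 <= indic_ball x.
Proof. by rewrite lee_fin. Qed.

Let indic_ballN x : indic_ball (- (x *m O))%R = indic_ball x.
Proof.
by rewrite /indic_ball !indicE !mem_unit_ball -scaleN1r enormZ normrN1 mul1r enorm_mulmx.
Qed.

Let integral_indic_ball (a : 'rV[R]_d) : \int[leb]_y indic_ball (y + a)%R = vol.
Proof.
rewrite ge0_integral_row_translate// integral_indic ?setIT//.
exact: measurable_unit_ball.
Qed.

Let mO := @measurable_fun_mulmx R d.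

Let mtranslate (a : 'rV[R]_d) : measurable_fun setT (fun y : 'rV[R]_d => y + a)%R.
Proof. exact: measurable_fun_rowD. Qed.

Let kernel (z : 'rV[R]_d * 'rV[R]_d) := f (z.1 *m O)%R * indic_ball (z.2 - z.1 *m O)%R.

Let kernel_ge0 z : 0 <= kernel z.
Proof. by rewrite mule_ge0. Qed.

Let measurable_kernel : measurable_fun setT kernel.
Proof.
apply: emeasurable_funM.
  exact: (measurableT_comp mf (measurableT_comp (mO O) _)).
apply: (measurableT_comp measurable_indic_ball).
apply: measurable_fun_rowD => //; under eq_fun do rewrite -scaleN1r.
by apply: measurable_fun_rowZ => //; exact: (measurableT_comp (mO O)).
Qed.

Let kernel_translate x y : kernel (x + y *m O^T, y)%R = f (y + x *m O)%R * indic_ball x.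
Proof.
rewrite /kernel /= mulmxDl mulmx_orthogonalVK// opprD addrCA subrr addr0 addrC.
by rewrite indic_ballN.
Qed.

Let integral_kernel_snd :
  \int[leb]_x \int[leb]_y kernel (x, y) = (\int[leb]_x f (x *m O)%R) * vol.
Proof.
rewrite -ge0_integralZr//; last exact: measurableT_comp.
apply: eq_integral => x _; rewrite -(integral_indic_ball (- (x *m O))).
by rewrite -ge0_integralZl//; exact: (measurableT_comp measurable_indic_ball).
Qed.

Let integral_kernel_fst :
  \int[leb]_y \int[leb]_x kernel (x, y) = (\int[leb]_x f x) * vol.
Proof.
transitivity (\int[leb]_y \int[leb]_x kernel (x + y *m O^T, y)%R).
  apply: eq_integral => y _.
  have my : measurable_fun setT (fun x => kernel (x, y)).
    by apply: (measurableT_comp measurable_kernel); exact: measurable_fun_pair.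
  by rewrite (ge0_integral_row_translate _ my).
rewrite -(fubini_tonelli (kernel \o (fun z => (z.1 + z.2 *m O^T, z.2)%R)))//=; last first.
  apply: (measurableT_comp measurable_kernel); apply: measurable_fun_pair => //.
  by apply: measurable_fun_rowD => //; exact: (measurableT_comp (mO O^T)).
transitivity (\int[leb]_x ((\int[leb]_y f y) * indic_ball x)).
  apply: eq_integral => x _; under eq_integral do rewrite kernel_translate.
  rewrite ge0_integralZr//; last exact: (measurableT_comp mf).
  by rewrite ge0_integral_row_translate.
rewrite ge0_integralZl//; last by apply: integral_ge0 => y _; exact: f0.
by rewrite -(ge0_integral_row_translate 0%R measurable_indic_ball)// integral_indic_ball.
Qed.

Lemma ge0_integral_row_mulmx : \int[leb]_x f (x *m O)%R = \int[leb]_x f x.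
Proof.
have vol_fin : vol \is a fin_num.
  by rewrite ge0_fin_numE ?lebesgue_row_unit_ball_ltoo.
have volV : vol * (fine vol)^-1%:E = 1.
  rewrite -[X in X * _](fineK vol_fin) -EFinM divff// gt_eqF// fine_gt0//.
  by rewrite lebesgue_row_unit_ball_gt0 lebesgue_row_unit_ball_ltoo.
have := integral_kernel_fst; rewrite -fubini_tonelli// integral_kernel_snd.
by move=> /(congr1 ( *%E^~ (fine vol)^-1%:E)); rewrite -!muleA volV !mule1.
Qed.

End orthogonal_invariance.

(** * Polar coordinates *)

Section polar_coordinates.
Variables (R : realType) (d : nat).
Hypothesis d_gt0 : (0 < d)%N.
Local Notation mu := (@lebesgue_measure R).
Local Notation leb := (lebesgue_row R d).
Local Open Scope ereal_scope.
Implicit Types F H : 'rV[R]_d -> \bar R.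

Lemma integral_pow_unit_itv : \int[mu]_(t in `[0%R, 1%R]) (d%:R * t ^+ d.-1)%:E = 1.
Proof.
rewrite (@continuous_FTC2 _ _ (fun t : R => t ^+ d)%R)//.
- by rewrite expr1n expr0n gtn_eqF// sube0.
- apply: continuous_subspaceT => x; apply: cvgM; first exact: cvg_cst.
  exact: exprn_continuous.
- split.
  + by move=> x _; exact: exprn_derivable.
  + by apply: cvg_at_right_filter; exact: exprn_continuous.
  + by apply: cvg_at_left_filter; exact: exprn_continuous.
- by move=> x _; rewrite exp_derive1.
Qed.

Definition radial_integral F (u : 'rV[R]_d) : \bar R :=
  \int[mu]_(t in `]0%R, +oo[) ((t ^+ d.-1)%:E * F (t *: u)%R).

Let ray F (z : 'rV[R]_d * measurableTypeR R) : \bar R :=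
  if (0 < z.2)%R then (z.2 ^+ d.-1)%:E * F (z.2 *: z.1)%R else 0.

Let radial_integralE F u : radial_integral F u = \int[mu]_t ray F (u, t).
Proof.
rewrite /radial_integral integral_mkcond; apply: eq_integral => t _.
by rewrite /patch mem_setE in_itv/= andbT.
Qed.

Let measurable_ray F : measurable_fun setT F -> measurable_fun setT (ray F).
Proof.
move=> mF; apply: measurable_fun_ifT => //; first exact: measurable_fun_ltr.
apply: emeasurable_funM; first exact/measurable_EFinP/measurable_funX.
by apply: (measurableT_comp mF); exact: measurable_fun_rowZ.
Qed.

Let ray_ge0 F z : (forall x, 0 <= F x) -> 0 <= ray F z.
Proof.
by move=> F0; rewrite /ray; case: ifP => // z0; rewrite mule_ge0// lee_fin exprn_ge0// ltW.
Qed.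

Lemma radial_integral_ge0 F u : (forall x, 0 <= F x) -> 0 <= radial_integral F u.
Proof. by move=> F0; rewrite radial_integralE integral_ge0// => t _; exact: ray_ge0. Qed.

Lemma measurable_radial_integral F : measurable_fun setT F -> (forall x, 0 <= F x) ->
  measurable_fun setT (radial_integral F).
Proof.
move=> mF F0; rewrite (funext (radial_integralE F)).
apply: (@measurable_fun_fubini_tonelli_F _ _ 'rV[R]_d (measurableTypeR R) R mu (ray F)).
  exact: measurable_ray.
by move=> z; exact: ray_ge0.
Qed.

Lemma radial_integralZ F (r : R) u : (0 < r)%R ->
  measurable_fun setT F -> (forall x, 0 <= F x) ->
  radial_integral F u = (r ^+ d)%:E * radial_integral F (r *: u).
Proof.
move=> r0 mF F0; have -> : (r ^+ d)%:E = r%:E * (r ^+ d.-1)%:E.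
  by rewrite -EFinM -exprS prednK.
have mray u' : measurable_fun setT (fun t : R => ray F (u', t)).
  by apply: (measurableT_comp (measurable_ray mF)); exact: measurable_fun_pair.
rewrite !radial_integralE (ge0_integral_affine 0%R r0)//; last first.
  by move=> t; exact: ray_ge0.
rewrite -muleA; congr (_ * _); rewrite -ge0_integralZl//=; last 3 first.
- exact: mray.
- by move=> t _; exact: ray_ge0.
- by rewrite lee_fin exprn_ge0// ltW.
apply: eq_integral => t _; rewrite addr0 /ray/= pmulr_rgt0//.
by case: ifP => _; rewrite ?mule0// exprMn EFinM muleA scalerA [(t * r)%R]mulrC.
Qed.

(* [shell x t] is supported on [|x| < t <= 2 |x|] and integrates to [1] in [t]. *)
Let shell (x : 'rV[R]_d) (t : R) : R :=
  (if enorm x < t <= 2 * enorm x then (enorm x)^-1 else 0)%R.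

Let shell_ge0 x t : (0 <= shell x t)%R.
Proof. by rewrite /shell; case: ifP => // _; rewrite invr_ge0 enorm_ge0. Qed.

Let shell_le0 x t : (t <= 0)%R -> shell x t = 0%R.
Proof.
move=> t0; rewrite /shell ifF//; apply/negbTE; rewrite negb_and -leNgt.
by rewrite (le_trans t0) ?enorm_ge0.
Qed.

Let measurable_shell :
  measurable_fun setT (fun z : 'rV[R]_d * measurableTypeR R => shell z.1 z.2).
Proof.
have menorm : measurable_fun setT (fun z : 'rV[R]_d * measurableTypeR R => enorm z.1).
  exact: (measurableT_comp (@measurable_enorm R d)).
apply: measurable_fun_ifT => //.
  apply: measurable_and; first exact: measurable_fun_ltr.
  by apply: measurable_fun_ler => //; exact: measurable_funM.
exact: (measurableT_comp (@measurable_invr R)).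
Qed.

Let integral_shell x : x != 0%R -> \int[mu]_t (shell x t)%:E = 1.
Proof.
rewrite -enorm_gt0 => x0.
transitivity (\int[mu]_(t in `]enorm x, (2 * enorm x)%R]) (enorm x)^-1%:E).
  rewrite [RHS]integral_mkcond; apply: eq_integral => t _.
  by rewrite /patch mem_setE in_itv/= /shell; case: ifP.
rewrite integral_cst//= lebesgue_measure_itv/= lte_fin ifT; last by lra.
by rewrite -EFinB -EFinM; congr EFin; field; rewrite gt_eqF.
Qed.

Let shellZ x t : (0 < t)%R -> shell (t *: x) t = (t^-1 * shell x 1)%R.
Proof.
move=> t0; rewrite /shell enormZ gtr0_norm// mulrCA.
rewrite -[ltRHS]mulr1 ltr_pM2l// -[leLHS]mulr1 ler_pM2l//.
by case: ifP; rewrite ?mulr0// invfM.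
Qed.

Let weight (x : 'rV[R]_d) : R := (shell x 1 * (enorm x ^+ d)^-1)%R.

Let weight_ge0 x : 0 <= (weight x)%:E.
Proof. by rewrite lee_fin mulr_ge0// invr_ge0 exprn_ge0// enorm_ge0. Qed.

Let measurable_weight : measurable_fun setT weight.
Proof.
apply: measurable_funM.
  apply: (measurableT_comp measurable_shell
    (g := fun x : 'rV[R]_d => (x, 1%R : measurableTypeR R))).
  exact: measurable_fun_pair.
apply: (measurableT_comp (@measurable_invr R)); apply: measurable_funX.
exact: measurable_enorm.
Qed.

Let weight0 : weight 0 = 0%R.
Proof. by rewrite /weight /shell enorm0 mulr0 ltr01 leNgt ltr01/= mul0r. Qed.

Let measurable_mul_shell F : measurable_fun setT F ->
  measurable_fun setT (fun z : 'rV[R]_d * measurableTypeR R => F z.1 * (shell z.1 z.2)%:E).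
Proof.
move=> mF; apply: emeasurable_funM; first exact: (measurableT_comp mF).
exact/measurable_EFinP.
Qed.

Let integral_mul_shell F t : measurable_fun setT F -> (forall x, 0 <= F x) ->
  \int[leb]_x (F x * (shell x t)%:E) = \int[leb]_x (ray F (x, t) * (shell x 1)%:E).
Proof.
move=> mF F0; have [t0|t0] := leP t 0%R.
  rewrite !integral0_eq// => x _; last by rewrite shell_le0// mule0.
  by rewrite /ray/= ltNge t0 mul0e.
pose k x := F x * (shell x t)%:E; have k0 x : 0 <= k x by rewrite mule_ge0// lee_fin.
have mk : measurable_fun setT k.
  apply: (measurableT_comp (measurable_mul_shell mF) (g := fun x : 'rV[R]_d => (x, t))).
  exact: measurable_fun_pair.
rewrite (ge0_integral_row_scale t0 mk)// -ge0_integralZl//=; last 2 first.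
- by apply: (measurableT_comp mk); exact: measurable_fun_rowZ.
- by rewrite lee_fin exprn_ge0// ltW.
have tdE : (t ^+ d.-1)%:E = (t ^+ d)%:E * t^-1%:E.
  by rewrite -EFinM -[in RHS](prednK d_gt0) exprSr mulfK ?gt_eqF.
apply: eq_integral => x _; rewrite /k/ray/= t0 shellZ// tdE EFinM.
by rewrite [F _ * _]muleCA !muleA.
Qed.

Let integral_shell_polar F : measurable_fun setT F -> (forall x, 0 <= F x) ->
  \int[leb]_x F x = \int[leb]_x ((weight x)%:E * radial_integral F (hatv x)).
Proof.
move=> mF F0.
pose k (z : 'rV[R]_d * measurableTypeR R) := F z.1 * (shell z.1 z.2)%:E.
have mk : measurable_fun setT k by exact: measurable_mul_shell.
have k0 z : 0 <= k z by rewrite mule_ge0// lee_fin.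
transitivity (\int[leb]_x \int[mu]_t k (x, t)).
  apply: ae_eq_integral => //; first exact: measurable_fun_fubini_tonelli_F.
  apply: filterS (ae_row_neq0 R d_gt0) => x x0 _ /=.
  rewrite /k/= ge0_integralZl//=.
  - by rewrite integral_shell// mule1.
  - exact/measurable_EFinP/(measurableT_comp measurable_shell (measurable_fun_pair _ _)).
  - by move=> t _; rewrite lee_fin.
rewrite fubini_tonelli//.
transitivity (\int[mu]_t \int[leb]_x (ray F (x, t) * (shell x 1)%:E)).
  by apply: eq_integral => t _; exact: integral_mul_shell.
rewrite -(fubini_tonelli (fun z => ray F z * (shell z.1 1)%:E)); last 2 first.
- apply: emeasurable_funM; first exact: measurable_ray.
  apply/measurable_EFinP; apply: (measurableT_comp measurable_shell
    (g := fun z : _ * _ => (z.1, 1%R : measurableTypeR R))).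
  exact: measurable_fun_pair.
- by move=> z; rewrite mule_ge0// ?ray_ge0// lee_fin.
apply: eq_integral => x _; rewrite /= ge0_integralZr//=; last 3 first.
- by apply: (measurableT_comp (measurable_ray mF)); exact: measurable_fun_pair.
- by move=> t _; exact: ray_ge0.
- by rewrite lee_fin.
rewrite -radial_integralE; have [->|x0] := eqVneq x 0%R.
  by rewrite weight0 /shell enorm0 mulr0 ltr01 leNgt ltr01/= !(mule0, mul0e).
have ex : (0 < enorm x)%R by rewrite enorm_gt0.
rewrite /weight (radial_integralZ (hatv x) ex)// enorm_scale_hatv EFinM -muleA [RHS]muleC.
by rewrite muleA -EFinM mulVf ?mul1e// gt_eqF// exprn_gt0.
Qed.

Let radial_integral_ball H u : usphere u -> measurable_fun setT H -> (forall x, 0 <= H x) ->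
  d%:R%:E * radial_integral (fun x => (\1_unit_ball x)%:E * H (hatv x)) u = H u.
Proof.
move=> u1 mH H0; rewrite /radial_integral.
transitivity (d%:R%:E * (\int[mu]_(t in `]0%R, 1%R]) (H u * (t ^+ d.-1)%:E))).
  congr (_ * _); rewrite integral_mkcond [RHS]integral_mkcond.
  apply: eq_integral => t _; rewrite /patch !mem_setE !in_itv/= andbT.
  have [t0|//] := ltP 0%R t; rewrite hatvZ// hatv_usphere// indicE mem_unit_ball.
  rewrite enormZ gtr0_norm// u1 mulr1.
  by case: (t <= 1)%R; rewrite ?mul1e ?mul0e ?mule0// muleC.
have mpow (D : set R) : measurable_fun D (fun t : R => (t ^+ d.-1)%:E).
  exact/measurable_EFinP/measurable_funX.
have pow_ge0 t : `]0%R, 1%R]%classic t -> 0 <= (t ^+ d.-1)%:E.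
  by rewrite /= in_itv/= => /andP[t0 _]; rewrite lee_fin exprn_ge0// ltW.
rewrite ge0_integralZl//; [|exact: mpow|exact: pow_ge0].
rewrite muleCA -[RHS]mule1 -integral_pow_unit_itv; congr (_ * _).
rewrite -[RHS]integral_itv_obnd_cbnd; last exact/measurable_EFinP/measurable_funM.
under [RHS]eq_integral do rewrite EFinM.
by rewrite ge0_integralZl//; [exact: mpow|exact: pow_ge0].
Qed.

Theorem ge0_integral_polar F : measurable_fun setT F -> (forall x, 0 <= F x) ->
  \int[leb]_x F x =
  d%:R%:E * \int[leb]_(x in unit_ball) radial_integral F (hatv x).
Proof.
move=> mF F0; have mrF := measurable_radial_integral mF F0.
have rF0 u := radial_integral_ge0 u F0.
pose G x := (\1_unit_ball x)%:E * radial_integral F (hatv x).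
have mrFh : measurable_fun setT (radial_integral F \o @hatv R d).
  exact: (measurableT_comp mrF (@measurable_hatv R d)).
have mG : measurable_fun setT G.
  apply: emeasurable_funM => //; apply/measurable_EFinP.
  by apply: measurable_indic; exact: measurable_unit_ball.
have G0 x : 0 <= G x by rewrite mule_ge0// lee_fin.
have -> : \int[leb]_(x in unit_ball) radial_integral F (hatv x) = \int[leb]_x G x.
  rewrite integral_mkcond; apply: eq_integral => x _.
  by rewrite /patch /G indicE; case: (x \in unit_ball); rewrite ?mul1e ?mul0e.
rewrite (integral_shell_polar mF F0) (integral_shell_polar mG G0).
have mrGh : measurable_fun setT (radial_integral G \o @hatv R d).
  exact: (measurableT_comp (measurable_radial_integral mG G0) (@measurable_hatv R d)).
rewrite -ge0_integralZl//=; last 2 first.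
- by apply: emeasurable_funM => //; exact/measurable_EFinP.
- by move=> x _; rewrite mule_ge0// radial_integral_ge0.
apply: eq_integral => x _; have [->|x0] := eqVneq x 0%R.
  by rewrite weight0 !(mul0e, mule0).
rewrite muleCA; congr (_ * _).
by rewrite (radial_integral_ball _ mrF rF0)//; exact/usphere_hatv.
Qed.

End polar_coordinates.

(** * Averages over the unit sphere *)

Section bounded_measurable.
Context d (T : measurableType d) (R : realType).
Variable D : set T.
Implicit Types f g : T -> R.

Definition bounded_measurable f :=
  measurable_fun D f /\ exists C, forall x, D x -> `|f x| <= C.

Lemma eq_bounded_measurable f g : (forall x, D x -> f x = g x) ->
  bounded_measurable f -> bounded_measurable g.
Proof.
move=> fg [mf [C fC]]; split; last by exists C => x Dx; rewrite -fg// fC.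
by apply: eq_measurable_fun mf => x; rewrite inE => /fg.
Qed.

Lemma bounded_measurable_cst c : bounded_measurable (cst c).
Proof. by split; last exists `|c|. Qed.

Lemma bounded_measurableD f g : bounded_measurable f -> bounded_measurable g ->
  bounded_measurable (fun x => f x + g x).
Proof.
move=> [mf [C fC]] [mg [C' gC']]; split; first exact: measurable_funD.
by exists (C + C') => x Dx; rewrite (le_trans (ler_normD _ _))// lerD ?fC ?gC'.
Qed.

Lemma bounded_measurableM f g : bounded_measurable f -> bounded_measurable g ->
  bounded_measurable (fun x => f x * g x).
Proof.
move=> [mf [C fC]] [mg [C' gC']]; split; first exact: measurable_funM.
by exists (C * C') => x Dx; rewrite normrM ler_pM ?fC ?gC'.
Qed.

Lemma bounded_measurableZ c f : bounded_measurable f ->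
  bounded_measurable (fun x => c * f x).
Proof. exact/bounded_measurableM/bounded_measurable_cst. Qed.

Lemma bounded_measurableB f g : bounded_measurable f -> bounded_measurable g ->
  bounded_measurable (fun x => f x - g x).
Proof.
move=> bf /(bounded_measurableZ (-1)) bg.
by apply: eq_bounded_measurable (bounded_measurableD bf bg) => x _; rewrite mulN1r.
Qed.

Lemma bounded_measurable_norm f : bounded_measurable f ->
  bounded_measurable (fun x => `|f x|).
Proof.
move=> [mf [C fC]]; split; first exact: measurableT_comp.
by exists C => x Dx; rewrite normr_id fC.
Qed.

Lemma bounded_measurable_sum (I : Type) (r : seq I) (f : I -> T -> R) :
  (forall i, bounded_measurable (f i)) ->
  bounded_measurable (fun x => \sum_(i <- r) f i x).
Proof.
move=> bf; elim: r => [|i r IH].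
  by apply: eq_bounded_measurable (bounded_measurable_cst 0) => x _; rewrite big_nil.
by apply: eq_bounded_measurable (bounded_measurableD (bf i) IH) => x _; rewrite big_cons.
Qed.

Lemma bounded_measurable_integrable (m : {measure set T -> \bar R}) f :
  measurable D -> (m D < +oo)%E -> bounded_measurable f ->
  m.-integrable D (EFin \o f).
Proof.
move=> mD moo [mf [C fC]]; apply: measurable_bounded_integrable => //.
exists C; split; first exact: num_real.
by move=> M CM x Dx /=; rewrite (le_trans (fC x Dx))// ltW.
Qed.

End bounded_measurable.

Section restricted_measure.
Local Open Scope ereal_scope.
Context d (T : measurableType d) (R : realType) (m : {measure set T -> \bar R}).

Lemma ge0_integral_mrestr (B D : set T) (mB : measurable B) (f : T -> \bar R) :
  measurable D -> measurable_fun D f -> (forall x, D x -> 0 <= f x) ->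
  \int[mrestr m mB]_(x in D) f x = \int[m]_(x in D `&` B) f x.
Proof.
move=> mD mf f0.
rewrite [LHS](@ge0_negligible_integral _ _ _ _ _ (D `\` B))//; last 2 first.
- exact: measurableD.
- by rewrite /= /mrestr setDKI measure0.
rewrite setDD; apply: eq_measure_integral => A mA AB; rewrite /= /mrestr setIidl//.
by move=> x /AB[].
Qed.

End restricted_measure.

Section sphere_measure.
Variables (R : realType) (d : nat).
Local Notation leb := (lebesgue_row R d).
Local Notation vol := (fine (leb unit_ball)).
Local Open Scope ereal_scope.

Lemma lebesgue_row_unit_ballE : leb unit_ball = vol%:E.
Proof. by rewrite fineK// ge0_fin_numE ?lebesgue_row_unit_ball_ltoo. Qed.

Lemma vol_unit_ball_gt0 : (0 < vol)%R.
Proof. by rewrite fine_gt0// lebesgue_row_unit_ball_gt0 lebesgue_row_unit_ball_ltoo. Qed.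

Let vol_inv_ge0 : (0 <= vol^-1)%R.
Proof. by rewrite invr_ge0 ltW// vol_unit_ball_gt0. Qed.

Definition sphere_measure : set 'rV[R]_d -> \bar R :=
  mscale (NngNum vol_inv_ge0)
    (image_measure (mrestr leb (@measurable_unit_ball R d)) (@measurable_hatv R d)).

HB.instance Definition _ := Measure.on sphere_measure.

Let sphere_measure_fin : fin_num_fun sphere_measure.
Proof.
move=> A mA; rewrite /sphere_measure/= /mscale/= /pushforward /mrestr.
have mhA : measurable (@hatv R d @^-1` A).
  by rewrite -[X in measurable X]setTI; exact: measurable_hatv.
have mB := @measurable_unit_ball R d.
rewrite fin_numM// ge0_fin_numE//.
apply: le_lt_trans (lebesgue_row_unit_ball_ltoo R d).
by apply: le_measure; rewrite ?inE//; exact: measurableI.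
Qed.

HB.instance Definition _ := Measure_isFinite.Build _ _ _ sphere_measure
  sphere_measure_fin.

Lemma ge0_integral_sphere (H : 'rV[R]_d -> \bar R) :
  measurable_fun usphere H -> (forall u, usphere u -> 0 <= H u) ->
  \int[sphere_measure]_(u in usphere) H u =
  vol^-1%:E * \int[leb]_(x in unit_ball) (H \_ usphere) (hatv x).
Proof.
move=> mH H0; have mS := @measurable_usphere R d.
have mhS : measurable (@hatv R d @^-1` usphere).
  by rewrite -[X in measurable X]setTI; exact: measurable_hatv.
rewrite /sphere_measure ge0_integral_mscale//; congr (_ * _).
rewrite [LHS](ge0_integral_pushforward (@measurable_hatv R d))//; last first.
  by move=> u; rewrite inE; exact: H0.
rewrite [LHS]ge0_integral_mrestr//; last 2 first.
- apply: (measurable_comp mS _ mH); first by move=> _ [x ? <-].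
  exact: measurable_funTS (@measurable_hatv R d).
- by move=> x; exact: H0.
by rewrite integral_mkcondl.
Qed.

End sphere_measure.

Section sphere_mean.
Variables (R : realType) (d : nat).
Hypothesis d_gt0 : (0 < d)%N.
Local Notation leb := (lebesgue_row R d).
Local Notation sigma := (@sphere_measure R d).
Local Notation sbounded := (bounded_measurable (usphere : set 'rV[R]_d)).
Implicit Types (g : 'rV[R]_d -> R) (u v : 'rV[R]_d).

Lemma sphere_measure_usphere : sigma usphere = 1%E.
Proof.
rewrite -[LHS]mul1e -integral_cst; last exact: measurable_usphere.
rewrite ge0_integral_sphere//.
rewrite (ae_eq_integral (cst 1%E)) => [|||//|]; last 3 first.
- exact: measurable_unit_ball.
- apply: measurable_funTS; apply: (measurableT_comp _ (@measurable_hatv R d)).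
  by apply/(measurable_restrictT _ (@measurable_usphere R d)).
- apply: filterS (ae_row_neq0 R d_gt0) => x x0 _.
  by rewrite patchE mem_set//; exact/usphere_hatv.
rewrite integral_cst ?mul1e; last exact: measurable_unit_ball.
by rewrite [X in (_ * X)%E]lebesgue_row_unit_ballE -EFinM mulVf// gt_eqF// vol_unit_ball_gt0.
Qed.

Let sphere_measure_ltoo : (sigma usphere < +oo)%E.
Proof. by rewrite sphere_measure_usphere ltry. Qed.

Lemma integrable_sphere g : sbounded g -> sigma.-integrable usphere (EFin \o g).
Proof.
by apply: bounded_measurable_integrable => //; exact: measurable_usphere.
Qed.

Definition sphere_mean g : R := \int[sigma]_(u in usphere) g u.

Lemma eq_sphere_mean g g' : (forall u, usphere u -> g u = g' u) ->
  sphere_mean g = sphere_mean g'.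
Proof. by move=> gg'; apply: eq_Rintegral => u; rewrite inE => /gg'. Qed.

Lemma sphere_mean_cst c : sphere_mean (cst c) = c.
Proof.
rewrite /sphere_mean Rintegral_cst; last exact: measurable_usphere.
by rewrite /= sphere_measure_usphere mulr1.
Qed.

Lemma sphere_meanD g g' : sbounded g -> sbounded g' ->
  sphere_mean (fun u => g u + g' u) = sphere_mean g + sphere_mean g'.
Proof.
by move=> bg bg'; rewrite /sphere_mean RintegralD//;
  [exact: measurable_usphere|exact: integrable_sphere..].
Qed.

Lemma sphere_meanB g g' : sbounded g -> sbounded g' ->
  sphere_mean (fun u => g u - g' u) = sphere_mean g - sphere_mean g'.
Proof.
by move=> bg bg'; rewrite /sphere_mean RintegralB//;
  [exact: measurable_usphere|exact: integrable_sphere..].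
Qed.

Lemma sphere_meanZ c g : sbounded g ->
  sphere_mean (fun u => c * g u) = c * sphere_mean g.
Proof.
by move=> bg; rewrite /sphere_mean RintegralZl//;
  [exact: measurable_usphere|exact: integrable_sphere].
Qed.

Lemma sphere_mean_sum (I : Type) (r : seq I) (g : I -> 'rV[R]_d -> R) :
  (forall i, sbounded (g i)) ->
  sphere_mean (fun u => \sum_(i <- r) g i u) = \sum_(i <- r) sphere_mean (g i).
Proof.
move=> bg; elim: r => [|i r IH].
  rewrite big_nil -[RHS](sphere_mean_cst 0); apply: eq_sphere_mean => u _.
  by rewrite big_nil.
rewrite big_cons -IH -sphere_meanD//; last exact: bounded_measurable_sum.
by apply: eq_sphere_mean => u _; rewrite big_cons.
Qed.

Lemma le_sphere_mean g g' : sbounded g -> sbounded g' ->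
  (forall u, usphere u -> g u <= g' u) -> sphere_mean g <= sphere_mean g'.
Proof.
by move=> bg bg'; apply: le_Rintegral;
  [exact: measurable_usphere|exact: integrable_sphere..].
Qed.

Lemma sphere_mean_ge0 g : (forall u, usphere u -> 0 <= g u) -> 0 <= sphere_mean g.
Proof. exact: Rintegral_ge0. Qed.

Lemma le_normr_sphere_mean g : sbounded g ->
  `|sphere_mean g| <= sphere_mean (fun u => `|g u|).
Proof.
by move=> bg; apply: le_normr_Rintegral; [exact: measurable_usphere|exact: integrable_sphere].
Qed.

Lemma bounded_measurable_mulmx g (O : 'M[R]_d) : orthogonal_mx O -> sbounded g ->
  sbounded (fun u => g (u *m O)).
Proof.
move=> oO [mg [C gC]]; split; last by exists C => u u1; apply/gC/usphere_mulmx.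
apply: (measurable_comp (@measurable_usphere R d) _ mg).
  by move=> _ [u u1 <-]; exact/usphere_mulmx.
by apply: measurable_funTS; exact: measurable_fun_mulmx.
Qed.

Lemma ge0_integral_sphere_mulmx (O : 'M[R]_d) (H : 'rV[R]_d -> \bar R) :
  orthogonal_mx O -> measurable_fun usphere H -> (forall u, usphere u -> (0 <= H u)%E) ->
  (\int[sigma]_(u in usphere) H (u *m O) = \int[sigma]_(u in usphere) H u)%E.
Proof.
move=> oO mH H0; have mS := @measurable_usphere R d.
have mHO : measurable_fun usphere (fun u => H (u *m O)).
  apply: (measurable_comp mS _ mH); first by move=> _ [u u1 <-]; exact/usphere_mulmx.
  by apply: measurable_funTS; exact: measurable_fun_mulmx.
rewrite !ge0_integral_sphere//; last by move=> u u1; exact/H0/usphere_mulmx.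
congr (_ * _)%E; rewrite integral_mkcond [RHS]integral_mkcond.
rewrite -[RHS](ge0_integral_row_mulmx oO).
- apply: eq_integral => x _; rewrite /patch !mem_unit_ball enorm_mulmx// hatv_mulmx//.
  case: ifP => // _; congr (if _ then _ else _).
  by apply/idP/idP; rewrite !inE => /(usphere_mulmx _ oO).
- apply/(measurable_restrictT _ (@measurable_unit_ball R d)); apply: measurable_funTS.
  apply: (measurableT_comp _ (@measurable_hatv R d)).
  exact/(measurable_restrictT _ mS).
- move=> x; apply: erestrict_ge0 => {}x _; apply: erestrict_ge0 => {}x; exact: H0.
Qed.

Lemma sphere_mean_mulmx g (O : 'M[R]_d) : orthogonal_mx O -> sbounded g ->
  sphere_mean (fun u => g (u *m O)) = sphere_mean g.
Proof.
move=> oO [mg _]; congr fine; rewrite integralE [RHS]integralE.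
have mEg : measurable_fun usphere (EFin \o g) by exact/measurable_EFinP.
congr (_ - _)%E.
- rewrite -[RHS](ge0_integral_sphere_mulmx oO (measurable_funepos mEg)) => [|u _].
    by apply: eq_integral => u _; rewrite !funeposE.
  exact: funepos_ge0.
- rewrite -[RHS](ge0_integral_sphere_mulmx oO (measurable_funeneg mEg)) => [|u _].
    by apply: eq_integral => u _; rewrite !funenegE.
  exact: funeneg_ge0.
Qed.

Definition spherical_cap u (dl : R) : set 'rV[R]_d :=
  [set v | usphere v /\ 1 - dl <= dotv u v].

Lemma measurable_spherical_cap u dl : measurable (spherical_cap u dl).
Proof.
apply: measurableI; first exact: measurable_usphere.
apply: measurable_set_of_bool; apply: measurable_fun_ler => //.
exact: measurable_dotv.
Qed.

(* The cone over the open cap is a nonempty open set. *)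
Lemma sphere_measure_cap_gt0 u dl : usphere u -> 0 < dl ->
  (0 < sigma (spherical_cap u dl))%E.
Proof.
move=> u1 dl0.
pose cone := [set x : 'rV[R]_d | (enorm x < 1) && (0 < dotv u x - (1 - dl) * enorm x)].
have mcap := measurable_spherical_cap u dl.
have mhcap : measurable (@hatv R d @^-1` spherical_cap u dl).
  by rewrite -[X in measurable X]setTI; exact: measurable_hatv.
have mcone : measurable cone.
  apply: measurable_set_of_bool; apply: measurable_and.
    by apply: measurable_fun_ltr => //; exact: measurable_enorm.
  apply: measurable_fun_ltr => //; apply: measurable_funB; first exact: measurable_dotv.
  by apply: measurable_funM => //; exact: measurable_enorm.
have ocone : open cone.
  have -> : cone = (@enorm R d) @^-1` [set t | t < 1] `&`
      (fun x => dotv u x - (1 - dl) * enorm x) @^-1` [set t | 0 < t].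
    by apply/seteqP; split => x /andP.
  apply: openI; apply: open_comp; [|exact: open_lt| |exact: open_gt] => x _.
    exact: continuous_enorm.
  apply: continuousB; first exact: continuous_dotv.
  by apply: continuousM; [exact: cst_continuous|exact: continuous_enorm].
have cone_gt0 : (0 < leb cone)%E.
  apply: open_lebesgue_row_gt0 => //; exists (2^-1 *: u).
  rewrite /cone/= enormZ u1 dotvZr (usphereE u).1// gtr0_norm ?invr_gt0//.
  by apply/andP; split; lra.
rewrite /sphere_measure/= /mscale/= mule_gt0// ?lte_fin ?invr_gt0 ?vol_unit_ball_gt0//.
apply: (lt_le_trans cone_gt0); apply: le_measure; rewrite ?inE//.
  by apply: measurableI => //; exact: measurable_unit_ball.
move=> x /andP[x1 xu]; have x0 : x != 0.
  by apply: contraTneq xu => ->; rewrite enorm0 dotvC dot0v mulr0 subrr ltxx.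
split; last exact: ltW.
split; first exact/usphere_hatv.
by rewrite dotvZr mulrC ler_pdivlMr ?enorm_gt0// -subr_ge0 ltW.
Qed.

Lemma spherical_cap_ltoo u dl : (sigma (spherical_cap u dl) < +oo)%E.
Proof.
apply: le_lt_trans sphere_measure_ltoo; apply: le_measure; rewrite ?inE//.
- exact: measurable_spherical_cap.
- exact: measurable_usphere.
- by move=> v [].
Qed.

Lemma le_cap_sphere_mean g u dl c : sbounded g -> (forall v, usphere v -> 0 <= g v) ->
  (forall v, spherical_cap u dl v -> c <= g v) ->
  c * fine (sigma (spherical_cap u dl)) <= sphere_mean g.
Proof.
move=> bg g0 gc; have mcap := measurable_spherical_cap u dl; have mS := @measurable_usphere R d.
have capS : spherical_cap u dl `<=` usphere by move=> v [].
have icap (h : 'rV[R]_d -> R) : sbounded h ->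
    sigma.-integrable (spherical_cap u dl) (EFin \o h).
  by move=> /integrable_sphere; exact: integrableS.
rewrite -[leLHS]Rintegral_cst//.
apply: (@le_trans _ _ (\int[sigma]_(v in spherical_cap u dl) g v)).
  by apply: le_Rintegral => //; [exact: (icap _ (bounded_measurable_cst _ c))|exact: icap].
rewrite fine_le//.
- by apply: integrable_fin_num => //; exact: icap.
- by apply: integrable_fin_num => //; exact: integrable_sphere.
apply: ge0_subset_integral => //.
by case: bg => mg _; exact/measurable_EFinP.
Qed.

End sphere_mean.

Section polar_integrals.
Variables (R : realType) (d : nat).
Hypothesis d_gt1 : (1 < d)%N.
Local Notation mu := (@lebesgue_measure R).
Local Notation leb := (lebesgue_row R d).
Local Notation vol := (fine (leb unit_ball)).
Local Notation sigma := (@sphere_measure R d).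
Local Notation sbounded := (bounded_measurable (usphere : set 'rV[R]_d)).

Let d_gt0 : (0 < d)%N. Proof. exact: ltnW. Qed.

Let indicE_if (x : 'rV[R]_d) : (if enorm x <= 1 then 1 else 0) = \1_unit_ball x :> R.
Proof. by rewrite indicE mem_unit_ball; case: ifP. Qed.

Lemma ball_volE : ball_vol R d = vol.
Proof.
have mB := @measurable_unit_ball R d.
rewrite /ball_vol (_ : (fun x => _) = \1_unit_ball); last exact/funext/indicE_if.
rewrite iint_integral ?integral_indic ?setIT//; apply/integrableP; split.
  exact/measurable_EFinP/measurable_indic.
under eq_integral do rewrite /= ger0_norm//.
by rewrite integral_indic ?setIT// lebesgue_row_unit_ball_ltoo.
Qed.

Lemma sphere_area_gt0 (r : R) : 0 < r -> 0 < sphere_area d r.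
Proof.
by move=> r0; rewrite /sphere_area ball_volE !mulr_gt0 ?ltr0n ?vol_unit_ball_gt0// exprn_gt0.
Qed.

Lemma sphere_area0 : sphere_area d 0 = 0 :> R.
Proof. by rewrite /sphere_area expr0n -subn1 subn_eq0 leqNgt d_gt1 mulr0. Qed.

Lemma sphere_area_ge0 (r : R) : 0 <= r -> 0 <= sphere_area d r.
Proof.
by rewrite le_eqVlt => /predU1P[<-|/sphere_area_gt0/ltW//]; rewrite sphere_area0.
Qed.

Let measurable_sphere_area_inv :
  measurable_fun [set: 'rV[R]_d] (fun x => (sphere_area d (enorm x))^-1).
Proof.
apply: (measurableT_comp (@measurable_invr R)); apply: measurable_funM => //.
by apply: measurable_funX; exact: measurable_enorm.
Qed.

Let polar (x : 'rV[R]_d) : 'rV[R]_d * measurableTypeR R := (hatv x, enorm x).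

Let measurable_polar : measurable_fun setT polar.
Proof. by apply: measurable_fun_pair; [exact: measurable_hatv|exact: measurable_enorm]. Qed.

Let cone_part (h : 'rV[R]_d * measurableTypeR R -> \bar R) x : \bar R :=
  (h (polar x) * (sphere_area d (enorm x))^-1%:E)%E.

Let measurable_cone_part h : measurable_fun setT h -> measurable_fun setT (cone_part h).
Proof.
move=> mh; apply: emeasurable_funM; first exact: (measurableT_comp mh).
exact/measurable_EFinP.
Qed.

Section product.
Local Open Scope ereal_scope.
Variable h : 'rV[R]_d * measurableTypeR R -> \bar R.
Hypotheses (mh : measurable_fun setT h)
  (h_supp : forall u t, ~ (usphere u /\ 0 < t)%R -> h (u, t) = 0).

Hypothesis h0 : forall z, 0 <= h z.

Let cone_part_ge0 x : 0 <= cone_part h x.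
Proof. by rewrite mule_ge0// lee_fin invr_ge0 sphere_area_ge0// enorm_ge0. Qed.

Let radial_integral_cone_part u : usphere u ->
  d%:R%:E * radial_integral (cone_part h) u = vol^-1%:E * \int[mu]_t h (u, t).
Proof.
move=> u1; have -> : \int[mu]_t h (u, t) = \int[mu]_(t in `]0%R, +oo[) h (u, t).
  rewrite [RHS]integral_mkcond; apply: eq_integral => t _.
  rewrite patchE mem_setE in_itv/= andbT; case: ifPn => // /negP t0.
  by rewrite h_supp// => -[_ /t0].
have mhu : measurable_fun (`]0%R, +oo[ : set R) (fun t => h (u, t)).
  by apply: measurable_funTS; apply: (measurableT_comp mh); exact: measurable_fun_pair.
rewrite -[RHS]ge0_integralZl ?lee_fin ?invr_ge0 ?(ltW (vol_unit_ball_gt0 R d))//.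
have mcu : measurable_fun (`]0%R, +oo[ : set R)
    (fun t : R => (t ^+ d.-1)%:E * cone_part h (t *: u)%R).
  apply: measurable_funTS; apply: emeasurable_funM.
    exact/measurable_EFinP/measurable_funX.
  by apply: (measurableT_comp (measurable_cone_part mh)); exact: measurable_fun_rowZ.
rewrite -ge0_integralZl//; last first.
  move=> t; rewrite /= in_itv/= andbT => t0.
  by rewrite mule_ge0// lee_fin exprn_ge0// ltW.
apply: eq_integral => t; rewrite inE/= in_itv/= andbT => t0.
rewrite /cone_part /polar hatvZ// hatv_usphere// enormZ gtr0_norm// u1 mulr1.
rewrite !muleA [_ * h _ in LHS]muleC -!muleA -!EFinM [RHS]muleC; congr (_ * _%:E).
rewrite /sphere_area ball_volE; field.
by rewrite !gt_eqF ?vol_unit_ball_gt0 ?exprn_gt0// ltr0n.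
Qed.

Lemma ge0_integral_polar_product :
  \int[leb]_x (h (hatv x, enorm x) * (sphere_area d (enorm x))^-1%:E) =
  \int[sigma \x mu]_z h z.
Proof.
pose H u := \int[mu]_t h (u, t).
have mH : measurable_fun setT H by exact: measurable_fun_fubini_tonelli_F.
have H0 u : 0 <= H u by exact: integral_ge0.
have mB := @measurable_unit_ball R d; have mS := @measurable_usphere R d.
rewrite (ge0_integral_polar d_gt0 (measurable_cone_part mh) cone_part_ge0).
rewrite fubini_tonelli1// -[RHS]/(\int[sigma]_u H u).
have -> : \int[sigma]_u H u = \int[sigma]_(u in usphere) H u.
  rewrite [RHS]integral_mkcond; apply: eq_integral => u _; rewrite patchE.
  case: ifPn => // /negP uS; apply: integral0_eq => t _.
  by rewrite h_supp// => -[/mem_set].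
rewrite ge0_integral_sphere//; last exact: measurable_funTS.
have mr : measurable_fun setT (radial_integral (cone_part h) \o @hatv R d).
  apply: (measurableT_comp _ (@measurable_hatv R d)).
  exact: (measurable_radial_integral (measurable_cone_part mh)) cone_part_ge0.
have mHS : measurable_fun setT ((H \_ usphere) \o @hatv R d).
  apply: (measurableT_comp _ (@measurable_hatv R d)).
  by apply/(measurable_restrictT _ mS); exact: measurable_funTS.
have HS0 u : 0 <= (H \_ usphere) u by apply: erestrict_ge0 => *.
have vol_inv_ge0 : 0 <= vol^-1%:E.
  by rewrite lee_fin invr_ge0 ltW// vol_unit_ball_gt0.
rewrite -ge0_integralZl//=; last 2 first.
- exact: measurable_funTS.
- by move=> x _; exact: radial_integral_ge0.
rewrite -[RHS]ge0_integralZl//=; last exact: measurable_funTS.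
apply: ae_eq_integral => //.
- by apply: emeasurable_funM => //; exact: measurable_funTS.
- by apply: emeasurable_funM => //; exact: measurable_funTS.
- apply: filterS (ae_row_neq0 R d_gt0) => x x0 _.
  have xS : usphere (hatv x) by exact/usphere_hatv.
  by rewrite radial_integral_cone_part// patchE mem_set.
Qed.

End product.

Section integrable_product.
Local Open Scope ereal_scope.
Variable h : 'rV[R]_d * measurableTypeR R -> \bar R.
Hypotheses (ih : (sigma \x mu).-integrable setT h)
  (h_supp : forall u t, ~ (usphere u /\ 0 < t)%R -> h (u, t) = 0).

Let mh : measurable_fun setT h. Proof. by case/integrableP: ih. Qed.

Let sphere_area_inv_ge0 (x : 'rV[R]_d) : (0 <= (sphere_area d (enorm x))^-1)%R.
Proof. by rewrite invr_ge0 sphere_area_ge0// enorm_ge0. Qed.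

Lemma integrable_polar_product : leb.-integrable setT (cone_part h).
Proof.
apply/integrableP; split; first exact: measurable_cone_part.
case/integrableP: ih => _; rewrite -ge0_integral_polar_product; last 3 first.
- exact: measurableT_comp.
- by move=> u t ut; rewrite h_supp// abse0.
- by [].
apply: le_lt_trans; rewrite le_eqVlt; apply/orP; left; apply/eqP.
by apply: eq_integral => x _; rewrite /cone_part abseM [X in _ * X]gee0_abs ?lee_fin.
Qed.

Lemma integral_polar_product : \int[leb]_x cone_part h x = \int[sigma \x mu]_z h z.
Proof.
rewrite integralE [RHS]integralE; congr (_ - _).
- rewrite -ge0_integral_polar_product; last 3 first.
  + exact: measurable_funepos.
  + by move=> u t ut; rewrite funeposE h_supp// maxxx.
  + by [].
  apply: eq_integral => x _.
  by rewrite !funeposE /cone_part muleC [RHS]muleC maxe_pMr ?mule0// lee_fin.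
- rewrite -ge0_integral_polar_product; last 3 first.
  + exact: measurable_funeneg.
  + by move=> u t ut; rewrite funenegE h_supp// oppe0 maxxx.
  + by [].
  apply: eq_integral => x _.
  by rewrite !funenegE /cone_part muleC [RHS]muleC maxe_pMr ?mule0 ?muleN// lee_fin.
Qed.

End integrable_product.

Section radial_times_spherical.
Variables (psi : R -> R) (g : 'rV[R]_d -> R).
Hypotheses (ipsi : mu.-integrable `[0%R, +oo[ (EFin \o psi)) (bg : sbounded g).

Let f (x : 'rV[R]_d) : R := psi (enorm x) / sphere_area d (enorm x) * g (hatv x).

Let psi_pos := psi \_ (`]0%R, +oo[ : set R).
Let g_sphere := g \_ usphere.

Let integrable_psi_pos : mu.-integrable setT (EFin \o psi_pos).
Proof.
rewrite -restrict_EFin; apply/integrable_restrict; rewrite ?setTI//.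
by apply: integrableS ipsi => // t; rewrite /= !in_itv/= !andbT => /ltW.
Qed.

Let integrable_g_sphere : sigma.-integrable setT (EFin \o g_sphere).
Proof.
rewrite -restrict_EFin; apply/integrable_restrict; rewrite ?setTI//.
  exact: measurable_usphere.
exact: integrable_sphere.
Qed.

Let fE : EFin \o f = fun x =>
  ((g_sphere (hatv x) * psi_pos (enorm x))%:E * (sphere_area d (enorm x))^-1%:E)%E.
Proof.
apply/funext => x; rewrite -EFinM /f /g_sphere /psi_pos/= !patchE.
have [->|x0] := eqVneq x 0; first by rewrite enorm0 sphere_area0 invr0 !(mulr0, mul0r).
rewrite mem_set; last exact/usphere_hatv.
by rewrite mem_setE in_itv/= andbT enorm_gt0 x0; congr EFin; ring.
Qed.

Let product_supp u t : ~ (usphere u /\ 0 < t) -> (g_sphere u * psi_pos t)%:E = 0%E.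
Proof.
rewrite /g_sphere /psi_pos !patchE mem_setE in_itv/= andbT.
have [uS|] := boolP (u \in usphere); last by rewrite mul0r.
by have [t0 []|] := ifPn; rewrite ?mulr0//; split=> //; rewrite inE in uS.
Qed.

Lemma integrable_radial_spherical : leb.-integrable setT (EFin \o f).
Proof.
have [ih _] := integral_prod_mul integrable_g_sphere integrable_psi_pos.
by rewrite fE; exact: (integrable_polar_product ih product_supp).
Qed.

Lemma iint_radial_spherical :
  iint f = ((\int[mu]_(t in `[0%R, +oo[) psi t) * sphere_mean g)%:E.
Proof.
have [ih prodE] := integral_prod_mul integrable_g_sphere integrable_psi_pos.
rewrite iint_integral; last exact: integrable_radial_spherical.
transitivity (\int[leb]_x (EFin \o f) x)%E => //.
rewrite fE [LHS](integral_polar_product ih product_supp) prodE mulrC EFinM.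
rewrite /sphere_mean /Rintegral !fineK; last 2 first.
- by apply: integrable_fin_num => //.
- apply: integrable_fin_num; last exact: integrable_sphere.
  exact: measurable_usphere.
congr (_ * _)%E.
  rewrite [RHS]integral_mkcond; apply: eq_integral => u _.
  by rewrite /= /g_sphere !patchE; case: ifP.
rewrite -[RHS]integral_itv_obnd_cbnd; last first.
  by apply: measurable_funS (measurable_int _ ipsi) => // t; rewrite /= !in_itv/= !andbT => /ltW.
by rewrite [RHS]integral_mkcond; apply: eq_integral => t _; rewrite /= /psi_pos !patchE; case: ifP.
Qed.

End radial_times_spherical.

Let ball_profile := (@sphere_area R d) \_ (`[0, 1] : set R).

Let integral_ball_profile (D : set R) : `[0, 1]%classic `<=` D ->
  (\int[mu]_(t in D) (ball_profile t)%:E = vol%:E)%E.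
Proof.
move=> D01; have mpow : measurable_fun (`[0, 1] : set R) (fun t : R => (d%:R * t ^+ d.-1)%:E).
  by apply/measurable_EFinP; apply: measurable_funM => //; exact: measurable_funX.
transitivity (\int[mu]_(t in `[0%R, 1%R]) (vol%:E * (d%:R * t ^+ d.-1)%:E))%E.
  rewrite -(setIidr D01) integral_mkcondr; apply: eq_integral => t _.
  rewrite /ball_profile !patchE; case: ifP => // _.
  by rewrite -EFinM /sphere_area ball_volE; congr EFin; ring.
rewrite ge0_integralZl// ?integral_pow_unit_itv ?mule1// ?lee_fin ?ltW ?vol_unit_ball_gt0//.
by move=> t; rewrite /= in_itv/= => /andP[t0 _]; rewrite lee_fin mulr_ge0// exprn_ge0.
Qed.

Let integrable_ball_profile : mu.-integrable `[0%R, +oo[ (EFin \o ball_profile).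
Proof.
have profile_ge0 t : 0 <= ball_profile t.
  rewrite /ball_profile patchE; case: ifPn => //; rewrite mem_setE in_itv/=.
  by move=> /andP[t0 _]; exact: sphere_area_ge0.
apply/integrableP; split.
  apply/measurable_EFinP; apply: measurable_funTS.
  apply/(measurable_restrictT _ (measurable_itv _)).
  by apply: measurable_funM => //; exact: measurable_funX.
under eq_integral do rewrite /= ger0_norm//.
rewrite integral_ball_profile ?ltry// => t.
by rewrite /= !in_itv/= andbT => /andP[].
Qed.

Lemma sphere_intE g : sbounded g -> sphere_int g = (sphere_mean g)%:E.
Proof.
move=> bg; pose f x := ball_profile (enorm x) / sphere_area d (enorm x) * g (hatv x).
have fi : leb.-integrable setT (EFin \o f).
  exact: (integrable_radial_spherical integrable_ball_profile bg).
have fE x : (if enorm x <= 1 then 1 else 0) * g (hatv x) = f x + g 0 * \1_[set 0] x.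
  rewrite /f /ball_profile patchE mem_setE in_itv/= enorm_ge0/= indicE.
  have [->|x0] := eqVneq x 0.
    by rewrite mem_set// enorm0 ler01 sphere_area0 invr0 hatv0 !(mulr0, mul0r) add0r mul1r mulr1.
  rewrite memNset ?mulr0 ?addr0; last exact/eqP.
  by case: ifP => _; rewrite ?mul0r// divff// gt_eqF// sphere_area_gt0// enorm_gt0.
have m0 := @measurable_row_set0 R d.
have i0 : leb.-integrable setT (fun x => (\1_[set 0] x)%:E).
  apply/integrableP; split; first by apply/measurable_EFinP; exact: measurable_indic.
  under eq_integral do rewrite /= ger0_norm//.
  by rewrite integral_indic// setIT /= lebesgue_row_set0 ?ltry.
have zi := integrableZl measurableT (g 0) i0.
rewrite /sphere_int ball_volE (funext fE) iint_integral; last first.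
  by apply: eq_integrable (integrableD measurableT fi zi).
rewrite -[X in (X * _)%E]/(\int[leb]_x ((f x)%:E + (g 0)%:E * (\1_[set 0] x)%:E))%E.
rewrite integralD// integralZl// integral_indic// setIT /= lebesgue_row_set0// mule0 adde0.
rewrite -iint_integral// (iint_radial_spherical integrable_ball_profile bg).
rewrite /Rintegral integral_ball_profile => [|t]; last first.
  by rewrite /= !in_itv/= andbT => /andP[].
by rewrite -EFinM mulrAC divff ?mul1r// gt_eqF// vol_unit_ball_gt0.
Qed.

End polar_integrals.

(** * Homogeneous polynomials and harmonic decomposition *)

Section homogeneous_polynomials.
Variables (R : realType) (d : nat).
Implicit Types (P Q f g : 'rV[R]_d -> R) (x y v : 'rV[R]_d).

Inductive hpoly : nat -> ('rV[R]_d -> R) -> Prop :=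
| hpoly0 k : hpoly k (fun=> 0)
| hpolyC c : hpoly 0 (fun=> c)
| hpolyD k f g : hpoly k f -> hpoly k g -> hpoly k (fun x => f x + g x)
| hpolyX k i f : hpoly k f -> hpoly k.+1 (fun x => x 0 i * f x).

Lemma eq_hpoly k f g : f =1 g -> hpoly k f -> hpoly k g.
Proof. by move=> /funext ->. Qed.

Lemma hpolyZ k c f : hpoly k f -> hpoly k (fun x => c * f x).
Proof.
elim=> {k f} [k|c'|k f g _ hf _ hg|k i f _ hf].
- by apply: eq_hpoly (hpoly0 k) => x; rewrite mulr0.
- exact: (hpolyC (c * c')).
- by apply: eq_hpoly (hpolyD hf hg) => x; rewrite mulrDr.
- by apply: eq_hpoly (hpolyX i hf) => x; rewrite mulrCA.
Qed.

Lemma hpolyB k f g : hpoly k f -> hpoly k g -> hpoly k (fun x => f x - g x).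
Proof.
move=> hf /(hpolyZ (-1)) hg; apply: eq_hpoly (hpolyD hf hg) => x.
by rewrite mulN1r.
Qed.

Lemma hpoly_sum (I : Type) (r : seq I) (p : pred I) k (f : I -> 'rV[R]_d -> R) :
  (forall i, p i -> hpoly k (f i)) -> hpoly k (fun x => \sum_(i <- r | p i) f i x).
Proof.
move=> hf; elim: r => [|i r IH].
  by apply: eq_hpoly (hpoly0 k) => x; rewrite big_nil.
have [pi|pi] := boolP (p i).
  by apply: eq_hpoly (hpolyD (hf i pi) IH) => x; rewrite big_cons pi.
by apply: eq_hpoly IH => x; rewrite big_cons (negbTE pi).
Qed.

Lemma hpolyM k l f g : hpoly k f -> hpoly l g -> hpoly (k + l) (fun x => f x * g x).
Proof.
move=> hf hg; elim: hf => {k f} [k|c|k f f' _ hf _ hf'|k i f _ hf].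
- by apply: eq_hpoly (hpoly0 _) => x; rewrite mul0r.
- exact: hpolyZ.
- by apply: eq_hpoly (hpolyD hf hf') => x; rewrite mulrDl.
- by apply: eq_hpoly (hpolyX i hf) => x; rewrite mulrA.
Qed.

Lemma hpoly_coord i : hpoly 1 (fun x => x 0 i).
Proof. by apply: eq_hpoly (hpolyX i (hpolyC 1)) => x; rewrite mulr1. Qed.

Lemma hpoly_exp k n f : hpoly k f -> hpoly (k * n) (fun x => f x ^+ n).
Proof.
move=> hf; elim: n => [|n IH]; first by rewrite muln0; exact: hpolyC.
by rewrite mulnS; apply: eq_hpoly (hpolyM hf IH) => x; rewrite exprS.
Qed.

Lemma hpoly_dotv_exp u n : hpoly n (fun x => dotv u x ^+ n).
Proof.
have hu : hpoly 1 (dotv u).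
  by apply: hpoly_sum => i _; apply: hpolyZ; exact: hpoly_coord.
by have := hpoly_exp n hu; rewrite mul1n.
Qed.

Lemma hpoly_sqnorm_exp n : hpoly n.*2 (fun x => dotv x x ^+ n).
Proof.
rewrite -mul2n; apply: hpoly_exp; apply: hpoly_sum => i _.
exact: (hpolyX i (hpoly_coord i)).
Qed.

Lemma hpoly_mulmx k P (O : 'M[R]_d) : hpoly k P -> hpoly k (fun x => P (x *m O)).
Proof.
elim=> {k P} [k|c|k f g _ hf _ hg|k i f _ hf].
- exact: hpoly0.
- exact: hpolyC.
- exact: hpolyD.
- have hO : hpoly 1 (fun x => (x *m O) 0 i).
    have h : hpoly 1 (fun x => \sum_j O j i * x 0 j).
      by apply: hpoly_sum => j _; apply: hpolyZ; exact: hpoly_coord.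
    by apply: eq_hpoly h => x; rewrite mxE; apply: eq_bigr => j _; rewrite mulrC.
  exact: (hpolyM hO hf).
Qed.

Lemma homog_poly_const c : homog_poly 0 (fun _ : 'rV[R]_d => c).
Proof.
exists (fun=> c) => x; rewrite (bigD1 [ffun=> ord0])/=; last first.
  by rewrite big1// => i _; rewrite ffunE.
rewrite !big1 ?mulr1 ?addr0// => [m /andP[_ /negP m0]|i _]; last first.
  by rewrite ffunE expr0.
by exfalso; apply: m0; apply/eqP/ffunP => i; rewrite ffunE ord1.
Qed.

Lemma homog_polyD k f g : homog_poly k f -> homog_poly k g ->
  homog_poly k (fun x => f x + g x).
Proof.
move=> [c fc] [c' gc']; exists (fun m => c m + c' m) => x.
by rewrite fc gc' -big_split/=; apply: eq_bigr => m _; rewrite mulrDl.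
Qed.

Lemma homog_poly_coordM k i f : homog_poly k f ->
  homog_poly k.+1 (fun x => x 0 i * f x).
Proof.
move=> [c fc].
pose incr (m : {ffun 'I_d -> 'I_k.+1}) : {ffun 'I_d -> 'I_k.+2} :=
  [ffun j => inord (m j + (j == i))%N].
have incrE (m : {ffun 'I_d -> 'I_k.+1}) j : incr m j = (m j + (j == i))%N :> nat.
  rewrite ffunE inordK// ltnS.
  by case: (j == i); rewrite ?addn1 ?addn0 ?ltn_ord// ltnW.
exists (fun m' => \sum_(m : {ffun 'I_d -> 'I_k.+1} |
  ((\sum_(i < d) (m i : nat))%N == k) && (m' == incr m)) c m) => x.
rewrite fc mulr_sumr; under [RHS]eq_bigr do rewrite mulr_suml.
rewrite (exchange_big_dep (fun m : {ffun 'I_d -> 'I_k.+1} =>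
  (\sum_(i < d) (m i : nat))%N == k))/=; last by move=> m' m _ /andP[].
apply: eq_bigr => m mk; rewrite (big_pred1 (incr m)) => [|m']/=.
  rewrite mulrCA; congr (_ * _); rewrite [RHS](bigD1 i)//= [in LHS](bigD1 i)//=.
  rewrite incrE eqxx addn1 exprS mulrA; congr (_ * _).
  by apply: eq_bigr => j ji; rewrite incrE (negbTE ji) addn0.
rewrite mk/=; have [->|_] := eqVneq m' (incr m); last by rewrite andbF.
rewrite andbT; under eq_bigr do rewrite incrE.
by rewrite big_split/= (eqP mk) (bigD1 i)//= eqxx big1 ?addn0 ?addn1 ?eqxx// => j /negbTE ->.
Qed.

Lemma homog_polyP k P : homog_poly k P <-> hpoly k P.
Proof.
split=> [[c Pc]|].
  rewrite (funext Pc); apply: hpoly_sum => m /eqP mk; apply: hpolyZ; rewrite -{1}mk.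
  elim: (index_enum _) => [|i r IH].
    by rewrite big_nil; apply: eq_hpoly (hpolyC 1) => x; rewrite big_nil.
  have := hpoly_exp (m i) (hpoly_coord i); rewrite mul1n big_cons => hi.
  by apply: eq_hpoly (hpolyM hi IH) => x; rewrite big_cons.
elim=> {k P} [k|c|k f g _ hf _ hg|k i f _ hf].
- by exists (fun=> 0) => x; rewrite big1// => m _; rewrite mul0r.
- exact: homog_poly_const.
- exact: homog_polyD.
- exact: homog_poly_coordM.
Qed.

Lemma continuous_hpoly k P : hpoly k P -> continuous P.
Proof.
elim=> {k P} [k|c|k f g _ hf _ hg|k i f _ hf] x.
- exact: cst_continuous.
- exact: cst_continuous.
- by apply: continuousD; [exact: hf|exact: hg].
- by apply: continuousM; [exact: coord_continuous|exact: hf].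
Qed.

Lemma bounded_measurable_hpoly k P : hpoly k P -> bounded_measurable usphere P.
Proof.
elim=> {k P} [k|c|k f g _ hf _ hg|k i f _ hf].
- exact: bounded_measurable_cst.
- exact: bounded_measurable_cst.
- exact: bounded_measurableD.
- apply: bounded_measurableM => //; split.
    by apply: measurable_funTS; exact: measurable_row_coord.
  by exists 1 => u <-; exact: coord_le_enorm.
Qed.

Lemma size_mul1BX2 (q : {poly R}) : (size ((1 - 'X^2) * q)%R <= (size q).+2)%N.
Proof.
apply: (leq_trans (size_polyMleq _ _)); rewrite -[leqRHS]/(3 + size q).-1.
rewrite -!subn1 leq_sub2r// leq_add2r (leq_trans (size_polyD _ _))//.
by rewrite geq_max size_polyN size_polyXn (leq_trans (size_polyC_leq1 _)).
Qed.

(* The restriction of a polynomial to the circle through the orthonormal vectors [e]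
   and [f], using [s ^ 2 = 1 - t ^ 2]. *)
Lemma hpoly_circle k P (e f : 'rV[R]_d) : hpoly k P ->
  exists A B : {poly R}, [/\ (size A <= k.+1)%N, (size B <= k)%N &
    forall t s, t ^+ 2 + s ^+ 2 = 1 -> P (t *: e + s *: f) = A.[t] + s * B.[t]].
Proof.
have sizeD (p q : {poly R}) n : (size p <= n)%N -> (size q <= n)%N -> (size (p + q)%R <= n)%N.
  by move=> pn qn; rewrite (leq_trans (size_polyD _ _))// geq_max pn.
have sizeZ a (p : {poly R}) n : (size p <= n)%N -> (size (a *: p) <= n)%N.
  exact/leq_trans/size_scale_leq.
have sizeMX (p : {poly R}) n : (size p <= n)%N -> (size ('X * p)%R <= n.+1)%N.
  move=> pn; rewrite (leq_trans (size_polyMleq _ _))// size_polyX.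
  by rewrite add2n /= ltnS.
elim=> {k P} [k|c|k P Q _ [A [B [sA sB PAB]]] _ [A' [B' [sA' sB' QAB]]]
             |k i P _ [A [B [sA sB PAB]]]].
- exists 0, 0; split; rewrite ?size_poly0// => t s _.
  by rewrite !horner0 mulr0 addr0.
- exists c%:P, 0; split; rewrite ?size_poly0// ?size_polyC_leq1// => t s _.
  by rewrite hornerC horner0 mulr0 addr0.
- exists (A + A'), (B + B'); split; [exact: sizeD|exact: sizeD|move=> t s ts].
  by rewrite PAB// QAB// !hornerD; ring.
- exists (e 0 i *: ('X * A) + f 0 i *: ((1 - 'X^2) * B)), (f 0 i *: A + e 0 i *: ('X * B)).
  split.
  + apply: sizeD; apply: sizeZ; first exact: sizeMX.
    exact: leq_trans (size_mul1BX2 _) _.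
  + by apply: sizeD; apply: sizeZ => //; exact: sizeMX.
  + move=> t s ts; rewrite PAB// !mxE.
    rewrite !(hornerD, hornerN, hornerM, hornerZ, hornerC, hornerX, hornerXn).
    have -> : 1 - t ^+ 2 = s ^+ 2 by rewrite -ts; ring.
    ring.
Qed.

End homogeneous_polynomials.
Arguments hpoly0 {R d} k.
Arguments hpolyC {R d} c.

Section laplacian.
Variables (R : realType) (d : nat).
Implicit Types (P Q f g : 'rV[R]_d -> R) (x y v : 'rV[R]_d).

Lemma is_derive_coord x v i : is_derive x v (fun y : 'rV[R]_d => y 0 i) (v 0 i).
Proof.
have h : (fun h : R => h^-1 *: ((h *: v + x) 0 i - x 0 i)) @ 0^' --> v 0 i.
  apply: cvg_near_cst; near=> t.
  rewrite !mxE addrK [_ *: _]mulrA mulVf ?mul1r//.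
  by near: t; exact: nbhs_dnbhs_neq.
by split; [exact: cvgP h|exact: cvg_lim h].
Unshelve. all: by end_near. Qed.

Definition partial (i : 'I_d) P : 'rV[R]_d -> R := fun y => 'D_(delta_mx 0 i) P y.

Lemma partial_gradient P (G : 'I_d -> 'rV[R]_d -> R) :
  (forall x v, is_derive x v P (\sum_i v 0 i * G i x)) -> forall i, partial i P = G i.
Proof.
move=> h i; apply/funext => x; rewrite /partial; have [_ ->] := h x (delta_mx 0 i).
rewrite (bigD1 i)//= mxE !eqxx mul1r big1 ?addr0// => j /negbTE ji.
by rewrite mxE ji andbF mul0r.
Qed.

Lemma is_derive_coordM i f (G : 'I_d -> 'rV[R]_d -> R) x v :
  is_derive x v f (\sum_j v 0 j * G j x) ->
  is_derive x v (fun x => x 0 i * f x)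
    (\sum_j v 0 j * ((j == i)%:R * f x + x 0 i * G j x)).
Proof.
move=> df; have -> : \sum_j v 0 j * ((j == i)%:R * f x + x 0 i * G j x) =
    x 0 i *: (\sum_j v 0 j * G j x) + f x *: v 0 i.
  under eq_bigr do rewrite mulrDr.
  rewrite big_split/= (bigD1 i)//= eqxx mul1r big1 => [|j /negbTE ->]; last first.
    by rewrite mul0r mulr0.
  rewrite addr0 addrC; congr (_ + _); last by rewrite [_ *: _]mulrC.
  by rewrite [_ *: _]mulr_sumr; apply: eq_bigr => j _; rewrite mulrCA.
exact: is_deriveM (is_derive_coord x v i) df.
Qed.

Lemma hpoly_gradient k P : hpoly k P -> exists G : 'I_d -> 'rV[R]_d -> R,
  [/\ forall i, (if k is k'.+1 then hpoly k' (G i) else forall x, G i x = 0),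
      forall x v, is_derive x v P (\sum_i v 0 i * G i x) &
      forall x, \sum_i x 0 i * G i x = k%:R * P x].
Proof.
elim=> {k P} [k|c|k f g _ [G [G1 G2 G3]] _ [G' [G'1 G'2 G'3]]|k i f hf [G [G1 G2 G3]]].
- exists (fun _ _ => 0); split => [i|x v|x].
  + by case: k => // k; exact: hpoly0.
  + by rewrite big1 => [|i _]; [exact: is_derive_cst|rewrite mulr0].
  + by rewrite big1 => [|i _]; rewrite !mulr0.
- exists (fun _ _ => 0); split => [//|x v|x].
  + by rewrite big1 => [|i _]; [exact: is_derive_cst|rewrite mulr0].
  + by rewrite big1 => [|i _]; rewrite ?mulr0 ?mul0r.
- exists (fun i x => G i x + G' i x); split => [i|x v|x].
  + case: k G1 G'1 {G3 G'3} => [|k] G1 G'1 => [x|]; first by rewrite G1 G'1 addr0.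
    exact: hpolyD.
  + apply: is_derive_eq (is_deriveD (G2 x v) (G'2 x v)) _.
    by rewrite -big_split/=; apply: eq_bigr => i _; rewrite mulrDr.
  + by under eq_bigr do rewrite mulrDr; rewrite big_split/= G3 G'3 mulrDr.
- exists (fun j x => (j == i)%:R * f x + x 0 i * G j x); split => [j|x v|x].
  + apply: hpolyD; first exact: hpolyZ.
    case: k hf G1 {G2 G3} => [|k] hf G1; last exact: hpolyX.
    by apply: eq_hpoly (hpoly0 0) => x; rewrite G1 mulr0.
  + exact: is_derive_coordM.
  + under eq_bigr do rewrite mulrDr; rewrite big_split/= (bigD1 i)//= eqxx mul1r.
    rewrite big1 => [|j /negbTE ->]; last by rewrite mul0r mulr0.
    by under eq_bigr do rewrite mulrCA; rewrite -mulr_sumr G3 addr0 -natr1; ring.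
Qed.

Lemma is_derive_hpoly k P x v : hpoly k P ->
  is_derive x v P (\sum_i v 0 i * partial i P x).
Proof.
move=> /hpoly_gradient[G [_ h _]]; have := h x v.
by under eq_bigr do rewrite -(partial_gradient h).
Qed.

Lemma hpoly_partial k i P : hpoly k.+1 P -> hpoly k (partial i P).
Proof. by move=> /hpoly_gradient[G [h0 h _]]; rewrite (partial_gradient h). Qed.

Lemma partial_hpoly0 i P : hpoly 0 P -> partial i P = fun=> 0.
Proof.
by move=> /hpoly_gradient[G [h0 h _]]; rewrite (partial_gradient h); exact/funext.
Qed.

Lemma hpoly_partial_pred k i P : hpoly k P -> hpoly k.-1 (partial i P).
Proof.
by case: k => [/partial_hpoly0 ->|k]; [exact: hpoly0|exact: hpoly_partial].
Qed.

Lemma euler_identity k P x : hpoly k P -> \sum_i x 0 i * partial i P x = k%:R * P x.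
Proof.
move=> /hpoly_gradient[G [_ h <-]]; apply: eq_bigr => i _.
by rewrite (partial_gradient h).
Qed.

Lemma derivable_hpoly k P x v : hpoly k P -> derivable P x v.
Proof. by move=> hP; have [] := is_derive_hpoly x v hP. Qed.

Lemma partialD k l i P Q : hpoly k P -> hpoly l Q ->
  partial i (fun x => P x + Q x) = fun x => partial i P x + partial i Q x.
Proof.
move=> hP hQ; apply/funext => x.
by apply: deriveD; [exact: derivable_hpoly hP|exact: derivable_hpoly hQ].
Qed.

Lemma partialZ k i c P : hpoly k P ->
  partial i (fun x => c * P x) = fun x => c * partial i P x.
Proof. move=> hP; apply/funext => x; apply: deriveZ; exact: derivable_hpoly hP. Qed.

Lemma partial_coordM k i j P : hpoly k P ->
  partial i (fun x => x 0 j * P x) = fun x => (i == j)%:R * P x + x 0 j * partial i P x.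
Proof.
move=> hP; apply: (partial_gradient
  (G := fun i x => (i == j)%:R * P x + x 0 j * partial i P x)) => x v.
exact: (is_derive_coordM j (G := partial^~ P) (is_derive_hpoly x v hP)).
Qed.

Lemma partial_sum (I : Type) (r : seq I) k i (f : I -> 'rV[R]_d -> R) :
  (forall j, hpoly k (f j)) ->
  partial i (fun x => \sum_(j <- r) f j x) = fun x => \sum_(j <- r) partial i (f j) x.
Proof.
move=> hf; elim: r => [|j r IH].
  rewrite (_ : (fun x => _) = fun=> 0); last by apply/funext => x; rewrite big_nil.
  by rewrite (partial_hpoly0 _ (hpoly0 0)); apply/funext => x; rewrite big_nil.
rewrite (_ : (fun x => _) = fun x => f j x + \sum_(j <- r) f j x); last first.
  by apply/funext => x; rewrite big_cons.
rewrite (@partialD k k)//; last exact: hpoly_sum.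
by apply/funext => x; rewrite IH big_cons.
Qed.

Lemma partial_mulmx k i P (O : 'M[R]_d) : hpoly k P ->
  partial i (fun y => P (y *m O)) = fun y => \sum_j O i j * partial j P (y *m O).
Proof.
move=> hP; apply/funext => y; rewrite /partial /derive.
under eq_fun do rewrite /= mulmxDl -scalemxAl -rowE.
have [_] := is_derive_hpoly (y *m O) (row i O) hP; rewrite /derive => ->.
by apply: eq_bigr => j _; rewrite mxE.
Qed.

Lemma laplacianE P x : laplacian P x = \sum_i partial i (partial i P) x.
Proof. by []. Qed.

Lemma laplacian_lt2 k P : (k < 2)%N -> hpoly k P -> forall x, laplacian P x = 0.
Proof.
move=> k2 hP x; rewrite laplacianE big1// => i _.
case: k k2 hP => [_ hP|[|]// _ hP].
  by rewrite (partial_hpoly0 _ hP) (partial_hpoly0 _ (hpoly0 0)).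
by rewrite (partial_hpoly0 _ (hpoly_partial i hP)).
Qed.

Lemma hpoly_laplacian k P : hpoly k.+2 P -> hpoly k (laplacian P).
Proof. by move=> hP; apply: hpoly_sum => i _; do 2 apply: hpoly_partial. Qed.

Lemma laplacianD k l P Q x : hpoly k P -> hpoly l Q ->
  laplacian (fun x => P x + Q x) x = laplacian P x + laplacian Q x.
Proof.
move=> hP hQ; rewrite !laplacianE -big_split/=; apply: eq_bigr => i _.
by rewrite (partialD _ hP hQ) (partialD _ (hpoly_partial_pred i hP) (hpoly_partial_pred i hQ)).
Qed.

Lemma laplacianZ k c P x : hpoly k P ->
  laplacian (fun x => c * P x) x = c * laplacian P x.
Proof.
move=> hP; rewrite !laplacianE mulr_sumr; apply: eq_bigr => i _.
by rewrite (partialZ _ _ hP) (partialZ _ _ (hpoly_partial_pred i hP)).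
Qed.

Lemma laplacian_sum (I : Type) (r : seq I) k (f : I -> 'rV[R]_d -> R) x :
  (forall i, hpoly k (f i)) ->
  laplacian (fun x => \sum_(i <- r) f i x) x = \sum_(i <- r) laplacian (f i) x.
Proof.
move=> hf; rewrite laplacianE exchange_big; apply: eq_bigr => i _.
rewrite (partial_sum _ _ hf) (@partial_sum _ _ k.-1)// => j.
exact: hpoly_partial_pred.
Qed.

Lemma laplacian_coordM k j P x : hpoly k P ->
  laplacian (fun x => x 0 j * P x) x = x 0 j * laplacian P x + 2 * partial j P x.
Proof.
move=> hP; rewrite !laplacianE mulr_sumr.
transitivity (\sum_i (x 0 j * partial i (partial i P) x +
    (i == j)%:R * (2 * partial j P x))).
  apply: eq_bigr => i _; rewrite (partial_coordM _ _ hP).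
  have hP' := hpoly_partial_pred i hP.
  rewrite (partialD _ (hpolyZ _ hP) (hpolyX j hP')) (partialZ _ _ hP).
  by rewrite (partial_coordM _ _ hP'); case: eqP => [->|_] /=; ring.
rewrite big_split/=; congr (_ + _); rewrite (bigD1 j)//= eqxx mul1r big1 ?addr0//.
by move=> i /negbTE ->; rewrite mul0r.
Qed.

Lemma laplacian_sqnormM k P x : hpoly k P ->
  laplacian (fun x => dotv x x * P x) x =
  dotv x x * laplacian P x + (2 * d%:R + 4 * k%:R) * P x.
Proof.
move=> hP.
have -> : (fun x => dotv x x * P x) = fun x => \sum_j x 0 j * (x 0 j * P x).
  by apply/funext => y; rewrite mulr_suml; apply: eq_bigr => j _; rewrite mulrA.
rewrite (@laplacian_sum _ _ k.+2); last by move=> j; do 2 apply: hpolyX.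
transitivity (\sum_j (x 0 j * x 0 j * laplacian P x +
    4 * (x 0 j * partial j P x) + 2 * P x)).
  apply: eq_bigr => j _.
  rewrite (laplacian_coordM _ _ (hpolyX j hP)) (laplacian_coordM _ _ hP).
  by rewrite (partial_coordM _ _ hP) eqxx /=; ring.
rewrite !big_split/= -mulr_suml -mulr_sumr (euler_identity _ hP) sumr_const card_ord.
by rewrite -[X in _ + X]mulr_natr /dotv; ring.
Qed.

Definition sqnorm_laplacian_coef (l i : nat) : R :=
  \sum_(j < i) (2 * d%:R + 4 * (j.*2 + l)%:R).

Lemma laplacian_sqnormXM l i P x : hpoly l P -> (forall x, laplacian P x = 0) ->
  laplacian (fun x => dotv x x ^+ i.+1 * P x) x =
  sqnorm_laplacian_coef l i.+1 * (dotv x x ^+ i * P x).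
Proof.
move=> hP P0; elim: i x => [|i IH] x.
  rewrite /sqnorm_laplacian_coef big_ord1 add0n expr0 mul1r.
  by under eq_fun do rewrite expr1; rewrite (laplacian_sqnormM _ hP) P0 mulr0 add0r.
have hQ := hpolyM (@hpoly_sqnorm_exp R d i.+1) hP.
rewrite (_ : (fun x => _) = fun x => dotv x x * (dotv x x ^+ i.+1 * P x)); last first.
  by apply/funext => y; rewrite exprS mulrA.
rewrite (laplacian_sqnormM _ hQ) IH /sqnorm_laplacian_coef [in RHS]big_ord_recr/= exprS.
ring.
Qed.

Lemma sqnorm_laplacian_coef_gt0 l i : (0 < d)%N -> 0 < sqnorm_laplacian_coef l i.+1.
Proof.
move=> d0; rewrite /sqnorm_laplacian_coef big_ord_recl/= ltr_wpDr//.
  by apply: sumr_ge0 => j _; rewrite addr_ge0// mulr_ge0.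
by rewrite ltr_wpDr ?mulr_ge0// mulr_gt0 ?ltr0n.
Qed.

(* The second order part of the chain rule is the trace of [O *m B *m O^T], with [B]
   the Hessian of [P]. *)
Lemma laplacian_mulmx k P (O : 'M[R]_d) x : orthogonal_mx O -> hpoly k P ->
  laplacian (fun y => P (y *m O)) x = laplacian P (x *m O).
Proof.
move=> oO hP; pose B := \matrix_(l, j) partial l (partial j P) (x *m O).
have hP' j := hpoly_partial_pred j hP.
transitivity (\tr (O *m (B *m O^T))).
  rewrite laplacianE; apply: eq_bigr => i _.
  rewrite (partial_mulmx _ _ hP) (@partial_sum _ _ k.-1); last first.
    by move=> j; apply: hpolyZ; exact: hpoly_mulmx.
  transitivity (\sum_j O i j * \sum_l O i l * B l j).
    apply: eq_bigr => j _; rewrite (partialZ _ _ (hpoly_mulmx O (hP' j))).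
    by rewrite (partial_mulmx _ _ (hP' j)); under [in RHS]eq_bigr do rewrite mxE.
  rewrite mxE; under eq_bigr do rewrite mulr_sumr.
  rewrite exchange_big; apply: eq_bigr => l _; rewrite mxE mulr_sumr.
  by apply: eq_bigr => j _; rewrite !mxE; ring.
rewrite mxtrace_mulC -mulmxA (mulmx1C oO) mulmx1 laplacianE.
by apply: eq_bigr => l _; rewrite mxE.
Qed.

Lemma harmonic_decomposition k P : (0 < d)%N -> hpoly k P ->
  exists H : nat -> 'rV[R]_d -> R,
    (forall i, (i <= k./2)%N -> hpoly (k - i.*2) (H i) /\ forall x, laplacian (H i) x = 0) /\
    forall x, P x = \sum_(i < k./2.+1) dotv x x ^+ i * H i x.
Proof.
move=> d0; elim/ltn_ind: k P => k IH P hP; have [k2|] := ltnP k 2.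
  have k20 : k./2 = 0%N by case: k k2 {IH hP} => [|[|]].
  exists (fun=> P); rewrite k20; split=> [i|x]; last by rewrite big_ord1 expr0 mul1r.
  by rewrite leqn0 => /eqP ->; rewrite subn0; split=> //; exact: (laplacian_lt2 k2 hP).
case: k hP IH => [|[|k]]// hP IH _.
have [|H [Hharm LPE]] := IH k _ _ (hpoly_laplacian hP); first by rewrite ltnS leqnSn.
pose c i := sqnorm_laplacian_coef (k - i.*2) i.+1.
pose Q x := \sum_(i < k./2.+1) (c i)^-1 * (dotv x x ^+ i.+1 * H i x).
have hterm (i : 'I_k./2.+1) : hpoly k.+2 (fun x => dotv x x ^+ i.+1 * H i x).
  have [hH _] := Hharm i (ltn_ord i : (i <= k./2)%N).
  have := hpolyM (@hpoly_sqnorm_exp R d i.+1) hH.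
  by rewrite doubleS !addSn subnKC// -geq_half_double -ltnS ltn_ord.
have hQ : hpoly k.+2 Q by apply: hpoly_sum => i _; exact: hpolyZ.
have LQ x : laplacian Q x = laplacian P x.
  rewrite (@laplacian_sum _ _ k.+2) => [|i]; last exact: hpolyZ.
  rewrite LPE; apply: eq_bigr => i _.
  have [hH LH] := Hharm i (ltn_ord i : (i <= k./2)%N).
  rewrite (laplacianZ _ _ (hterm i)) (laplacian_sqnormXM _ _ hH LH) mulKf//.
  by rewrite gt_eqF// sqnorm_laplacian_coef_gt0.
exists (fun i => if i is i'.+1 then fun x => (c i')^-1 * H i' x else fun x => P x - Q x).
split=> [[_|i ik]|x].
- rewrite subn0; split=> [|x]; first exact: hpolyB.
  rewrite (_ : (fun x => _) = fun x => P x + (-1) * Q x); last first.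
    by apply/funext => y; rewrite mulN1r.
  by rewrite (laplacianD _ hP (hpolyZ _ hQ)) (laplacianZ _ _ hQ) LQ mulN1r subrr.
- have [hH LH] := Hharm i ik; rewrite doubleS; split=> [|x]; first exact: hpolyZ.
  by rewrite (laplacianZ _ _ hH) LH mulr0.
- rewrite big_ord_recl expr0 mul1r [X in _ + X](_ : _ = Q x) ?subrK//.
  by apply: eq_bigr => i _; rewrite /= mulrCA.
Qed.

End laplacian.

(** * Spherical harmonics *)

Section spherical_harmonics.
Variables (R : realType) (d : nat).
Implicit Types (Y : 'rV[R]_d -> R) (k : nat).

Lemma sph_harmP k Y : sph_harm k Y <-> exists P, [/\ hpoly k P,
  forall x, laplacian P x = 0 & forall u, usphere u -> Y u = P u].
Proof.
split=> [[P [/homog_polyP hP [LP YP]]]|[P [hP LP YP]]]; exists P => //.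
by split; first exact/homog_polyP.
Qed.

Lemma eq_sph_harm k Y Y' : (forall u, usphere u -> Y u = Y' u) ->
  sph_harm k Y -> sph_harm k Y'.
Proof.
move=> YY' /sph_harmP[P [hP LP YP]]; apply/sph_harmP; exists P; split=> // u u1.
by rewrite -YY'// YP.
Qed.

Lemma sph_harmD k Y Y' : sph_harm k Y -> sph_harm k Y' -> sph_harm k (fun u => Y u + Y' u).
Proof.
move=> /sph_harmP[P [hP LP YP]] /sph_harmP[Q [hQ LQ YQ]]; apply/sph_harmP.
exists (fun x => P x + Q x); split=> [|x|u u1]; first exact: hpolyD.
  by rewrite (laplacianD _ hP hQ) LP LQ addr0.
by rewrite YP// YQ.
Qed.

Lemma sph_harmZ k c Y : sph_harm k Y -> sph_harm k (fun u => c * Y u).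
Proof.
move=> /sph_harmP[P [hP LP YP]]; apply/sph_harmP.
exists (fun x => c * P x); split=> [|x|u u1]; first exact: hpolyZ.
  by rewrite (laplacianZ _ _ hP) LP mulr0.
by rewrite YP.
Qed.

Lemma sph_harm_cst c : sph_harm 0 (fun _ : 'rV[R]_d => c).
Proof.
have hc := @hpolyC R d c; apply/sph_harmP; exists (fun=> c); split=> // x.
exact: (laplacian_lt2 (k := 0) _ hc).
Qed.

Lemma sph_harm0 k : sph_harm k (fun _ : 'rV[R]_d => 0).
Proof.
apply/sph_harmP; exists (fun=> 0); split=> [|x|//]; first exact: hpoly0.
exact: (laplacian_lt2 (k := 0) _ (hpoly0 0)).
Qed.

Lemma sph_harm_sum (I : Type) (r : seq I) k (Y : I -> 'rV[R]_d -> R) :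
  (forall i, sph_harm k (Y i)) -> sph_harm k (fun u => \sum_(i <- r) Y i u).
Proof.
move=> hY; elim: r => [|i r IH].
  by apply: eq_sph_harm (sph_harm0 k) => u _; rewrite big_nil.
by apply: eq_sph_harm (sph_harmD (hY i) IH) => u _; rewrite big_cons.
Qed.

Lemma sph_harm_mulmx k Y (O : 'M[R]_d) : orthogonal_mx O -> sph_harm k Y ->
  sph_harm k (fun u => Y (u *m O)).
Proof.
move=> oO /sph_harmP[P [hP LP YP]]; apply/sph_harmP.
exists (fun x => P (x *m O)); split=> [|x|u u1]; first exact: hpoly_mulmx.
  by rewrite (laplacian_mulmx _ oO hP) LP.
by rewrite YP//; exact/usphere_mulmx.
Qed.

Lemma bounded_measurable_sph_harm k Y : sph_harm k Y -> bounded_measurable usphere Y.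
Proof.
move=> /sph_harmP[P [hP _ YP]].
by apply: eq_bounded_measurable (bounded_measurable_hpoly hP) => u /YP.
Qed.

Lemma continuous_sph_harm k Y : sph_harm k Y -> {within usphere, continuous Y}.
Proof.
move=> /sph_harmP[P [hP _ YP]].
apply: (@subspace_eq_continuous _ _ _ (P : 'rV[R]_d -> R)).
  by move=> u; rewrite inE => /YP.
by apply: continuous_subspaceT; exact: continuous_hpoly hP.
Qed.

Lemma sph_harm_decomposition k P : (0 < d)%N -> hpoly k P ->
  exists H : nat -> 'rV[R]_d -> R,
    (forall i, (i <= k./2)%N -> sph_harm (k - i.*2) (H i)) /\
    forall u, usphere u -> P u = \sum_(i < k./2.+1) H i u.
Proof.
move=> d0 /(harmonic_decomposition d0)[H [harmH PE]]; exists H.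
split=> [i /harmH[hH LH]|u /usphereE u1]; first by apply/sph_harmP; exists (H i).
by rewrite PE u1; apply: eq_bigr => i _; rewrite expr1n mul1r.
Qed.

Definition zonal (e : 'rV[R]_d) Y :=
  forall u v, usphere u -> usphere v -> dotv e u = dotv e v -> Y u = Y v.

Lemma invariant_zonal e Y :
  (forall O, orthogonal_mx O -> e *m O = e -> forall u, usphere u -> Y (u *m O) = Y u) ->
  zonal e Y.
Proof.
move=> YO u v u1 v1 euv.
have uv : enorm u = enorm v by rewrite u1 v1.
have [Q [oQ <- eQ]] := orthogonal_mx_transitive uv euv.
by rewrite YO.
Qed.

Lemma zonal_poly k Y e : (1 < d)%N -> usphere e -> sph_harm k Y -> zonal e Y ->
  exists2 A : {poly R}, (size A <= k.+1)%N & forall u, usphere u -> Y u = A.[dotv e u].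
Proof.
move=> d1 e1 /sph_harmP[P [hP _ YP]] zY; have [e' e'1 ee'] := usphere_exists_orth d1 e1.
have [A [B [sizeA _ PE]]] := hpoly_circle e e' hP.
exists A => // u u1; set t := dotv e u.
have t2 : t ^+ 2 <= 1.
  by rewrite -[t ^+ 2]real_normK ?num_real// exprn_ile1 ?normr_ge0 ?normr_dotv_le1.
pose s := Num.sqrt (1 - t ^+ 2).
have ts : t ^+ 2 + s ^+ 2 = 1 by rewrite sqr_sqrtr ?subr_ge0// addrC subrK.
have YE r : t ^+ 2 + r ^+ 2 = 1 -> Y u = A.[t] + r * B.[t].
  move=> tr; rewrite -PE//.
  have [ee e'e'] := (conj ((usphereE e).1 e1) ((usphereE e').1 e'1)).
  have w1 : usphere (t *: e + r *: e').
    by apply/usphereE; rewrite !dotv_bilinear (dotvC e' e) ee' ee e'e'; lra.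
  by rewrite -YP//; apply: zY => //; rewrite !dotv_bilinear ee ee' mulr1 mulr0 addr0.
(* The value at [u] does not depend on the sign of [s]. *)
by have := YE _ ts; have := YE (- s); rewrite sqrrN => /(_ ts); lra.
Qed.

End spherical_harmonics.

Section sphere_inner_product.
Variables (R : realType) (d : nat).
Hypothesis d_gt0 : (0 < d)%N.
Local Notation sbounded := (bounded_measurable (usphere : set 'rV[R]_d)).
Implicit Types f g : 'rV[R]_d -> R.

Lemma near_usphere_cap (u : 'rV[R]_d) (P : set 'rV[R]_d) : usphere u ->
  (\forall v \near within usphere (nbhs u), P v) ->
  exists2 dl, 0 < dl <= 1 & spherical_cap u dl `<=` P.
Proof.
move=> u1 /nbhs_ballP[r /= r0 ballP]; exists (Num.min (r ^+ 2 / 8) 1).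
  by rewrite lt_min ge_min lexx orbT andbT ltr01 divr_gt0// exprn_gt0.
move=> v [v1 uv]; apply: ballP => //.
have {}uv : 1 - r ^+ 2 / 8 <= dotv u v.
  by apply: le_trans uv; rewrite lerD2l lerN2 ge_min lexx.
have uvr : enorm (u - v) <= r / 2.
  rewrite enorm_le ?divr_ge0 ?(ltW r0)// !dotv_bilinear (usphereE u).1// (usphereE v).1//.
  by rewrite (dotvC v u) expr_div_n; lra.
split=> // i j; rewrite ord1 /ball/=; apply: le_lt_trans (_ : r / 2 < _); last lra.
by apply: le_trans uvr; have := coord_le_enorm (u - v) j; rewrite !mxE.
Qed.

Lemma sphere_mean_eq0 f : sbounded f -> {within usphere, continuous f} ->
  (forall u, usphere u -> 0 <= f u) -> sphere_mean f = 0 -> forall u, usphere u -> f u = 0.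
Proof.
move=> bf /subspace_continuousP cf f0 mf0 u u1; apply/eqP; rewrite -[_ == _]negbK.
apply/negP => fu0.
have fu_gt0 : 0 < f u by rewrite lt_neqAle eq_sym fu0 f0.
have near_gt : \forall v \near within usphere (nbhs u), f u / 2 <= f v.
  have /cvgrPdist_le/(_ (f u / 2)) := cf _ u1; rewrite divr_gt0// => /(_ isT).
  by apply: filterS => v; rewrite ler_norml /from_subspace => /andP[_]; lra.
have [dl /andP[dl0 _] capf] := near_usphere_cap u1 near_gt.
have := le_cap_sphere_mean d_gt0 bf f0 capf; rewrite mf0 leNgt mulr_gt0 ?divr_gt0//.
by rewrite fine_gt0// spherical_cap_ltoo// sphere_measure_cap_gt0.
Qed.

Definition sphere_ip f g := sphere_mean (fun u => f u * g u).

Lemma sphere_ipC f g : sphere_ip f g = sphere_ip g f.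
Proof. by apply: eq_sphere_mean => u _; rewrite mulrC. Qed.

Lemma eq_sphere_ipl f f' g : (forall u, usphere u -> f u = f' u) ->
  sphere_ip f g = sphere_ip f' g.
Proof. by move=> ff'; apply: eq_sphere_mean => u /ff' ->. Qed.

Lemma sphere_ip_suml (I : Type) (r : seq I) (c : I -> R) (F : I -> 'rV[R]_d -> R) g :
  (forall i, sbounded (F i)) -> sbounded g ->
  sphere_ip (fun u => \sum_(i <- r) c i * F i u) g = \sum_(i <- r) c i * sphere_ip (F i) g.
Proof.
move=> bF bg; have bFg i := bounded_measurableM (bF i) bg.
transitivity (sphere_mean (fun u => \sum_(i <- r) c i * (F i u * g u))).
  apply: eq_sphere_mean => u _; rewrite mulr_suml.
  by apply: eq_bigr => i _; rewrite mulrA.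
rewrite sphere_mean_sum// => [|i]; last exact: bounded_measurableZ.
by apply: eq_bigr => i _; rewrite sphere_meanZ.
Qed.

Lemma sphere_ip_mulmxl f g (O : 'M[R]_d) : orthogonal_mx O -> sbounded f -> sbounded g ->
  sphere_ip (fun u => f (u *m O)) g = sphere_ip f (fun u => g (u *m O^T)).
Proof.
move=> oO bf bg; have oOT := orthogonal_mx_tr oO.
have := sphere_mean_mulmx oO (bounded_measurableM bf (bounded_measurable_mulmx oOT bg)).
by rewrite /sphere_ip => <-; apply: eq_sphere_mean => u _; rewrite mulmx_orthogonalK.
Qed.

Lemma bounded_measurable_zonal (kappa : R -> R) (u : 'rV[R]_d) :
  {within `[-1, 1], continuous kappa} -> usphere u ->
  sbounded (fun v => kappa (dotv u v)).
Proof.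
move=> ck u1; split.
  have mk := subspace_continuous_measurable_fun (measurable_itv `[-1, 1]) ck.
  apply: (measurable_comp (measurable_itv _) _ mk).
    by move=> _ [v v1 <-]; exact: dotv_itv.
  by apply: measurable_funTS; exact: measurable_dotv.
have [M [_ boundM]] := compact_bounded (continuous_compact ck (@segment_compact R (-1) 1)).
exists (M + 1) => v v1; apply: boundM; first by rewrite ltrDl.
by exists (dotv u v) => //; exact: dotv_itv.
Qed.

Lemma continuous_zonal (kappa : R -> R) (u : 'rV[R]_d) :
  {within `[-1, 1], continuous kappa} -> usphere u ->
  {within usphere, continuous (fun v => kappa (dotv u v))}.
Proof.
move=> /subspace_continuousP ck u1; apply/subspace_continuousP => v v1.
apply: cvg_trans (ck _ (dotv_itv u1 v1)) => A /= hA.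
have near_uv : \forall w \near v, `[-1, 1]%classic (dotv u w) -> A (kappa (dotv u w)).
  exact: (@continuous_dotv R d u v _ hA).
suff : \forall w \near v, usphere w -> A (kappa (dotv u w)) by [].
by apply: filterS near_uv => w wA w1; apply: wA; exact: dotv_itv.
Qed.

End sphere_inner_product.

(** * The Funk-Hecke formula *)

Section funk_hecke.
Variables (R : realType) (d : nat).
Hypothesis d_gt1 : (1 < d)%N.
Variables (N : nat -> nat) (Y : nat -> nat -> 'rV[R]_d -> R).
Hypothesis basis : sph_harm_basis N Y.
Local Notation sbounded := (bounded_measurable (usphere : set 'rV[R]_d)).
Implicit Types (f g : 'rV[R]_d -> R) (u v e : 'rV[R]_d) (kappa : R -> R).

Let d_gt0 : (0 < d)%N. Proof. exact: ltnW. Qed.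

Lemma basis_sph_harm k (j : 'I_(N k)) : sph_harm k (Y k j).
Proof. by case: basis => h _ _; exact: h. Qed.

Lemma bounded_measurable_basis k (j : 'I_(N k)) : sbounded (Y k j).
Proof. exact: bounded_measurable_sph_harm (basis_sph_harm j). Qed.

Lemma sphere_ip_basis k (i : 'I_(N k)) l (j : 'I_(N l)) :
  sphere_ip (Y k i) (Y l j) = ((k == l) && (i == j :> nat))%:R.
Proof.
case: basis => _ /(_ k i l j (ltn_ord i) (ltn_ord j)) + _; rewrite sphere_intE//.
  by case=> ipE; rewrite [LHS]ipE; case: ifP.
by apply: bounded_measurableM; exact: bounded_measurable_basis.
Qed.

Lemma sphere_ip_basis_sum k (c : nat -> R) (j : 'I_(N k)) :
  sphere_ip (fun u => \sum_(i < N k) c i * Y k i u) (Y k j) = c j.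
Proof.
have bY := @bounded_measurable_basis k; rewrite (sphere_ip_suml d_gt0)//.
rewrite (bigD1 j)//= sphere_ip_basis !eqxx mulr1 big1 ?addr0// => i ij.
by rewrite sphere_ip_basis eqxx -val_eqE/= in ij *; rewrite (negbTE ij) mulr0.
Qed.

Lemma sph_harm_expansion k f u : sph_harm k f -> usphere u ->
  f u = \sum_(j < N k) sphere_ip f (Y k j) * Y k j u.
Proof.
case: basis => _ _ span hf u1; have [c fE] := span k f hf.
rewrite fE//; apply: eq_bigr => j _; congr (_ * _).
by rewrite (eq_sphere_ipl _ fE) sphere_ip_basis_sum.
Qed.

Lemma eq_sph_harm_ip k f g : sph_harm k f -> sph_harm k g ->
  (forall h, sph_harm k h -> sphere_ip f h = sphere_ip g h) ->
  forall u, usphere u -> f u = g u.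
Proof.
move=> hf hg fg u u1; rewrite (sph_harm_expansion hf u1) (sph_harm_expansion hg u1).
by apply: eq_bigr => j _; rewrite fg//; exact: basis_sph_harm.
Qed.

Lemma sphere_ip_sph_harm_neq k l f g : sph_harm k f -> sph_harm l g -> k != l ->
  sphere_ip f g = 0.
Proof.
move=> hf hg kl; have bY n := @bounded_measurable_basis n.
rewrite (eq_sphere_ipl _ (fun u => sph_harm_expansion hf (u := u))).
rewrite (sphere_ip_suml d_gt0)//; last exact: bounded_measurable_sph_harm hg.
apply: big1 => i _; rewrite [X in _ * X]sphere_ipC.
rewrite (eq_sphere_ipl _ (fun u => sph_harm_expansion hg (u := u))).
rewrite (sphere_ip_suml d_gt0)// big1 ?mulr0// => j _.
by rewrite sphere_ip_basis eq_sym (negbTE kl) mulr0.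
Qed.

Lemma sphere_ip_sum_sph_harm M (F : nat -> 'rV[R]_d -> R) k h :
  (forall l, sph_harm l (F l)) -> sph_harm k h ->
  sphere_ip (fun u => \sum_(l < M) F l u) h = if (k < M)%N then sphere_ip (F k) h else 0.
Proof.
move=> hF hh.
rewrite (eq_sphere_ipl (f' := fun u => \sum_(l < M) 1 * F l u)); last first.
  by move=> u _; apply: eq_bigr => l _; rewrite mul1r.
rewrite (sphere_ip_suml d_gt0); last 2 first.
- by move=> l; exact: bounded_measurable_sph_harm (hF l).
- exact: bounded_measurable_sph_harm hh.
case: ltnP => [kM|Mk].
  rewrite (bigD1 (Ordinal kM))//= mul1r big1 ?addr0// => l lk.
  by rewrite (sphere_ip_sph_harm_neq (hF l) hh) ?mulr0.
apply: big1 => l _; rewrite (sphere_ip_sph_harm_neq (hF l) hh) ?mulr0//.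
by rewrite neq_ltn (leq_trans (ltn_ord l)).
Qed.

Definition spherical_poly M f := exists F : nat -> 'rV[R]_d -> R,
  (forall k, sph_harm k (F k)) /\ forall u, usphere u -> f u = \sum_(k < M) F k u.

Lemma eq_spherical_poly M f g : (forall u, usphere u -> f u = g u) ->
  spherical_poly M f -> spherical_poly M g.
Proof. by move=> fg [F [hF fF]]; exists F; split=> // u u1; rewrite -fg// fF. Qed.

Lemma spherical_poly_sph_harm M k f : (k < M)%N -> sph_harm k f -> spherical_poly M f.
Proof.
move=> kM hf; exists (fun l => if l == k then f else fun=> 0); split=> [l|u _].
  by case: eqVneq => [->//|_]; exact: sph_harm0.
rewrite (bigD1 (Ordinal kM))//= eqxx big1 ?addr0// => l.
by rewrite -val_eqE/= => /negbTE ->.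
Qed.

Lemma spherical_poly_sum (I : Type) (r : seq I) M (c : I -> R) (f : I -> 'rV[R]_d -> R) :
  (forall i, spherical_poly M (f i)) -> spherical_poly M (fun u => \sum_(i <- r) c i * f i u).
Proof.
move=> /choice[F hF]; exists (fun k u => \sum_(i <- r) c i * F i k u); split=> [k|u u1].
  by apply: sph_harm_sum => i; apply: sph_harmZ; have [] := hF i.
rewrite exchange_big; apply: eq_bigr => i _; have [_ ->//] := hF i.
by rewrite mulr_sumr.
Qed.

Lemma spherical_poly_hpoly M l P : (l < M)%N -> hpoly l P -> spherical_poly M P.
Proof.
move=> lM /(sph_harm_decomposition d_gt0)[H [harmH PE]].
apply: (eq_spherical_poly (f := fun u => \sum_(i < l./2.+1) 1 * H i u)) => [u u1|].
  by rewrite PE//; apply: eq_bigr => i _; rewrite mul1r.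
apply: spherical_poly_sum => i; apply: spherical_poly_sph_harm (harmH i (ltn_ord i)).
by rewrite (leq_ltn_trans _ lM)// leq_subr.
Qed.

Lemma spherical_poly_zonal M e (q : {poly R}) : (size q <= M)%N ->
  spherical_poly M (fun u => q.[dotv e u]).
Proof.
move=> qM; apply: (eq_spherical_poly (f := fun u => \sum_(i < size q) q`_i * dotv e u ^+ i)).
  by move=> u _; rewrite horner_coef.
apply: spherical_poly_sum => i; apply: spherical_poly_hpoly (hpoly_dotv_exp e i).
exact: leq_trans (ltn_ord i) qM.
Qed.

Lemma sph_harm_zonal_poly_eq0 k f e (q : {poly R}) : sph_harm k f -> (size q <= k)%N ->
  (forall u, usphere u -> f u = q.[dotv e u]) -> forall u, usphere u -> f u = 0.
Proof.
move=> hf qk fq; have bf := bounded_measurable_sph_harm hf.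
have cf := continuous_sph_harm hf.
have [F [hF qF]] := spherical_poly_zonal e qk.
have f2 : sphere_ip f f = 0.
  by rewrite (eq_sphere_ipl _ fq) (eq_sphere_ipl _ qF) (sphere_ip_sum_sph_harm _ hF hf) ltnn.
have ff0 := sphere_mean_eq0 d_gt0 (bounded_measurableM bf bf) _ _ f2.
move=> u u1; apply/eqP; rewrite -[_ == 0]orbb -mulf_eq0 ff0// => v; last first.
  by rewrite -expr2 sqr_ge0.
by apply: continuousM; exact: cf.
Qed.

(* Both are polynomials of degree [k] in [dotv e]; a combination without leading term
   is orthogonal to itself. *)
Lemma zonal_proportional k f g e : usphere e -> sph_harm k f -> sph_harm k g ->
  zonal e f -> zonal e g -> g e != 0 ->
  exists a, forall u, usphere u -> f u = a * g u.
Proof.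
move=> e1 hf hg zf zg ge0.
have [A sizeA fA] := zonal_poly d_gt1 e1 hf zf.
have [B sizeB gB] := zonal_poly d_gt1 e1 hg zg.
have size_low (C : {poly R}) : (size C <= k.+1)%N -> C`_k = 0 -> (size C <= k)%N.
  move=> sizeC Ck; apply/leq_sizeP => j; rewrite leq_eqVlt => /orP[/eqP <-//|kj].
  by apply/leq_sizeP: kj.
have Bk : B`_k != 0.
  apply: contra_neq ge0 => Bk.
  exact: (sph_harm_zonal_poly_eq0 hg (size_low _ sizeB Bk) gB e1).
exists (A`_k / B`_k) => u u1; apply/eqP; rewrite -subr_eq0; apply/eqP.
pose q := A - (A`_k / B`_k) *: B.
apply: (@sph_harm_zonal_poly_eq0 k (fun u => f u - A`_k / B`_k * g u) e q) => //.
- apply: eq_sph_harm (sph_harmD hf (sph_harmZ (- (A`_k / B`_k)) hg)) => v _.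
  by rewrite mulNr.
- apply: size_low; last by rewrite coefB coefZ divfK// subrr.
  rewrite (leq_trans (size_polyD _ _))// geq_max sizeA size_polyN.
  by rewrite (leq_trans (size_scale_leq _ _)).
- by move=> v v1; rewrite fA// gB// hornerD hornerN hornerZ.
Qed.

Definition zonal_harmonic k u v := \sum_(j < N k) Y k j u * Y k j v.

Lemma zonal_harmonicC k u v : zonal_harmonic k u v = zonal_harmonic k v u.
Proof. by apply: eq_bigr => j _; rewrite mulrC. Qed.

Lemma sph_harm_zonal_harmonic k u : sph_harm k (zonal_harmonic k u).
Proof. by apply: sph_harm_sum => j; apply: sph_harmZ; exact: basis_sph_harm. Qed.

Lemma zonal_harmonic_reproducing k f u : sph_harm k f -> usphere u ->
  sphere_ip (zonal_harmonic k u) f = f u.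
Proof.
move=> hf u1; rewrite (sph_harm_expansion hf u1) (sphere_ip_suml d_gt0); last 2 first.
- exact: bounded_measurable_basis.
- exact: bounded_measurable_sph_harm hf.
by apply: eq_bigr => j _; rewrite sphere_ipC mulrC.
Qed.

Lemma zonal_harmonic_mulmx k (O : 'M[R]_d) u v : orthogonal_mx O -> usphere u -> usphere v ->
  zonal_harmonic k (u *m O) (v *m O) = zonal_harmonic k u v.
Proof.
move=> oO u1 v1; have hZ w := sph_harm_zonal_harmonic k w.
have hZO := sph_harm_mulmx oO (hZ (u *m O)).
apply: (eq_sph_harm_ip hZO (hZ u) _ v1) => h hh.
rewrite sphere_ip_mulmxl//; [|exact: bounded_measurable_sph_harm (hZ _)
  |exact: bounded_measurable_sph_harm hh].
rewrite zonal_harmonic_reproducing//; last exact/usphere_mulmx.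
  by rewrite mulmx_orthogonalK// zonal_harmonic_reproducing.
by apply: sph_harm_mulmx hh; exact: orthogonal_mx_tr.
Qed.

Lemma zonal_harmonic_diag k u : usphere u -> zonal_harmonic k u u = (N k)%:R.
Proof.
move=> u1; have diagE v : usphere v -> zonal_harmonic k u u = zonal_harmonic k v v.
  move=> v1; have uv : enorm u = enorm v by rewrite u1 v1.
  have uv0 : dotv 0 u = dotv 0 v by rewrite !dot0v.
  by have [Q [oQ <- _]] := orthogonal_mx_transitive uv uv0; rewrite zonal_harmonic_mulmx.
rewrite -(sphere_mean_cst d_gt0 (zonal_harmonic k u u)) (eq_sphere_mean diagE).
rewrite (sphere_mean_sum d_gt0) => [|j]; last first.
  by apply: bounded_measurableM; exact: bounded_measurable_basis.
transitivity (\sum_(j < N k) (1 : R)); last by rewrite sumr_const card_ord.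
by apply: eq_bigr => j _; rewrite -[LHS]/(sphere_ip _ _) sphere_ip_basis !eqxx.
Qed.

Lemma normr_zonal_harmonic_le k u v : usphere u -> usphere v ->
  `|zonal_harmonic k u v| <= (N k)%:R.
Proof.
move=> u1 v1; have sum_sqr w : usphere w -> \sum_(j < N k) Y k j w ^+ 2 = (N k)%:R.
  by move=> w1; rewrite -(zonal_harmonic_diag k w1); apply: eq_bigr => j _; rewrite expr2.
have -> : (N k)%:R = \sum_(j < N k) (Y k j u ^+ 2 + Y k j v ^+ 2) / 2 :> R.
  by rewrite -mulr_suml big_split/= !sum_sqr//; lra.
apply: (le_trans (ler_norm_sum _ _ _)); apply: ler_sum => j _.
rewrite ler_norml; have := sqr_ge0 (Y k j u - Y k j v).
by have := sqr_ge0 (Y k j u + Y k j v); rewrite sqrrD sqrrB; lra.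
Qed.

Lemma zonal_zonal_harmonic k e : usphere e -> zonal e (zonal_harmonic k e).
Proof.
by move=> e1; apply: invariant_zonal => O oO eO u u1; rewrite -{1}eO zonal_harmonic_mulmx.
Qed.

Definition zonal_operator kappa f u := sphere_ip (fun v => kappa (dotv u v)) f.

Section zonal_operator.
Variable kappa : R -> R.
Hypothesis ck : {within `[-1, 1], continuous kappa}.
Local Notation T := (zonal_operator kappa).

Lemma zonal_operator_mulmx f u (O : 'M[R]_d) : orthogonal_mx O -> usphere u -> sbounded f ->
  T f (u *m O) = T (fun v => f (v *m O)) u.
Proof.
move=> oO u1 bf; have oOT := orthogonal_mx_tr oO.
have := sphere_ip_mulmxl oOT (bounded_measurable_zonal ck u1) bf.
rewrite trmxK /zonal_operator => <-; apply: eq_sphere_ipl => v _.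
by rewrite -[in LHS](mulmx_orthogonalVK v oO) dotv_mulmx.
Qed.

Lemma zonal_operator_sph_harm k f u : sph_harm k f -> usphere u ->
  T f u = \sum_(j < N k) sphere_ip f (Y k j) * T (Y k j) u.
Proof.
move=> hf u1; rewrite /zonal_operator sphere_ipC.
rewrite (eq_sphere_ipl _ (fun v => sph_harm_expansion hf (u := v))).
rewrite (sphere_ip_suml d_gt0); last 2 first.
- exact: bounded_measurable_basis.
- exact: bounded_measurable_zonal.
by apply: eq_bigr => j _; rewrite [X in _ = _ * X]sphere_ipC.
Qed.

(* The orthogonal projection of [fun v => kappa (dotv u v)] on the harmonics of degree [k]. *)
Definition zonal_projection k u v := \sum_(j < N k) T (Y k j) u * Y k j v.

Lemma sph_harm_zonal_projection k u : sph_harm k (zonal_projection k u).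
Proof. by apply: sph_harm_sum => j; apply: sph_harmZ; exact: basis_sph_harm. Qed.

Lemma sphere_ip_zonal_projection k f u : sph_harm k f -> usphere u ->
  sphere_ip (zonal_projection k u) f = T f u.
Proof.
move=> hf u1; rewrite (zonal_operator_sph_harm hf u1) (sphere_ip_suml d_gt0); last 2 first.
- exact: bounded_measurable_basis.
- exact: bounded_measurable_sph_harm hf.
by apply: eq_bigr => j _; rewrite sphere_ipC mulrC.
Qed.

Lemma zonal_zonal_projection k e : usphere e -> zonal e (zonal_projection k e).
Proof.
move=> e1; apply: invariant_zonal => O oO eO.
have hP := sph_harm_zonal_projection k e; have hPO := sph_harm_mulmx oO hP.
apply: (eq_sph_harm_ip hPO hP) => h hh; have oOT := orthogonal_mx_tr oO.
have bh := bounded_measurable_sph_harm hh.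
rewrite sphere_ip_mulmxl//; last exact: bounded_measurable_sph_harm hP.
rewrite !sphere_ip_zonal_projection//; last exact: sph_harm_mulmx hh.
by rewrite -zonal_operator_mulmx// -{1}eO mulmx_orthogonalK.
Qed.

Lemma funk_hecke_pole k e : usphere e ->
  exists lam, forall f, sph_harm k f -> T f e = lam * f e.
Proof.
move=> e1; have [Nk0|Nk0] := eqVneq (N k) 0%N.
  exists 0 => f hf; rewrite mul0r (zonal_operator_sph_harm hf e1).
  by apply: big1 => -[j]; rewrite Nk0.
have Ze0 : zonal_harmonic k e e != 0 by rewrite zonal_harmonic_diag// pnatr_eq0.
have [lam PE] := zonal_proportional e1 (sph_harm_zonal_projection k e)
  (sph_harm_zonal_harmonic k e) (zonal_zonal_projection k e1) (zonal_zonal_harmonic k e1) Ze0.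
exists lam => f hf; rewrite -(sphere_ip_zonal_projection hf e1) (eq_sphere_ipl _ PE).
rewrite -(zonal_harmonic_reproducing hf e1) -sphere_meanZ//.
  by apply: eq_sphere_mean => u _; rewrite mulrA.
by apply: bounded_measurableM;
  [exact: bounded_measurable_sph_harm (sph_harm_zonal_harmonic k e)
  |exact: bounded_measurable_sph_harm hf].
Qed.

Theorem funk_hecke k :
  exists lam, forall f u, sph_harm k f -> usphere u -> T f u = lam * f u.
Proof.
pose e : 'rV[R]_d := delta_mx 0 (Ordinal d_gt0); have e1 : usphere e by exact: usphere_delta.
have [lam TE] := funk_hecke_pole k e1; exists lam => f u hf u1.
have eu : enorm e = enorm u by rewrite e1 u1.
have eu0 : dotv 0 e = dotv 0 u by rewrite !dot0v.
have [Q [oQ <- _]] := orthogonal_mx_transitive eu eu0.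
rewrite zonal_operator_mulmx//; last exact: bounded_measurable_sph_harm hf.
by rewrite TE//; exact: sph_harm_mulmx.
Qed.

End zonal_operator.

Definition funk_hecke_coef kappa k : R := xget 0 [set lam |
  forall f u, sph_harm k f -> usphere u -> zonal_operator kappa f u = lam * f u].

Lemma zonal_operatorE kappa k f u : {within `[-1, 1], continuous kappa} ->
  sph_harm k f -> usphere u -> zonal_operator kappa f u = funk_hecke_coef kappa k * f u.
Proof.
move=> ck hf u1; rewrite /funk_hecke_coef; case: xgetP => [lam _ -> //|noeigen].
by have [lam /noeigen[]] := funk_hecke ck k.
Qed.

End funk_hecke.

(** * Positive definite zonal kernels *)

Lemma ge0_of_natmul_ge0 (R : realType) (a b : R) : (forall n, 0 <= n%:R * a + b) -> 0 <= a.
Proof.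
move=> ge0; rewrite leNgt; apply/negP => a0; have a0' : 0 < - a by rewrite oppr_gt0.
have := archi_boundP (divr_ge0 (normr_ge0 b) (ltW a0')).
rewrite ltr_pdivrMr//; have := ge0 (Num.bound (`|b| / - a)); have := ler_norm b.
by lra.
Qed.

Section positive_definite.
Variables (R : realType) (d : nat).
Hypothesis d_gt1 : (1 < d)%N.
Variables (N : nat -> nat) (Y : nat -> nat -> 'rV[R]_d -> R).
Hypothesis basis : sph_harm_basis N Y.
Variable kappa : R -> R.
Hypotheses (ck : {within `[-1, 1], continuous kappa}) (pk : sph_pd d kappa).
Local Notation weighted_point := (R * {u : 'rV[R]_d | usphere u})%type.
Local Notation sbounded := (bounded_measurable (usphere : set 'rV[R]_d)).

Let d_gt0 : (0 < d)%N. Proof. exact: ltnW. Qed.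

Definition energy (s : seq weighted_point) : R :=
  \sum_(a <- s) \sum_(b <- s) a.1 * b.1 * kappa (dotv (sval a.2) (sval b.2)).

Lemma energy_ge0 s : 0 <= energy s.
Proof.
have := pk (u := fun i : 'I_(size s) => sval (tnth (in_tuple s) i).2)
  (fun i => (tnth (in_tuple s) i).1) (fun i => svalP (tnth (in_tuple s) i).2).
rewrite /energy [X in _ -> 0 <= X]big_tnth.
by under [X in _ -> 0 <= X]eq_bigr do rewrite big_tnth.
Qed.

Lemma energy_cons c w s : energy ((c, w) :: s) =
  energy s + 2 * \sum_(a <- s) a.1 * (kappa (dotv (sval a.2) (sval w)) * c) + c ^+ 2 * kappa 1.
Proof.
rewrite /energy !big_cons/= ((usphereE _).1 (svalP w)).
under [X in _ + X = _]eq_bigr do rewrite big_cons.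
rewrite big_split/=; set E := \sum_(a <- s) \sum_(b <- s) _.
have -> : \sum_(b <- s) c * b.1 * kappa (dotv (sval w) (sval b.2)) =
    \sum_(a <- s) a.1 * (kappa (dotv (sval a.2) (sval w)) * c).
  by apply: eq_bigr => a _; rewrite (dotvC (sval w)); ring.
have -> : \sum_(a <- s) a.1 * c * kappa (dotv (sval a.2) (sval w)) =
    \sum_(a <- s) a.1 * (kappa (dotv (sval a.2) (sval w)) * c).
  by apply: eq_bigr => a _; ring.
by ring.
Qed.

Section eigenfunction.
Variables (y : 'rV[R]_d -> R) (lam : R).
Hypotheses (sy : sbounded y) (y_norm : sphere_ip y y = 1)
  (y_eigen : forall u, usphere u -> zonal_operator kappa y u = lam * y u).

(* The expected energy of [s] together with [n] independent uniform random points [w] of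
   weight [y w]. *)
Let expected_energy n s := energy s + 2 * n%:R * (\sum_(a <- s) a.1 * (lam * y (sval a.2))) +
  n%:R * (n%:R - 1) * lam + n%:R * kappa 1.

Let interaction (s : seq weighted_point) w := \sum_(a <- s) a.1 * (kappa (dotv (sval a.2) w) * y w).

Let bounded_interaction s : sbounded (interaction s).
Proof.
apply: bounded_measurable_sum => a; apply: bounded_measurableZ; apply: bounded_measurableM => //.
exact: bounded_measurable_zonal (svalP a.2).
Qed.

Let mean_interaction s :
  sphere_mean (interaction s) = \sum_(a <- s) a.1 * (lam * y (sval a.2)).
Proof.
have bk (a : weighted_point) : sbounded (fun w => kappa (dotv (sval a.2) w) * y w).
  by apply: bounded_measurableM => //; exact: bounded_measurable_zonal (svalP a.2).
rewrite (sphere_mean_sum d_gt0) => [|a]; last exact: bounded_measurableZ.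
apply: eq_bigr => a _; rewrite (sphere_meanZ d_gt0)// -y_eigen//.
exact: svalP.
Qed.

Let expected_energy_ge0 n : forall s, 0 <= expected_energy n s.
Proof.
elim: n => [|n IH] s; first by rewrite /expected_energy mulr0 !mul0r !addr0 energy_ge0.
have -> : expected_energy n.+1 s = expected_energy n s +
    (2 * (\sum_(a <- s) a.1 * (lam * y (sval a.2))) + (kappa 1 + 2 * n%:R * lam)).
  by rewrite /expected_energy -(natr1 n); ring.
pose h w := expected_energy n s + (2 * interaction s w + (kappa 1 + 2 * n%:R * lam) * (y w * y w)).
have byy := bounded_measurableM sy sy.
have b2 : sbounded (fun w => 2 * interaction s w) by exact: bounded_measurableZ.
have byy2 : sbounded (fun w => (kappa 1 + 2 * n%:R * lam) * (y w * y w)).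
  exact: bounded_measurableZ.
have : 0 <= sphere_mean h.
  apply: sphere_mean_ge0 => w w1.
  have := IH ((y w, exist _ w w1) :: s); congr (0 <= _).
  by rewrite /h /expected_energy energy_cons big_cons/= -/(interaction s w); ring.
congr (0 <= _); rewrite /h (sphere_meanD d_gt0 (bounded_measurable_cst _ _))//; last first.
  exact: bounded_measurableD.
rewrite (sphere_mean_cst d_gt0) (sphere_meanD d_gt0)// !(sphere_meanZ d_gt0)//.
have -> : sphere_mean (fun w => y w * y w) = 1 by exact: y_norm.
by rewrite mulr1 mean_interaction.
Qed.

Lemma pd_eigenvalue_ge0 : 0 <= lam.
Proof.
apply: (@ge0_of_natmul_ge0 _ _ (kappa 1)) => n.
have := expected_energy_ge0 n.+1 [::]; rewrite /expected_energy /energy !big_nil.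
rewrite mulr0 !add0r -mulrA -mulrDr pmulr_rge0 ?ltr0n//.
by rewrite -(natr1 n) addrK.
Qed.

End eigenfunction.

Lemma funk_hecke_coef_ge0 k : (0 < N k)%N -> 0 <= funk_hecke_coef d kappa k.
Proof.
move=> Nk0; have hY := basis_sph_harm basis (Ordinal Nk0).
apply: (pd_eigenvalue_ge0 (bounded_measurable_sph_harm hY)).
- by rewrite (sphere_ip_basis d_gt1 basis (Ordinal Nk0) (Ordinal Nk0)) !eqxx.
- by move=> u; exact: (zonal_operatorE d_gt1 basis ck hY).
Qed.

End positive_definite.

(** * Pointwise Mercer expansion of zonal kernels *)

Section zonal_bump.
Variables (R : realType) (d : nat).
Hypothesis d_gt1 : (1 < d)%N.
Variables (N : nat -> nat) (Y : nat -> nat -> 'rV[R]_d -> R).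
Hypothesis basis : sph_harm_basis N Y.
Local Notation sbounded := (bounded_measurable (usphere : set 'rV[R]_d)).
Local Notation sigma := (@sphere_measure R d).
Local Notation zonal_harmonic := (zonal_harmonic N Y).
Implicit Types (f : 'rV[R]_d -> R) (u v : 'rV[R]_d) (kappa : R -> R).

Let d_gt0 : (0 < d)%N. Proof. exact: ltnW. Qed.

Section nonnegative_kernel.
Variable kappa : R -> R.
Hypotheses (ck : {within `[-1, 1], continuous kappa})
  (kappa0 : forall u v, usphere u -> usphere v -> 0 <= kappa (dotv u v)).
Local Notation T := (zonal_operator kappa).
Local Notation coef := (funk_hecke_coef d kappa).

Lemma zonal_operator_cst c u : usphere u -> T (cst c) u = c * coef 0.
Proof. by move=> u1; rewrite (zonal_operatorE d_gt1 basis ck (sph_harm_cst d c) u1) mulrC. Qed.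

Lemma normr_zonal_operator_le f u (C : R) : sbounded f -> usphere u ->
  (forall v, usphere v -> `|f v| <= C) -> `|T f u| <= C * coef 0.
Proof.
move=> bf u1 fC; have bk := bounded_measurable_zonal ck u1.
have bkf := bounded_measurableM bk bf.
rewrite -(zonal_operator_cst C u1); apply: (le_trans (le_normr_sphere_mean d_gt0 bkf)).
apply: (le_sphere_mean d_gt0); [exact: bounded_measurable_norm| |].
  by apply: bounded_measurableM => //; exact: bounded_measurable_cst.
by move=> v v1; rewrite normrM (ger0_norm (kappa0 u1 v1)) ler_wpM2l ?kappa0 ?fC.
Qed.

Lemma normr_funk_hecke_coef_le k : (0 < N k)%N -> `|coef k| <= coef 0.
Proof.
move=> Nk0; pose e : 'rV[R]_d := delta_mx 0 (Ordinal d_gt0).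
have e1 : usphere e by exact: usphere_delta.
have hZ := sph_harm_zonal_harmonic basis k e.
have := normr_zonal_operator_le (bounded_measurable_sph_harm hZ) e1
  (fun v => normr_zonal_harmonic_le d_gt1 basis k (v := v) e1).
rewrite (zonal_operatorE d_gt1 basis ck hZ e1) (zonal_harmonic_diag d_gt1 basis)//.
by rewrite normrM normr_nat mulrC ler_pM2l// ltr0n.
Qed.

End nonnegative_kernel.

Definition zonal_bump m (t : R) : R := ((1 + t) / 2) ^+ m.

Definition bump_mass m : R := funk_hecke_coef d (zonal_bump m) 0.

Definition bump_multiplier m k : R := funk_hecke_coef d (zonal_bump m) k / bump_mass m.

Lemma continuous_zonal_bump m : {within `[-1, 1], continuous (zonal_bump m)}.
Proof.
apply: continuous_subspaceT => t.
apply: (@continuous_comp _ _ _ (fun t : R => (1 + t) / 2) (fun t => t ^+ m)).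
  apply: cvgM; last exact: cvg_cst.
  by apply: cvgD; [exact: cvg_cst|exact: cvg_id].
exact: exprn_continuous.
Qed.

(* [(1 + t) / 2 * kappa t] is half the sum of [kappa] and of the kernels
   [u 0 l * v 0 l * kappa (dotv u v)]. *)
Lemma sph_pd_mul_half1D kappa : sph_pd d kappa -> sph_pd d (fun t => (1 + t) / 2 * kappa t).
Proof.
move=> pk n u c u1.
have -> : \sum_i \sum_j c i * c j * ((1 + dotv (u i) (u j)) / 2 * kappa (dotv (u i) (u j))) =
    2^-1 * (\sum_i \sum_j c i * c j * kappa (dotv (u i) (u j)) +
    \sum_l \sum_i \sum_j (c i * u i 0 l) * (c j * u j 0 l) * kappa (dotv (u i) (u j))).
  rewrite [X in _ + X]exchange_big -big_split mulr_sumr; apply: eq_bigr => i _ /=.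
  rewrite exchange_big -big_split mulr_sumr; apply: eq_bigr => j _ /=.
  have -> : \sum_l (c i * u i 0 l) * (c j * u j 0 l) * kappa (dotv (u i) (u j)) =
     c i * c j * kappa (dotv (u i) (u j)) * dotv (u i) (u j).
    by rewrite [X in _ = _ * X]/dotv mulr_sumr; apply: eq_bigr => l _; ring.
  by field.
rewrite mulr_ge0 ?invr_ge0// addr_ge0 ?pk//.
by apply: sumr_ge0 => l _; exact: (pk n u (fun i => c i * u i 0 l)).
Qed.

Lemma sph_pd_zonal_bump m : sph_pd d (zonal_bump m).
Proof.
elim: m => [|m IH]; last first.
  by rewrite (_ : zonal_bump _ = fun t => (1 + t) / 2 * zonal_bump m t);
    [exact: sph_pd_mul_half1D|apply/funext => t; rewrite /zonal_bump exprS].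
move=> n u c _; rewrite [leRHS](_ : _ = (\sum_i c i) ^+ 2) ?sqr_ge0// expr2 mulr_suml.
apply: eq_bigr => i _; rewrite mulr_sumr.
by apply: eq_bigr => j _; rewrite /zonal_bump expr0 mulr1.
Qed.

Let half1D_dotv_ge0 u v : usphere u -> usphere v -> 0 <= (1 + dotv u v) / 2.
Proof. by move=> u1 v1; have := dotv_itv u1 v1; rewrite /= in_itv/= => /andP[]; lra. Qed.

Lemma zonal_bump_ge0 m u v : usphere u -> usphere v -> 0 <= zonal_bump m (dotv u v).
Proof. by move=> u1 v1; rewrite exprn_ge0// half1D_dotv_ge0. Qed.

Lemma le_cap_bump_mass m u (dl : R) : usphere u -> dl <= 2 ->
  (1 - dl / 2) ^+ m * fine (sigma (spherical_cap u dl)) <= bump_mass m.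
Proof.
move=> u1 dl2; have cb := @continuous_zonal_bump m.
rewrite -[bump_mass m]mul1r -(zonal_operator_cst cb 1 u1).
apply: (le_cap_sphere_mean d_gt0).
- by apply: bounded_measurableM; [exact: bounded_measurable_zonal|exact: bounded_measurable_cst].
- by move=> v v1; rewrite mulr1 zonal_bump_ge0.
- move=> v [v1 uv]; rewrite mulr1 lerXn2r ?nnegrE ?half1D_dotv_ge0//; lra.
Qed.

Lemma bump_mass_gt0 m : 0 < bump_mass m.
Proof.
have u1 : usphere (delta_mx 0 (Ordinal d_gt0) : 'rV[R]_d) by exact: usphere_delta.
apply: lt_le_trans (le_cap_bump_mass m u1 (ler1n _ 2)).
by rewrite mulr_gt0 ?exprn_gt0 ?fine_gt0 ?spherical_cap_ltoo ?sphere_measure_cap_gt0//; lra.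
Qed.

Lemma bump_concentration m f u (dl C e : R) : sbounded f -> usphere u -> dl <= 2 -> 0 <= e ->
  (forall v, usphere v -> `|f v| <= C) ->
  (forall v, spherical_cap u dl v -> `|f v - f u| <= e) ->
  `|zonal_operator (zonal_bump m) f u - bump_mass m * f u| <=
    e * bump_mass m + 2 * C * (1 - dl / 2) ^+ m.
Proof.
move=> bf u1 dl2 e0 fC fe; set b := fun v => zonal_bump m (dotv u v).
have bb : sbounded b := bounded_measurable_zonal (@continuous_zonal_bump m) u1.
have b0 v : usphere v -> 0 <= b v by exact: zonal_bump_ge0.
have mass_b c : c * bump_mass m = sphere_mean (fun v => b v * c).
  by rewrite -(zonal_operator_cst (@continuous_zonal_bump m) c u1).
have bc (c : R) : sbounded (cst c) by exact: bounded_measurable_cst.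
have bbc c : sbounded (fun v => b v * c) := bounded_measurableM bb (bc c).
have bfu : sbounded (fun v => f v - f u) := bounded_measurableB bf (bc (f u)).
have -> : zonal_operator (zonal_bump m) f u - bump_mass m * f u =
    sphere_mean (fun v => b v * (f v - f u)).
  rewrite mulrC mass_b.
  rewrite -(sphere_meanB d_gt0 (bounded_measurableM bb bf) (bbc _)).
  by apply: eq_sphere_mean => v _; rewrite mulrBr.
apply: (le_trans (le_normr_sphere_mean d_gt0 (bounded_measurableM bb bfu))).
rewrite mass_b -[X in _ <= _ + X](sphere_mean_cst d_gt0) -(sphere_meanD d_gt0 (bbc _) (bc _)).
apply: (le_sphere_mean d_gt0) => [| |v v1].
- exact/bounded_measurable_norm/bounded_measurableM.
- exact: bounded_measurableD.
have C0 : 0 <= C := le_trans (normr_ge0 _) (fC u u1).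
rewrite normrM (ger0_norm (b0 v v1)); have [uv|uv] := leP (1 - dl) (dotv u v).
  rewrite ler_wpDr//; last by rewrite ler_wpM2l ?b0 ?fe.
  by rewrite !mulr_ge0// exprn_ge0//; lra.
rewrite ler_wpDl ?mulr_ge0 ?b0//= mulrC; apply: ler_pM => //; first exact: b0.
  by rewrite (le_trans (ler_normB _ _))// mulr_natl lerD ?fC.
by rewrite lerXn2r ?nnegrE ?half1D_dotv_ge0//; lra.
Qed.

Lemma bump_approximate_identity f u : sbounded f -> {within usphere, continuous f} ->
  usphere u ->
  (fun m => zonal_operator (zonal_bump m) f u / bump_mass m) @ \oo --> f u.
Proof.
move=> bf /subspace_continuousP cf u1; apply/cvgrPdist_le => e e0.
have e2 : 0 < e / 2 by rewrite divr_gt0.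
have near_f : \forall v \near within usphere (nbhs u), `|f v - f u| <= e / 2.
  by have /cvgrPdist_le/(_ _ e2) := cf _ u1; apply: filterS => v; rewrite distrC.
have [dl /andP[dl0 dl1] fe] := near_usphere_cap u1 near_f.
have [_ [C fC]] := bf; have C0 : 0 <= C := le_trans (normr_ge0 _) (fC u u1).
pose s := fine (sigma (spherical_cap u (dl / 2))).
have s0 : 0 < s by rewrite fine_gt0// spherical_cap_ltoo// sphere_measure_cap_gt0// divr_gt0.
(* The mass decays at rate at least [b], the contribution of the far points at rate [a]. *)
pose a := 1 - dl / 2; pose b := 1 - dl / 2 / 2.
have [a0 b0 ab] : [/\ 0 <= a, 0 < b & a < b] by rewrite /a /b; split; lra.
have ratio : (fun m => 2 * C / s * (a / b) ^+ m) @ \oo --> (0 : R).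
  rewrite -(mulr0 (2 * C / s)); apply: cvgM; first exact: cvg_cst.
  by apply: cvg_expr; rewrite ger0_norm ?divr_ge0 ?(ltW b0)// ltr_pdivrMr ?mul1r.
move/cvgrPdist_le : ratio => /(_ _ e2); apply: filterS => m.
have r0 : 0 <= 2 * C / s * (a / b) ^+ m.
  by rewrite mulr_ge0 ?exprn_ge0 ?divr_ge0 ?mulr_ge0// ltW.
rewrite sub0r normrN (ger0_norm r0) => small.
have mass0 := bump_mass_gt0 m; have mass_ge : b ^+ m * s <= bump_mass m.
  by apply: le_cap_bump_mass => //; lra.
rewrite distrC -[X in _ - X](mulKf (lt0r_neq0 mass0)) [X in _ - X]mulrC -mulrBl normrM normfV.
rewrite (gtr0_norm mass0) ler_pdivrMr//.
apply: (le_trans (bump_concentration m bf u1 _ (ltW e2) fC fe)); first lra.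
rewrite -/a [leRHS](_ : _ = e / 2 * bump_mass m + e / 2 * bump_mass m); last by field.
rewrite lerD2l (_ : 2 * C * a ^+ m = 2 * C / s * (a / b) ^+ m * (b ^+ m * s)).
  by rewrite ler_pM// mulr_ge0 ?exprn_ge0 ?ltW.
by rewrite expr_div_n; field; rewrite expf_neq0 gt_eqF//= gt_eqF.
Qed.

Lemma bump_multiplier_itv m k : (0 < N k)%N -> 0 <= bump_multiplier m k <= 1.
Proof.
move=> Nk0; have cb := @continuous_zonal_bump m; have mass0 := bump_mass_gt0 m.
rewrite /bump_multiplier ler_pdivrMr// mul1r divr_ge0 ?(ltW mass0)//=; last first.
  exact: (funk_hecke_coef_ge0 d_gt1 basis cb (@sph_pd_zonal_bump m) Nk0).
apply: (le_trans (ler_norm _)).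
by apply: normr_funk_hecke_coef_le => // u v; exact: zonal_bump_ge0.
Qed.

Lemma bump_multiplier_cvg k u v : usphere u -> usphere v ->
  (fun m => bump_multiplier m k * zonal_harmonic k u v) @ \oo --> zonal_harmonic k u v.
Proof.
move=> u1 v1; have hZ := sph_harm_zonal_harmonic basis k u.
have := bump_approximate_identity (bounded_measurable_sph_harm hZ) (continuous_sph_harm hZ) v1.
apply: cvg_trans; apply: near_eq_cvg; near=> m.
by rewrite (zonal_operatorE d_gt1 basis (@continuous_zonal_bump m) hZ v1) mulrAC.
Unshelve. all: by end_near. Qed.

End zonal_bump.

Section tannery.
Variables (R : realType) (a : nat -> nat -> R) (b M : nat -> R).
Hypotheses (ab : forall k, a ^~ k @ \oo --> b k) (aM : forall m k, `|a m k| <= M k)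
  (cM : cvgn (series M)).

Let M_ge0 k : 0 <= M k. Proof. exact: le_trans (normr_ge0 _) (aM 0 k). Qed.

Let tail_le m n : (n <= m)%N ->
  `|\sum_(0 <= k < m) a m k - \sum_(0 <= k < n) a m k| <= limn (series M) - series M n.
Proof.
move=> nm; rewrite (big_cat_nat (n := n))//= addrAC subrr add0r.
apply: (le_trans (ler_norm_sum _ _ _)).
apply: (@le_trans _ _ (series M m - series M n)).
  rewrite /series/= [X in _ <= X - _](big_cat_nat (n := n))//= addrAC subrr add0r.
  by apply: ler_sum.
rewrite lerD2r nondecreasing_cvgn_le// => i j ij.
by rewrite /series/= [leRHS](big_cat_nat (n := i))//= lerDl sumr_ge0.
Qed.

(* Tannery's theorem, a dominated convergence theorem for series. *)
Lemma cvg_series_dominated (l : R) : (fun m => \sum_(0 <= k < m) a m k) @ \oo --> l ->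
  series b @ \oo --> l.
Proof.
move=> al; apply/cvgrPdist_le => e e0; have e3 : 0 < e / 3 by rewrite divr_gt0.
have ab_sum n : (fun m => \sum_(0 <= k < n) a m k) @ \oo --> series b n.
  by apply: (cvg_sum (F := eventually)) => k; exact: ab.
near=> n; near \oo => m.
have nm : (n <= m)%N by near: m; exact: nbhs_infty_ge.
have am : `|l - \sum_(0 <= k < m) a m k| <= e / 3.
  by near: m; move/cvgrPdist_le : al; exact.
have abm : `|series b n - \sum_(0 <= k < n) a m k| <= e / 3.
  by near: m; move/cvgrPdist_le : (ab_sum n); exact.
have tail : limn (series M) - series M n <= e / 3.
  by apply: (le_trans (ler_norm _)); near: n; move/cvgrPdist_le : cM; exact.
have := le_trans (tail_le nm) tail.
move: am abm; rewrite !ler_norml => /andP[? ?] /andP[? ?] /andP[? ?].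
by apply/andP; split; lra.
Unshelve. all: by end_near. Qed.

End tannery.

Section mercer.
Variables (R : realType) (d : nat).
Hypothesis d_gt1 : (1 < d)%N.
Variables (N : nat -> nat) (Y : nat -> nat -> 'rV[R]_d -> R).
Hypothesis basis : sph_harm_basis N Y.
Local Notation sbounded := (bounded_measurable (usphere : set 'rV[R]_d)).
Local Notation zonal_harmonic := (zonal_harmonic N Y).
Local Notation coef := (funk_hecke_coef d).
Local Notation mass := (bump_mass R d).
Local Notation multiplier := (bump_multiplier R d).
Implicit Types (u v : 'rV[R]_d) (kappa : R -> R).

Let d_gt0 : (0 < d)%N. Proof. exact: ltnW. Qed.

Let bounded_zonal_harmonic k u : sbounded (zonal_harmonic k u).
Proof. exact: bounded_measurable_sph_harm (sph_harm_zonal_harmonic basis k u). Qed.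

Lemma zonal_poly_expansion M (q : {poly R}) u v : (size q <= M)%N ->
  {within `[-1, 1], continuous (horner q)} -> usphere u -> usphere v ->
  q.[dotv u v] = \sum_(k < M) coef (horner q) k * zonal_harmonic k u v.
Proof.
move=> qM cq u1 v1; have [F [hF qF]] := spherical_poly_zonal d_gt1 u qM.
rewrite qF//; apply: eq_bigr => k _; have hZ := sph_harm_zonal_harmonic basis k v.
rewrite zonal_harmonicC -(zonal_operatorE d_gt1 basis cq hZ u1) /zonal_operator.
rewrite (eq_sphere_ipl _ qF) (sphere_ip_sum_sph_harm d_gt1 basis _ hF hZ) ltn_ord sphere_ipC.
by rewrite (zonal_harmonic_reproducing d_gt1 basis (hF k) v1).
Qed.

Lemma zonal_bump_expansion m u v : usphere u -> usphere v ->
  zonal_bump m (dotv u v) = \sum_(k < m.+1) coef (zonal_bump m) k * zonal_harmonic k u v.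
Proof.
move=> u1 v1; pose q : {poly R} := (2^-1 *: (1 + 'X)) ^+ m.
have qE : horner q = zonal_bump m.
  by apply/funext => t; rewrite horner_exp !(hornerE) /zonal_bump mulrC.
rewrite -qE (zonal_poly_expansion (M := m.+1))//; last first.
  by rewrite qE; exact: continuous_zonal_bump.
apply: (leq_trans (size_exp_leq _ _)); rewrite ltnS -[leqRHS]mul1n leq_mul2r.
apply/orP; right; rewrite -ltnS.
have := leq_trans (size_scale_leq (2^-1 : R) (1 + 'X)) (size_polyD _ _).
by rewrite size_poly1 size_polyX; case: size.
Qed.

Section kernel.
Variable kappa : R -> R.
Hypotheses (ck : {within `[-1, 1], continuous kappa}) (pk : sph_pd d kappa).

Let term u v m k := multiplier m k * (coef kappa k * zonal_harmonic k u v).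

Lemma smoothed_expansion m u v : usphere u -> usphere v ->
  zonal_operator (zonal_bump m) (fun w => kappa (dotv u w)) v / mass m =
  \sum_(0 <= k < m.+1) multiplier m k * (coef kappa k * zonal_harmonic k u v).
Proof.
move=> u1 v1; rewrite big_mkord /zonal_operator.
rewrite (eq_sphere_ipl _ (fun w => zonal_bump_expansion m v1 (v := w))).
rewrite (sphere_ip_suml d_gt0) => [|k|]; [|exact: bounded_zonal_harmonic|]; last first.
  exact: bounded_measurable_zonal.
rewrite mulr_suml; apply: eq_bigr => k _; rewrite sphere_ipC zonal_harmonicC.
rewrite -[sphere_ip _ _]/(zonal_operator kappa (zonal_harmonic k v) u).
rewrite (zonal_operatorE d_gt1 basis ck (sph_harm_zonal_harmonic basis k v) u1).
by rewrite /bump_multiplier zonal_harmonicC; ring.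
Qed.

Lemma normr_term_le u v m k : usphere u -> usphere v ->
  `|term u v m k| <= coef kappa k * (N k)%:R.
Proof.
move=> u1 v1; have Z_le := normr_zonal_harmonic_le d_gt1 basis k u1 v1.
have [Nk0|Nk0] := posnP (N k).
  move: Z_le; rewrite Nk0 normr_le0 => /eqP Z0.
  by rewrite /term Z0 !mulr0 normr0.
have coef0 : 0 <= coef kappa k by exact: (funk_hecke_coef_ge0 d_gt1 basis ck pk).
have /andP[mult0 mult1] := bump_multiplier_itv d_gt1 basis m Nk0.
rewrite /term normrM (ger0_norm mult0) normrM (ger0_norm coef0) -[leRHS]mul1r.
by rewrite ler_pM// ?mulr_ge0// ler_wpM2l.
Qed.

Lemma term_cvg u v k : usphere u -> usphere v ->
  term u v ^~ k @ \oo --> coef kappa k * zonal_harmonic k u v.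
Proof.
move=> u1 v1; rewrite (_ : term u v ^~ k =
  (fun m => coef kappa k * (multiplier m k * zonal_harmonic k u v))); last first.
  by apply/funext => m; rewrite /term mulrCA.
by apply: cvgM; [exact: cvg_cst|exact: (bump_multiplier_cvg d_gt1 basis)].
Qed.

(* The partial sums are limits of partial sums of smoothings of [kappa] on the diagonal. *)
Lemma sum_funk_hecke_coef_le n C : (forall t, `[-1, 1]%classic t -> `|kappa t| <= C) ->
  \sum_(0 <= k < n) coef kappa k * (N k)%:R <= C.
Proof.
move=> kC; pose e : 'rV[R]_d := delta_mx 0 (Ordinal d_gt0).
have e1 : usphere e by exact: usphere_delta.
have sum_cvg : (fun m => \sum_(0 <= k < n) term e e m k) @ \oo -->
    \sum_(0 <= k < n) coef kappa k * (N k)%:R.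
  under eq_bigr do rewrite -(zonal_harmonic_diag d_gt1 basis _ e1).
  by apply: (cvg_sum (F := eventually)) => k; exact: term_cvg.
apply: (ler_cvg_to sum_cvg (cvg_cst C)); near=> m.
have nm : (n <= m.+1)%N by rewrite leqW//; near: m; exact: nbhs_infty_ge.
apply: (@le_trans _ _ (\sum_(0 <= k < m.+1) term e e m k)).
  rewrite [leRHS](big_cat_nat (n := n))//= lerDl sumr_ge0// => k _.
  rewrite /term (zonal_harmonic_diag d_gt1 basis)//.
  have [->|Nk0] := posnP (N k); first by rewrite !mulr0.
  have /andP[mult0 _] := bump_multiplier_itv d_gt1 basis m Nk0.
  by rewrite mulr_ge0// mulr_ge0// (funk_hecke_coef_ge0 d_gt1 basis ck pk).
have mass0 := bump_mass_gt0 d_gt1 basis m.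
rewrite -smoothed_expansion// ler_pdivrMr//; apply: (le_trans (ler_norm _)).
apply: (normr_zonal_operator_le d_gt1 basis (@continuous_zonal_bump R m)) => //.
- by move=> u v; exact: zonal_bump_ge0.
- exact: bounded_measurable_zonal.
- by move=> v v1; apply: kC; exact: dotv_itv.
Unshelve. all: by end_near. Qed.

Theorem mercer_expansion u v : usphere u -> usphere v ->
  (fun n => \sum_(k < n) coef kappa k * zonal_harmonic k u v) @ \oo --> kappa (dotv u v).
Proof.
move=> u1 v1; under eq_fun do rewrite -(big_mkord xpredT (fun k => _ k * zonal_harmonic k u v)).
have [C [_ boundC]] := compact_bounded (continuous_compact ck (@segment_compact R (-1) 1)).
apply: (cvg_series_dominated (a := fun m => term u v m.-1)
  (M := fun k => coef kappa k * (N k)%:R)) => [k|m k||].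
- by rewrite -cvg_shiftS; exact: term_cvg.
- exact: normr_term_le.
- apply: nondecreasing_is_cvgn.
    move=> i j ij; rewrite /series/= [leRHS](big_cat_nat (n := i))//= lerDl sumr_ge0// => k _.
    exact: le_trans (normr_ge0 _) (normr_term_le 0 k u1 v1).
  exists (C + 1) => _ [n _ <-]; apply: sum_funk_hecke_coef_le => t t1.
  by apply: boundC; [rewrite ltrDl|exists t].
- rewrite -cvg_shiftS/=; under eq_fun do rewrite -smoothed_expansion//.
  have ckv := continuous_zonal ck u1.
  exact: (bump_approximate_identity d_gt1 basis (bounded_measurable_zonal ck u1) ckv v1).
Qed.

End kernel.
End mercer.

(** * The radial part *)

Section symmetric_diagonalization.
Variable R : rcfType.

Lemma sum_ord2 (V : nmodType) (F : 'I_2 -> V) : \sum_(i < 2) F i = F 0 + F 1.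
Proof. by rewrite big_ord_recl big_ord1; congr (_ + F _); exact: val_inj. Qed.

Lemma ord2P (i : 'I_2) : i = 0 \/ i = 1.
Proof. by case: i => -[|[|//]] ilt; [left|right]; exact: val_inj. Qed.

Lemma sym2_eigenvector (S : 'M[R]_2) : S^T = S ->
  exists (v : 'rV[R]_2) (lam : R), v != 0 /\ v *m S = lam *: v.
Proof.
move=> symS; have S10 : S 1 0 = S 0 1 by rewrite -[in LHS]symS mxE.
have [S01|S01] := eqVneq (S 0 1) 0.
  exists (delta_mx 0 0), (S 0 0); split.
    by apply/eqP => /matrixP/(_ 0 0)/eqP; rewrite !mxE !eqxx oner_eq0.
  apply/rowP => j; rewrite -rowE !mxE eqxx/=.
  by case: (ord2P j) => ->; rewrite ?S01 ?mulr1 ?mulr0.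
(* The second coordinate [q] of the eigenvector of first coordinate [S 0 1] is a root of
   [q ^ 2 + (S 0 0 - S 1 1) q - (S 0 1) ^ 2]. *)
pose D := Num.sqrt ((S 0 0 - S 1 1) ^+ 2 + 4 * S 0 1 ^+ 2).
have D2 : D ^+ 2 = (S 0 0 - S 1 1) ^+ 2 + 4 * S 0 1 ^+ 2.
  by rewrite sqr_sqrtr// addr_ge0 ?sqr_ge0// mulr_ge0 ?sqr_ge0.
pose q := (S 1 1 - S 0 0 + D) / 2.
have qE : S 0 1 ^+ 2 + q * S 1 1 = (S 0 0 + q) * q.
  apply/eqP; rewrite -subr_eq0.
  rewrite (_ : _ - _ = 4^-1 * ((S 0 0 - S 1 1) ^+ 2 + 4 * S 0 1 ^+ 2 - D ^+ 2)).
    by rewrite D2 subrr mulr0.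
  by rewrite /q; field.
exists (\row_j if j == 0 then S 0 1 else q), (S 0 0 + q); split.
  by apply: contra_neq S01 => /rowP/(_ 0); rewrite !mxE.
apply/rowP => j; rewrite !mxE sum_ord2 !mxE/=.
by case: (ord2P j) => -> /=; rewrite ?S10; [ring|rewrite -expr2 qE].
Qed.

End symmetric_diagonalization.

Lemma sym2_spectral (R : realType) (S : 'M[R]_2) : S^T = S ->
  exists (Q : 'M[R]_2) (D : 'rV[R]_2), orthogonal_mx Q /\ Q *m S = diag_mx D *m Q.
Proof.
move=> symS; have [v [lam [v0 vS]]] := sym2_eigenvector symS.
have e1 : usphere (hatv v) by exact/usphere_hatv.
have [e' e'1 ee'] := usphere_exists_orth (isT : (1 < 2)%N) e1.
pose Q := \matrix_(i < 2) (if i == 0 then hatv v else e').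
have QE i j : (Q *m Q^T) i j = dotv (row i Q) (row j Q).
  by rewrite mxE; apply: eq_bigr => l _; rewrite !mxE.
have oQ : orthogonal_mx Q.
  apply/matrixP => i j; rewrite QE !rowK mxE.
  case: (ord2P i) => ->; case: (ord2P j) => -> /=; rewrite ?(dotvC e') ?ee'//.
  - exact: (usphereE _).1 e1.
  - exact: (usphereE _).1 e'1.
pose B := Q *m S *m Q^T.
have symB : B^T = B by rewrite /B !trmx_mul trmxK symS mulmxA.
have B01 : B 0 1 = 0.
  have -> : B 0 1 = dotv (row 0 Q *m S) (row 1 Q).
    by rewrite -row_mul mxE; apply: eq_bigr => l _; rewrite !mxE.
  have eS : hatv v *m S = lam *: hatv v by rewrite -scalemxAl vS !scalerA mulrC.
  by rewrite !rowK/= eS dotvZl ee' mulr0.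
have QSE : Q *m S = B *m Q by rewrite /B -[RHS]mulmxA (mulmx1C oQ) mulmx1.
clearbody B; exists Q, (\row_i B i i); split=> //; rewrite QSE; congr (_ *m _).
apply/matrixP => i j; rewrite !mxE.
case: (ord2P i) => ->; case: (ord2P j) => -> //=.
by rewrite -[in LHS]symB mxE B01.
Qed.

(* The map [w |-> w *m C] carries the form [C *m C^T] to the standard one and
   [C *m C^T *m L] to the symmetric matrix [C^T *m L *m C]. *)
Lemma gram_diagonalization (R : realType) n (C L Q : 'M[R]_n) (D : 'rV[R]_n) :
  C \in unitmx -> orthogonal_mx Q -> Q *m (C^T *m L *m C) = diag_mx D *m Q ->
  let P := Q *m invmx C in [/\ P *m (C *m C^T) *m P^T = 1%:M,
    P *m (C *m C^T) *m L = diag_mx D *m P & P^T *m diag_mx D *m P = L].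
Proof.
move=> uC oQ QS P; have PC : P *m C = Q by rewrite mulmxKV.
clearbody P.
have P_orth : P *m (C *m C^T) *m P^T = 1%:M.
  by rewrite mulmxA PC -mulmxA -trmx_mul PC.
have PD : P^T *m diag_mx D *m P = L.
  have uCT : C^T \in unitmx by rewrite unitmx_tr.
  apply: (can_inj (mulKmx uCT)); apply: (can_inj (mulmxK uC)).
  rewrite !mulmxA -trmx_mul PC -!mulmxA PC -QS !mulmxA.
  by rewrite (mulmx1C oQ) mul1mx.
by split=> //; rewrite -{1}PD -(mulmxA P^T) [LHS]mulmxA P_orth mul1mx.
Qed.

Section moments.
Variables (R : realType) (p : R -> R).
Local Notation mu := (@lebesgue_measure R).
Local Notation rays := (`[0%R, +oo[%classic : set (measurableTypeR R)).
Hypotheses (mp : measurable_fun (`[0%R, +oo[ : set R) p)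
  (p_ge0 : forall r, 0 <= r -> 0 <= p r)
  (p_mass : (\int[mu]_(r in `[0%R, +oo[) (p r)%:E = 1)%E)
  (p_moment2 : (0 < \int[mu]_(r in `[0%R, +oo[) (p r * r ^+ 2)%:E < +oo)%E).

Definition moment (i : nat) : R := \int[mu]_(r in `[0%R, +oo[) (p r * r ^+ i).

Let mrays : measurable rays. Proof. exact: measurable_itv. Qed.

Let in_rays (r : R) : rays r -> 0 <= r.
Proof. by rewrite /= in_itv/= andbT. Qed.

Let measurable_moment i : measurable_fun (`[0%R, +oo[ : set R) (fun r => p r * r ^+ i).
Proof. by apply: measurable_funM => //; exact: measurable_funX. Qed.

Let moment_ge0 i r : rays r -> 0 <= p r * r ^+ i.
Proof. by move=> /in_rays r0; rewrite mulr_ge0 ?p_ge0// exprn_ge0. Qed.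

Let integrable_moment_ltoo i : (\int[mu]_(r in `[0%R, +oo[) (p r * r ^+ i)%:E < +oo)%E ->
  mu.-integrable `[0%R, +oo[ (EFin \o (fun r => p r * r ^+ i)).
Proof.
move=> moment_ltoo; apply/integrableP; split.
  by apply/measurable_EFinP; exact: measurable_moment.
apply: le_lt_trans moment_ltoo; rewrite le_eqVlt; apply/orP; left; apply/eqP.
by apply: eq_integral => r; rewrite inE => rD; rewrite /= ger0_norm// moment_ge0.
Qed.

Lemma integrable_moment i : (i <= 2)%N ->
  mu.-integrable `[0%R, +oo[ (EFin \o (fun r => p r * r ^+ i)).
Proof.
move=> i2.
have int0 : mu.-integrable `[0%R, +oo[ (EFin \o (fun r => p r * r ^+ 0)).
  apply: integrable_moment_ltoo.
  by under eq_integral do rewrite expr0 mulr1; rewrite p_mass ltry.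
have int2 : mu.-integrable `[0%R, +oo[ (EFin \o (fun r => p r * r ^+ 2)).
  by apply: integrable_moment_ltoo; case/andP: p_moment2.
apply: le_integrable (integrableD mrays int0 int2) => //.
  by apply/measurable_EFinP; exact: measurable_moment.
move=> r rD /=; have r0 := in_rays rD.
rewrite lee_fin (ger0_norm (moment_ge0 i rD)) ger0_norm ?addr_ge0 ?moment_ge0//.
rewrite -mulrDr ler_wpM2l ?p_ge0// expr0.
by case: i i2 => [|[|[|//]]] _; rewrite ?expr0 ?expr1; nra.
Qed.

Lemma integral_moment_sum (I : finType) (c : I -> R) (e : I -> nat) :
  (forall i, e i <= 2)%N ->
  mu.-integrable `[0%R, +oo[ (EFin \o (fun r => (\sum_i c i * r ^+ e i) * p r)) /\
  \int[mu]_(r in `[0%R, +oo[) ((\sum_i c i * r ^+ e i) * p r) = \sum_i c i * moment (e i).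
Proof.
move=> e2; elim: (index_enum I) => [|i s [int_s IH]].
  rewrite (_ : (fun r => _) = cst 0); last by apply/funext => r; rewrite big_nil mul0r.
  by rewrite big_nil Rintegral_cst// mul0r; split=> //; exact: integrable0.
have int_i := integrableZl mrays (c i) (integrable_moment (e2 i)).
rewrite (_ : (fun r => _) = fun r =>
    c i * (p r * r ^+ e i) + (\sum_(j <- s) c j * r ^+ e j) * p r); last first.
  by apply/funext => r; rewrite big_cons; ring.
split; first exact: (integrableD mrays int_i int_s).
rewrite RintegralD// big_cons -IH; congr (_ + _).
exact: (RintegralZl _ mrays (integrable_moment (e2 i))).
Qed.

Lemma moment0 : moment 0 = 1.
Proof. by rewrite /moment /Rintegral; under eq_integral do rewrite expr0 mulr1; rewrite p_mass. Qed.

Lemma moment2_gt0 : 0 < moment 2.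
Proof. by rewrite /moment /Rintegral fine_gt0. Qed.

Lemma moment2_normalization : exists2 a, 0 < a & a ^+ 2 * moment 2 = 1.
Proof.
have m2 := moment2_gt0; exists (Num.sqrt (moment 2))^-1; first by rewrite invr_gt0 sqrtr_gt0.
by rewrite exprVn sqr_sqrtr ?ltW// mulVf// gt_eqF.
Qed.

(* Otherwise [p] would be concentrated at the point [moment 1]. *)
Lemma moment_variance_gt0 : 0 < moment 2 - moment 1 ^+ 2.
Proof.
set m := moment 1; pose c (i : 'I_3) : R := nth 0 [:: m ^+ 2; - (2 * m); 1] i.
pose f r := (\sum_(i < 3) c i * r ^+ i) * p r.
have [fi f_int] := integral_moment_sum c (fun i : 'I_3 => ltn_ord i : (i <= 2)%N).
have fE r : f r = (r - m) ^+ 2 * p r.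
  by rewrite /f !big_ord_recl big_ord0 /c/= /bump/=; ring.
have varE : \int[mu]_(r in `[0%R, +oo[) f r = moment 2 - m ^+ 2.
  by rewrite f_int !big_ord_recl big_ord0 /c/= /bump/= moment0 -/m; ring.
have f_ge0 r : rays r -> 0 <= f r.
  by move=> /in_rays r0; rewrite fE mulr_ge0 ?sqr_ge0// p_ge0.
rewrite -varE lt_neqAle Rintegral_ge0// andbT; apply/negP => /eqP f0.
have norm0 : (\int[mu]_(r in `[0%R, +oo[) `|(EFin \o f) r| = 0)%E.
  transitivity (\int[mu]_(r in `[0%R, +oo[) (f r)%:E)%E.
    by apply: eq_integral => r; rewrite inE => rD; rewrite /= ger0_norm// f_ge0.
  rewrite -[LHS]fineK ?(integrable_fin_num _ fi)//.
  by rewrite -[fine _]/(\int[mu]_(r in `[0%R, +oo[) f r) -f0.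
have mf : measurable_fun (`[0%R, +oo[ : set R) (EFin \o f) by case/integrableP: fi.
have /(ae_eq_integral_abs _ mrays mf) f_ae0 := norm0.
have p_ae0 : (\int[mu]_(r in `[0%R, +oo[) (p r)%:E = \int[mu]_(r in `[0%R, +oo[) cst 0 r)%E.
  apply: ae_eq_integral => //; first exact/measurable_EFinP.
  have neq_m : \forall r \ae mu, r != m.
    exists [set m]; split; [exact: measurable_set1|exact: lebesgue_measure_set1|].
    by move=> r /= /negP; rewrite negbK => /eqP.
  apply: filterS2 f_ae0 neq_m => r /= fr0 rm /fr0; rewrite fE => -[/eqP].
  by rewrite mulf_eq0 sqrf_eq0 subr_eq0 (negbTE rm)/= => /eqP ->.
by move/eqP: p_ae0; rewrite p_mass integral0 onee_eq0.
Qed.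

(* The Gram matrix of the functions [r] and [1] for the density [p]. *)
Definition moment_gram : 'M[R]_2 := \matrix_(i, j) moment (1 - i + (1 - j)).

Lemma radial_eigenbasis (lam : 'rV[R]_2) : exists (P : 'M[R]_2) (D : 'rV[R]_2),
  [/\ P *m moment_gram *m P^T = 1%:M, P *m moment_gram *m diag_mx lam = diag_mx D *m P &
      P^T *m diag_mx D *m P = diag_mx lam].
Proof.
pose s := Num.sqrt (moment 2 - moment 1 ^+ 2); have var0 := moment_variance_gt0.
have s2 : s ^+ 2 = moment 2 - moment 1 ^+ 2 by rewrite sqr_sqrtr// ltW.
pose C : 'M[R]_2 := \matrix_(i, j)
  if i == 0 then if j == 0 then s else moment 1 else if j == 0 then 0 else 1.
have GE : moment_gram = C *m C^T.
  apply/matrixP => i j; rewrite !mxE sum_ord2 !mxE.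
  by case: (ord2P i) => ->; case: (ord2P j) => ->; rewrite /= -?expr2 ?s2 ?moment0; ring.
have uC : C \in unitmx.
  rewrite unitmxE -det_tr det_trig; last first.
    by apply/is_trig_mxP => i j; rewrite !mxE; case: (ord2P i) => ->; case: (ord2P j) => ->.
  by rewrite big_ord_recl big_ord1 !mxE/= mulr1 unitfE gt_eqF// sqrtr_gt0.
have symS : (C^T *m diag_mx lam *m C)^T = C^T *m diag_mx lam *m C.
  by rewrite !trmx_mul trmxK tr_diag_mx mulmxA.
have [Q [D [oQ QS]]] := sym2_spectral symS.
by exists (Q *m invmx C), D; rewrite GE; exact: gram_diagonalization.
Qed.

End moments.

(** * Kernels homogeneous of order one and zero *)

Section homogeneous_kernels.
Variables (R : realType) (d : nat) (p : R -> R).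
Variables (N : nat -> nat) (Y : nat -> nat -> 'rV[R]_d -> R).
Local Notation mu := (@lebesgue_measure R).
Hypotheses (d_gt1 : (1 < d)%N) (basis : sph_harm_basis N Y)
  (mp : measurable_fun (`[0%R, +oo[ : set R) p)
  (p_ge0 : forall r, 0 <= r -> 0 <= p r)
  (p_mass : (\int[mu]_(r in `[0%R, +oo[) (p r)%:E = 1)%E)
  (p_moment2 : (0 < \int[mu]_(r in `[0%R, +oo[) (p r * r ^+ 2)%:E < +oo)%E).
Local Notation sbounded := (bounded_measurable (usphere : set 'rV[R]_d)).
Local Notation G := (moment_gram p).
Local Notation coef := (funk_hecke_coef d).
Implicit Types (f g : 'rV[R]_d -> R) (x z : 'rV[R]_d) (kappa : R -> R).

Definition homogeneous_kernel n kappa x z : R :=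
  enorm x ^+ n * enorm z ^+ n * kappa (dotv (hatv x) (hatv z)).

(* The coefficients of [a * r + b] are indexed so that [r ^+ (1 - i)] has index [i]. *)
Definition radial_col (r : R) : 'cV[R]_2 := \col_i r ^+ (1 - i).

Lemma radial_shE m (P : 'M[R]_(m, 2)) i f x :
  radial_sh (P i 0) (P i 1) f x = (P *m radial_col (enorm x)) i 0 * f (hatv x).
Proof. by rewrite /radial_sh mxE sum_ord2 !mxE expr1 expr0 mulr1. Qed.

Lemma radial_sh_diag m (P : 'M[R]_(m, 2)) (D : 'rV[R]_m) i f x :
  radial_sh ((diag_mx D *m P) i 0) ((diag_mx D *m P) i 1) f x =
  D 0 i * radial_sh (P i 0) (P i 1) f x.
Proof. by rewrite mul_diag_mx /radial_sh !mxE; ring. Qed.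

Definition row_pair (a b : R) : 'rV[R]_2 := \row_j if j == 0 then a else b.

Lemma row_pair0 a b : row_pair a b 0 0 = a.
Proof. by rewrite mxE. Qed.

Lemma row_pair1 a b : row_pair a b 0 1 = b.
Proof. by rewrite mxE. Qed.

Lemma row_pair_gram a : (row_pair a 0 *m G *m (row_pair a 0)^T) 0 0 = a ^+ 2 * moment p 2.
Proof. by rewrite !(mxE, sum_ord2)/=; ring. Qed.

Lemma iint_radial_sum (I : finType) (c : I -> R) (e : I -> nat) g :
  (forall i, e i <= 2)%N -> sbounded g ->
  let F z := (\sum_i c i * enorm z ^+ e i) * g (hatv z) * pbar p z in
  (lebesgue_row R d).-integrable setT (EFin \o F) /\
  iint F = ((\sum_i c i * moment p (e i)) * sphere_mean g)%:E.
Proof.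
move=> e2 bg F; pose psi r := (\sum_i c i * r ^+ e i) * p r.
have [int_psi psiE] := integral_moment_sum mp p_ge0 p_mass p_moment2 c e2.
have -> : F = fun z => psi (enorm z) / sphere_area d (enorm z) * g (hatv z).
  by apply/funext => z; rewrite /F /psi /pbar; ring.
split; first exact: (integrable_radial_spherical d_gt1 int_psi bg).
by rewrite -psiE; exact: (iint_radial_spherical d_gt1 int_psi bg).
Qed.

Lemma L2ip_radial_sh m (P : 'M[R]_(m, 2)) i m' (P' : 'M[R]_(m', 2)) i' f g :
  sbounded f -> sbounded g ->
  L2ip p (radial_sh (P i 0) (P i 1) f) (radial_sh (P' i' 0) (P' i' 1) g) =
  ((P *m G *m P'^T) i i' * sphere_ip f g)%:E.
Proof.
move=> bf bg; have e2 (ij : 'I_2 * 'I_2) : (1 - ij.1 + (1 - ij.2) <= 2)%N.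
  by rewrite (leq_add (n1 := 1) (n2 := 1))// leq_subr.
have [_ iintE] := iint_radial_sum (fun ij => P i ij.1 * P' i' ij.2) e2
  (bounded_measurableM bf bg).
transitivity (iint (fun z => (\sum_(ij : 'I_2 * 'I_2) P i ij.1 * P' i' ij.2 *
    enorm z ^+ (1 - ij.1 + (1 - ij.2))) * (f (hatv z) * g (hatv z)) * pbar p z)).
  congr iint; apply/funext => z; congr (_ * _); rewrite !radial_shE.
  rewrite [RHS](_ : _ = (P *m radial_col (enorm z)) i 0 * (P' *m radial_col (enorm z)) i' 0 *
    (f (hatv z) * g (hatv z))); first by ring.
  congr (_ * _); rewrite !mxE big_distrlr pair_big/=; apply: eq_bigr => -[j l] _.
  by rewrite !mxE exprD; ring.
rewrite iintE; congr EFin; congr (_ * _).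
rewrite mxE; under [RHS]eq_bigr do rewrite !mxE mulr_suml.
rewrite exchange_big pair_big/=; apply: eq_bigr => -[j l] _.
by rewrite !mxE/=; ring.
Qed.

Lemma Top_homogeneous_kernel (l : 'I_2) kappa k f m (P : 'M[R]_(m, 2)) i x :
  {within `[-1, 1], continuous kappa} -> sph_harm k f -> x != 0 ->
  let F z := homogeneous_kernel (1 - l) kappa x z * radial_sh (P i 0) (P i 1) f z * pbar p z in
  (lebesgue_row R d).-integrable setT (EFin \o F) /\
  iint F = ((P *m G) i l * coef kappa k * radial_col (enorm x) l 0 * f (hatv x))%:E.
Proof.
move=> ck hf x0 F; have x1 : usphere (hatv x) by exact/usphere_hatv.
have e2 (j : 'I_2) : (1 - j + (1 - l) <= 2)%N.
  by rewrite (leq_add (n1 := 1) (n2 := 1))// leq_subr.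
have bkf := bounded_measurableM (bounded_measurable_zonal ck x1) (bounded_measurable_sph_harm hf).
have := iint_radial_sum (fun j => enorm x ^+ (1 - l) * P i j) e2 bkf.
rewrite -[sphere_mean _]/(zonal_operator kappa f (hatv x)) (zonal_operatorE d_gt1 basis ck hf x1).
rewrite (_ : (fun z => _) = F); last first.
  apply/funext => z; rewrite /F /homogeneous_kernel radial_shE mxE.
  have -> : \sum_j enorm x ^+ (1 - l) * P i j * enorm z ^+ (1 - j + (1 - l)) =
      enorm x ^+ (1 - l) * enorm z ^+ (1 - l) * \sum_j P i j * radial_col (enorm z) j 0.
    by rewrite mulr_sumr; apply: eq_bigr => j _; rewrite mxE exprD; ring.
  by ring.
move=> [intF ->]; split=> //; congr EFin.
have -> : \sum_j enorm x ^+ (1 - l) * P i j * moment p (1 - j + (1 - l)) =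
    (P *m G) i l * radial_col (enorm x) l 0.
  by rewrite !mxE mulr_suml; apply: eq_bigr => j _; rewrite mxE; ring.
by ring.
Qed.

Lemma Top_order1_kernel kappa k f a x : {within `[-1, 1], continuous kappa} -> sph_harm k f ->
  Top p (fun x z => enorm x * enorm z * kappa (dotv (hatv x) (hatv z))) (radial_sh a 0 f) x =
  (moment p 2 * coef kappa k * radial_sh a 0 f x)%:E.
Proof.
move=> ck hf; pose P := row_pair a 0.
have [P0 P1] := (row_pair0 a 0, row_pair1 a 0).
have [->|x0] := eqVneq x 0.
  have [_ iint0] := @iint_radial_sum void (fun=> 0) (fun=> 0%N) (cst 0) (fun=> isT)
    (bounded_measurable_cst _ 0).
  rewrite /radial_sh enorm0 !(mulr0, addr0, mul0r).
  transitivity (iint (fun z => (\sum_(i : void) 0 * enorm z ^+ 0) * cst 0 (hatv z) * pbar p z)).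
    by congr iint; apply/funext => z; rewrite enorm0 big_pred0//= !mul0r.
  by rewrite iint0 big_pred0// mul0r.
have [_ TE] := Top_homogeneous_kernel 0 P 0 ck hf x0.
transitivity (iint (fun z => homogeneous_kernel 1 kappa x z *
    radial_sh (P 0 0) (P 0 1) f z * pbar p z)).
  by congr iint; apply/funext => z; rewrite P0 P1 /homogeneous_kernel !expr1.
by rewrite [LHS]TE; congr EFin; rewrite /radial_sh mxE sum_ord2 P0 P1 !mxE/=; ring.
Qed.

Lemma iintD f g : (lebesgue_row R d).-integrable setT (EFin \o f) ->
  (lebesgue_row R d).-integrable setT (EFin \o g) ->
  iint (fun x => f x + g x) = (iint f + iint g)%E.
Proof.
move=> fi gi; rewrite !iint_integral//; last exact: (integrableD measurableT fi gi).
by rewrite -integralD//; apply: eq_integral => x _; rewrite EFinD.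
Qed.

Section mixed_kernel.
Variables kappa0 kappa1 : R -> R.
Hypotheses (ck0 : {within `[-1, 1], continuous kappa0})
  (ck1 : {within `[-1, 1], continuous kappa1}).

Definition funk_hecke_row k : 'rV[R]_2 :=
  \row_l coef (if l == 0 then kappa0 else kappa1) k.

Lemma Top_mixed_kernel k f m (P : 'M[R]_(m, 2)) i x : sph_harm k f -> x != 0 ->
  let P' := P *m G *m diag_mx (funk_hecke_row k) in
  Top p (fun x z => enorm x * enorm z * kappa0 (dotv (hatv x) (hatv z)) +
    kappa1 (dotv (hatv x) (hatv z))) (radial_sh (P i 0) (P i 1) f) x =
  (radial_sh (P' i 0) (P' i 1) f x)%:E.
Proof.
move=> hf x0 P'; have [int0 T0] := Top_homogeneous_kernel 0 P i ck0 hf x0.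
have [int1 T1] := Top_homogeneous_kernel 1 P i ck1 hf x0.
rewrite radial_shE mxE sum_ord2 /P' !mul_mx_diag.
have -> : forall a b, (a + b) * f (hatv x) = a * f (hatv x) + b * f (hatv x) by move=> *; ring.
transitivity (iint (fun z => homogeneous_kernel 1 kappa0 x z *
      radial_sh (P i 0) (P i 1) f z * pbar p z +
    homogeneous_kernel 0 kappa1 x z *
      radial_sh (P i 0) (P i 1) f z * pbar p z)).
  by congr iint; apply/funext => z; rewrite /homogeneous_kernel !expr1 !expr0; ring.
by rewrite [LHS](iintD int0 int1) T0 T1 -EFinD !mxE/=; congr EFin; ring.
Qed.

End mixed_kernel.

Lemma sum_radial_sh (P : 'M[R]_2) (D lam : 'rV[R]_2) f g x z :
  P^T *m diag_mx D *m P = diag_mx lam ->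
  \sum_(i < 2) D 0 i * radial_sh (P i 0) (P i 1) f x * radial_sh (P i 0) (P i 1) g z =
  (lam 0 0 * (enorm x * enorm z) + lam 0 1) * (f (hatv x) * g (hatv z)).
Proof.
move=> PD; pose rx := radial_col (enorm x); pose rz := radial_col (enorm z).
transitivity (((P *m rx)^T *m diag_mx D *m (P *m rz)) 0 0 * (f (hatv x) * g (hatv z))).
  rewrite mul_mx_diag mxE mulr_suml; apply: eq_bigr => i _.
  by rewrite !radial_shE !mxE -/rx -/rz; ring.
congr (_ * _); rewrite trmx_mul (_ : _ *m _ = rx^T *m (P^T *m diag_mx D *m P) *m rz).
  by rewrite PD mul_mx_diag mxE sum_ord2 !mxE/= !expr1 !expr0; ring.
by rewrite !mulmxA.
Qed.

Lemma order1_kernel_expansion kappa x z : {within `[-1, 1], continuous kappa} ->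
  sph_pd d kappa ->
  (fun n => \sum_(k < n) coef kappa k * (enorm x * enorm z *
    zonal_harmonic N Y k (hatv x) (hatv z))) @ \oo -->
  enorm x * enorm z * kappa (dotv (hatv x) (hatv z)).
Proof.
move=> ck pk; rewrite (_ : (fun n => _) = fun n => enorm x * enorm z *
    \sum_(k < n) coef kappa k * zonal_harmonic N Y k (hatv x) (hatv z)); last first.
  by apply/funext => n; rewrite mulr_sumr; apply: eq_bigr => k _; rewrite mulrCA.
have [xz0|] := eqVneq (enorm x * enorm z) 0.
  by rewrite xz0 mul0r; under eq_fun do rewrite mul0r; exact: cvg_cst.
rewrite mulf_eq0 !enorm_eq0 => /norP[x0 z0]; apply: cvgM; first exact: cvg_cst.
by apply: (mercer_expansion d_gt1 basis ck pk); exact/usphere_hatv.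
Qed.

Lemma order1_kernel_eigen_expansion kappa a x z : {within `[-1, 1], continuous kappa} ->
  sph_pd d kappa -> a ^+ 2 * moment p 2 = 1 ->
  (fun n => \sum_(k < n) moment p 2 * coef kappa k *
    \sum_(j < N k) radial_sh a 0 (Y k j) x * radial_sh a 0 (Y k j) z) @ \oo -->
  enorm x * enorm z * kappa (dotv (hatv x) (hatv z)).
Proof.
move=> ck pk a2; have := order1_kernel_expansion (x := x) (z := z) ck pk.
apply: cvg_trans; apply: near_eq_cvg; near=> n; apply: eq_bigr => k _.
rewrite !mulr_sumr; apply: eq_bigr => j _; rewrite /radial_sh.
by rewrite -[LHS]mul1r -a2; ring.
Unshelve. all: by end_near. Qed.

Lemma mixed_kernel_eigen_expansion kappa0 kappa1 (P : nat -> 'M[R]_2) (D : nat -> 'rV[R]_2) x z :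
  {within `[-1, 1], continuous kappa0} -> {within `[-1, 1], continuous kappa1} ->
  sph_pd d kappa0 -> sph_pd d kappa1 ->
  (forall k, (P k)^T *m diag_mx (D k) *m P k = diag_mx (funk_hecke_row kappa0 kappa1 k)) ->
  x != 0 -> z != 0 ->
  (fun n => \sum_(k < n) \sum_(j < N k) \sum_(i < 2) D k 0 i *
    radial_sh (P k i 0) (P k i 1) (Y k j) x * radial_sh (P k i 0) (P k i 1) (Y k j) z) @ \oo -->
  enorm x * enorm z * kappa0 (dotv (hatv x) (hatv z)) + kappa1 (dotv (hatv x) (hatv z)).
Proof.
move=> ck0 ck1 pk0 pk1 PD x0 z0; have x1 := (usphere_hatv x).2 x0.
have z1 := (usphere_hatv z).2 z0.
rewrite (_ : (fun n => _) = fun n =>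
    \sum_(k < n) coef kappa0 k * (enorm x * enorm z * zonal_harmonic N Y k (hatv x) (hatv z)) +
    \sum_(k < n) coef kappa1 k * zonal_harmonic N Y k (hatv x) (hatv z)); last first.
  apply/funext => n; rewrite -big_split; apply: eq_bigr => k _.
  rewrite /= !mulr_sumr -big_split; apply: eq_bigr => j _.
  by rewrite (sum_radial_sh _ _ _ _ (PD k)) !mxE/=; ring.
apply: cvgD; first exact: order1_kernel_expansion.
exact: (mercer_expansion d_gt1 basis ck1 pk1).
Qed.

Lemma L2ip_basis m (P : 'M[R]_(m, 2)) i m' (P' : 'M[R]_(m', 2)) i' k j k' j' :
  (j < N k)%N -> (j' < N k')%N ->
  L2ip p (radial_sh (P i 0) (P i 1) (Y k j)) (radial_sh (P' i' 0) (P' i' 1) (Y k' j')) =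
  ((P *m G *m P'^T) i i' * ((k == k') && (j == j'))%:R)%:E.
Proof.
move=> jk jk'; rewrite L2ip_radial_sh.
- by rewrite (sphere_ip_basis d_gt1 basis (Ordinal jk) (Ordinal jk')).
- exact: (bounded_measurable_basis basis (Ordinal jk)).
- exact: (bounded_measurable_basis basis (Ordinal jk')).
Qed.

Lemma order1_orthonormal a k j k' j' : a ^+ 2 * moment p 2 = 1 ->
  (j < N k)%N -> (j' < N k')%N ->
  L2ip p (radial_sh a 0 (Y k j)) (radial_sh a 0 (Y k' j')) =
  (if (k == k') && (j == j') then 1 else 0)%:E.
Proof.
move=> a2 jk jk'; have := L2ip_basis (row_pair a 0) 0 (row_pair a 0) 0 jk jk'.
by rewrite row_pair0 row_pair1 row_pair_gram a2 mul1r; case: ifP.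
Qed.

Lemma mixed_orthonormal (P : nat -> 'M[R]_2) k j i k' j' i' :
  (forall k, P k *m G *m (P k)^T = 1%:M) -> (j < N k)%N -> (j' < N k')%N ->
  L2ip p (radial_sh (P k i 0) (P k i 1) (Y k j)) (radial_sh (P k' i' 0) (P k' i' 1) (Y k' j')) =
  (if [&& k == k', j == j' & i == i'] then 1 else 0)%:E.
Proof.
move=> PGP jk jk'; rewrite L2ip_basis//; case: eqVneq => [<-|_]/=; rewrite ?mulr0// PGP mxE.
by rewrite -natrM mulnb andbC; case: ifP.
Qed.

End homogeneous_kernels.

Theorem theorem6 (R : realType) (d : nat) (p : R -> R) (kappa0 kappa1 : R -> R)
    (N : nat -> nat) (Y : nat -> nat -> 'rV[R]_d -> R) :
  (2 <= d)%N ->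
  measurable_fun (`[0%R, +oo[ : set R) p ->
  (forall r, 0 <= r -> 0 <= p r) ->
  (\int[@lebesgue_measure R]_(r in `[0%R, +oo[) (p r)%:E = 1)%E ->
  (0 < \int[@lebesgue_measure R]_(r in `[0%R, +oo[) (p r * r ^+ 2)%:E < +oo)%E ->
  {within `[-1, 1], continuous kappa0} ->
  {within `[-1, 1], continuous kappa1} ->
  sph_pd d kappa0 -> sph_pd d kappa1 ->
  sph_harm_basis N Y ->
  let k0 := fun x z : 'rV[R]_d => enorm x * enorm z * kappa0 (dotv (hatv x) (hatv z)) in
  let k1 := fun x z : 'rV[R]_d => kappa1 (dotv (hatv x) (hatv z)) in
  (* (1) *)
  (exists (a : R) (lam : nat -> R), 0 < a /\
     (forall k j, (j < N k)%N -> forall x,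
        Top p k0 (radial_sh a 0 (Y k j)) x = (lam k * radial_sh a 0 (Y k j) x)%:E) /\
     (forall k j k' j', (j < N k)%N -> (j' < N k')%N ->
        L2ip p (radial_sh a 0 (Y k j)) (radial_sh a 0 (Y k' j'))
        = (if (k == k') && (j == j') then 1 else 0)%:E) /\
     (forall x z : 'rV[R]_d,
        (fun n => \sum_(k < n) lam k *
            \sum_(j < N k) radial_sh a 0 (Y k j) x * radial_sh a 0 (Y k j) z)
        @ \oo --> k0 x z))
  /\
  (* (2) *)
  ((forall k j, (j < N k)%N -> forall a b : R, exists a' b' : R,
      forall x : 'rV[R]_d, x != 0 ->
        Top p (fun x z => k0 x z + k1 x z) (radial_sh a b (Y k j)) x
        = (radial_sh a' b' (Y k j) x)%:E) /\
   (exists (A B M : nat -> nat -> 'I_2 -> R),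
     (forall k j (i : 'I_2), (j < N k)%N -> forall x : 'rV[R]_d, x != 0 ->
        Top p (fun x z => k0 x z + k1 x z) (radial_sh (A k j i) (B k j i) (Y k j)) x
        = (M k j i * radial_sh (A k j i) (B k j i) (Y k j) x)%:E) /\
     (forall k j (i : 'I_2) k' j' (i' : 'I_2), (j < N k)%N -> (j' < N k')%N ->
        L2ip p (radial_sh (A k j i) (B k j i) (Y k j))
               (radial_sh (A k' j' i') (B k' j' i') (Y k' j'))
        = (if [&& k == k', j == j' & i == i'] then 1 else 0)%:E) /\
     (forall x z : 'rV[R]_d, x != 0 -> z != 0 ->
        (fun n => \sum_(k < n) \sum_(j < N k) \sum_(i < 2) M k j i *
            radial_sh (A k j i) (B k j i) (Y k j) x *
            radial_sh (A k j i) (B k j i) (Y k j) z)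
        @ \oo --> k0 x z + k1 x z))).
Proof.
move=> d_gt1 mp p_ge0 p_mass p_moment2 ck0 ck1 pk0 pk1 basis k0 k1.
have hY k j (jk : (j < N k)%N) := basis_sph_harm basis (Ordinal jk).
have Top_mixed := Top_mixed_kernel d_gt1 basis mp p_ge0 p_mass p_moment2 ck0 ck1.
split.
  have [a a_gt0 a2] := moment2_normalization p_moment2.
  exists a, (fun k => moment p 2 * funk_hecke_coef d kappa0 k); split=> //; split; [|split].
  - move=> k j jk x.
    exact: (Top_order1_kernel d_gt1 basis mp p_ge0 p_mass p_moment2 a x ck0 (hY k j jk)).
  - by move=> *; exact: (order1_orthonormal d_gt1 basis).
  - by move=> x z; exact: (order1_kernel_eigen_expansion d_gt1 basis ck0 pk0 a2).
split=> [k j jk a b|].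
  pose w := row_pair a b *m moment_gram p *m diag_mx (funk_hecke_row d kappa0 kappa1 k).
  exists (w 0 0), (w 0 1) => x x0; rewrite -(Top_mixed _ _ _ _ _ _ (hY k j jk) x0).
  by rewrite row_pair0 row_pair1.
have [P /choice[D eigenbasis]] := choice (fun k =>
  radial_eigenbasis mp p_ge0 p_mass p_moment2 (funk_hecke_row d kappa0 kappa1 k)).
exists (fun k _ i => P k i 0), (fun k _ i => P k i 1), (fun k _ i => D k 0 i); split; [|split].
- move=> k j i jk x x0; have [_ PGL _] := eigenbasis k.
  by rewrite (Top_mixed _ _ _ (P k) i x (hY k j jk) x0) PGL radial_sh_diag.
- move=> k j i k' j' i' jk jk'.
  by apply: (mixed_orthonormal d_gt1 basis) => // l; have [] := eigenbasis l.
- move=> x z x0 z0; apply: (mixed_kernel_eigen_expansion d_gt1 basis) => // k.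
  by have [_ _ ->] := eigenbasis k.
Qed.
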